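(* For every integer $n\ge 1$ there exist constants $A(n)$ and $B(n)$, depending only on $n$, such that the following holds. Let $H(x,y)=y^2-x^{n+1}+\overline H(x)\in\mathbf C[x,y]$, where $\overline H\in\mathbf C[x]$ is a polynomial of degree $n-1$, and assume that $H$ is of Morse type. Let $\omega$ be a polynomial 1-form on $\mathbf C^2$ of (weighted) degree $d$, let $\delta(t)$ be a horizontal section of the homology bundle of $H$, and let $t_0\in\mathbf C$ be a regular value of $H$. If $\oint_{\delta(t)}\omega\not\equiv 0$, then $$\mathrm{ord}_{t_0}\left(\oint_{\delta(t)}\omega\right)\le A(n)+d\cdot B(n).$$
   Context: $H$ is of Morse type if all its critical points in $\mathbf C^2$ are nondegenerate and its critical values are pairwise distinct. Degrees are weighted: $x$ has weight $w_x=1$ and $y$ has weight $w_y=(n+1)/2$, a monomial $x^\alpha y^\beta$ has degree $\alpha w_x+\beta w_y$, the degree of a polynomial is the maximal degree of its monomials, and for a 1-form $\omega=P\,dx+Q\,dy$ one sets $\deg\omega=\max(\deg P+w_x,\deg Q+w_y)$. Over the complement in $\mathbf C$ of the finite set $\mathrm{crit}(H)$ of critical values, the level curves $\{H=t\}\subset\mathbf C^2$ form a locally trivial differentiable fibration. The homology bundle is the bundle over $\mathbf C\setminus\mathrm{crit}(H)$ with fibers $H_1(\{H=t\},\mathbf Z)$, equipped with the (flat) Gauss-Manin connection. A horizontal section $\delta(t)$ is a family of classes $\delta(t)\in H_1(\{H=t\},\mathbf Z)$ obtained by parallel transport (locally univalued, in general multivalued globally). The Abelian integral $\oint_{\delta(t)}\omega$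 is analytic in $t$ near any regular value $t_0$ of $H$, and $\mathrm{ord}_{t_0}$ denotes its order of vanishing at $t_0$. *)

(* Defs.v *)
From HB Require Import structures.
From mathcomp Require Import all_boot all_order all_algebra.
From mathcomp Require Import complex.
From mathcomp Require Import freeg.
From mathcomp Require Import all_classical all_reals all_analysis.

Set Implicit Arguments.
Unset Strict Implicit.
Unset Printing Implicit Defensive.

Import Order.TTheory GRing.Theory Num.Theory.
Import numFieldNormedType.Exports.
Local Open Scope classical_set_scope.
Local Open Scope quotient_scope.
Local Open Scope ring_scope.

(* The type [R[i]] itself carries no topology; through this alias it receives  *)
(* the generic one of numFieldTypes (and complex differentiability).           *)
Definition cplx (R : realType) : numClosedFieldType := R[i].

Section singular_homology.
Variable R : realType.

Definition std_simplex (k : nat) : set 'rV[R]_k.+1 :=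
  [set x | (forall i, 0 <= x ord0 i) /\ \sum_i x ord0 i = 1].
Arguments std_simplex : clear implicits.

Lemma face_subproof k (i : 'I_k.+2) (x : std_simplex k) :
  (\row_j oapp (\val x ord0) 0 (unlift i j)) \in std_simplex k.+1.
Proof.
apply/mem_set; have [x0 x1] := set_valP x; split=> [j|].
  by rewrite mxE; case: unlift => /=.
rewrite (bigD1_ord i) //= mxE unlift_none /= add0r -[RHS]x1.
by apply: eq_bigr => j _; rewrite mxE liftK.
Qed.

(* The i-th face inclusion: insert a zero at position i. *)
Definition face k (i : 'I_k.+2) (x : std_simplex k) : std_simplex k.+1 :=
  exist (fun y => y \in std_simplex k.+1) _ (face_subproof i x).

Lemma face_continuous k (i : 'I_k.+2) : continuous (@face k i).
Proof.
apply: continuous_comp_initial => x A /nbhs_ballP[e /= e0 eA].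
have : nbhs x (set_val @^-1` ball (set_val x) e).
  exact/initial_continuous/nbhsx_ballx.
move=> /(@filterS _ _ (nbhs_filter x)); apply => y [_ xy]; apply: eA.
split=> // a j; rewrite !mxE; case: unliftP => [j' _|_] /=; last exact: ballxx.
exact: xy.
Qed.

HB.instance Definition _ k (i : 'I_k.+2) :=
  isContinuous.Build _ _ (@face k i) (@face_continuous k i).

Definition simplex (k : nat) (T : topologicalType) : choiceType :=
  continuousType (std_simplex k) T.

Definition chain (k : nat) (T : topologicalType) : lmodType int :=
  {freeg (simplex k T) / int}.

Definition boundary k (T : topologicalType) : chain k.+1 T -> chain k T :=
  fglift (fun s : simplex k.+1 T =>
    \sum_(i < k.+2) (-1) ^+ i *: (<< s \o face i : simplex k T >> : chain k T)).

Definition pushforward k (T U : topologicalType) (f : continuousType T U) :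
    chain k T -> chain k U :=
  fglift (fun s : simplex k T => << f \o s : simplex k U >> : chain k U).

HB.instance Definition _ k T := Algebra.isZmodMorphism.Build _ _ (@boundary k T)
  (@lift_is_additive _ _ _ _).

HB.instance Definition _ k T U f :=
  Algebra.isZmodMorphism.Build _ _ (@pushforward k T U f)
    (@lift_is_additive _ _ _ _).

Lemma boundaryU k T (s : simplex k.+1 T) : boundary (<< s >> : chain k.+1 T) =
  \sum_(i < k.+2) (-1) ^+ i *: (<< s \o face i : simplex k T >> : chain k T).
Proof. by rewrite /boundary liftU scale1r. Qed.

Lemma pushforwardU k (T U : topologicalType) (f : continuousType T U)
    (s : simplex k T) :
  pushforward f (<< s >> : chain k T) = (<< f \o s : simplex k U >> : chain k U).
Proof. by rewrite /pushforward liftU scale1r. Qed.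

Lemma boundary_pushforward k (T U : topologicalType) (f : continuousType T U)
    (c : chain k.+1 T) :
  boundary (pushforward f c) = pushforward f (boundary c).
Proof.
have scal (V W : lmodType int) (g : {additive V -> W}) (m : int) v :
    g (m *: v) = m *: g v by rewrite -[m]intz !scaler_int raddfMz.
have genE (K : choiceType) (m : int) (x : K) :
    << m *g x >> = m *: (<< x >> : {freeg K / int}).
  by rewrite -[m in RHS]intz scaler_int freegU_mulz intz.
rewrite -[c]freeg_sumE !raddf_sum; apply: eq_bigr => s _.
rewrite genE !scal /= pushforwardU !boundaryU; congr (_ *: _).
rewrite raddf_sum; apply: eq_bigr => i _.
rewrite scal /= pushforwardU; congr (_ *: << _ >>).
exact/continuousEP.
Qed.

Definition cycle1 (T : topologicalType) := {c : chain 1 T | boundary c == 0}.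

Lemma pushforward_subproof (T U : topologicalType) (f : continuousType T U)
    (c : cycle1 T) : boundary (pushforward f (\val c)) == 0.
Proof. by rewrite boundary_pushforward (eqP (valP c)) raddf0. Qed.

Definition cycle1_pushforward (T U : topologicalType) (f : continuousType T U)
    (c : cycle1 T) : cycle1 U :=
  exist (fun d => boundary d == 0) _ (pushforward_subproof f c).

Definition homologous (T : topologicalType) (c c' : cycle1 T) : bool :=
  `[< exists b : chain 2 T, \val c - \val c' = boundary b >].

Lemma homologous_equiv T : equiv_class_of (@homologous T).
Proof.
split=> [c|c c'|c' c c''].
- by apply/asboolP; exists 0; rewrite subrr raddf0.
- by apply/asbool_equiv_eq; split=> -[b bE]; exists (- b);
    rewrite raddfN /= -bE opprB.
- move=> /asboolP[b bE] /asboolP[b' b'E]; apply/asboolP; exists (b + b').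
  by rewrite raddfD /= -bE -b'E addrA subrK.
Qed.

Canonical homologous_equiv_rel T := EquivRelPack (homologous_equiv T).

Definition H1 (T : topologicalType) := {eq_quot @homologous T}.

Definition H1_class (T : topologicalType) (c : cycle1 T) : H1 T := \pi_(H1 T) c.

(* The choice of the representative is irrelevant, by [H1_mapE].              *)
Definition H1_map (T U : topologicalType) (f : continuousType T U)
    (h : H1 T) : H1 U := H1_class (cycle1_pushforward f (repr h)).

Lemma H1_mapE (T U : topologicalType) (f : continuousType T U) (c : cycle1 T) :
  H1_map f (H1_class c) = H1_class (cycle1_pushforward f c).
Proof.
apply/eqmodP/asboolP.
have /eqmodP/asboolP[b bE] : repr (H1_class c) = c %[mod H1 T] by rewrite reprK.
by exists (pushforward f b); rewrite boundary_pushforward -bE raddfB /=.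
Qed.

End singular_homology.
Arguments std_simplex : clear implicits.

(* The inner variable of [{poly {poly C}}] is x and the outer one is y.        *)
Definition bipoly (R : realType) := {poly {poly cplx R}}.

Section level_curves.
Variable R : realType.
Local Notation C := (cplx R).
Implicit Types (F : bipoly R) (z : C * C) (t : C).

Definition bieval F z : C := F.[z.2%:P].[z.1].

Definition dx F : bipoly R := map_poly (@deriv C) F.
Definition dy F : bipoly R := deriv F.

Definition critical_point F z : Prop := bieval (dx F) z = 0 /\ bieval (dy F) z = 0.

Definition hessian F z : C :=
  bieval (dx (dx F)) z * bieval (dy (dy F)) z - bieval (dx (dy F)) z ^+ 2.

Definition morse_type F : Prop :=
  (forall z, critical_point F z -> hessian F z != 0) /\
  (forall z z', critical_point F z -> critical_point F z' ->
     z <> z' -> bieval F z <> bieval F z').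

Definition regular_value F t : Prop := ~ (bieval F @` critical_point F) t.

Definition level F t : set (C * C) := [set z | bieval F z = t].

Definition hyperelliptic (n : nat) (Hbar : {poly C}) : bipoly R :=
  'X^2 - ('X^(n.+1))%:P + Hbar%:P.

End level_curves.

Section forms.
Variable R : realType.
Local Notation C := (cplx R).
Local Open Scope ereal_scope.

Record form1 := Form1 { form_dx : bipoly R; form_dy : bipoly R }.

Definition weight_x : R := 1%R.
Definition weight_y (n : nat) : R := (n.+1%:R / 2)%R.

(* With deg 0 = -oo, so that a vanishing coefficient does not contribute to    *)
(* the degree of a form.                                                       *)
Definition wdeg (n : nat) (F : bipoly R) : \bar R :=
  \big[maxe/-oo]_(j < size F)
    \big[maxe/-oo]_(i < size F`_j | F`_j`_i != 0%R)
      (i%:R * weight_x + j%:R * weight_y n)%:E.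

Definition form_wdeg (n : nat) (w : form1) : \bar R :=
  maxe (wdeg n (form_dx w) + weight_x%:E) (wdeg n (form_dy w) + (weight_y n)%:E).

End forms.

Section integration.
Variable R : realType.
Local Notation C := (cplx R).

Definition clamp01 (s : R) : R := Num.max 0 (Num.min 1 s).

Lemma edge_subproof (s : R) :
  (\row_(j < 2) (if j == ord0 then 1 - clamp01 s else clamp01 s))
    \in std_simplex R 1.
Proof.
have c0 : 0 <= clamp01 s by rewrite le_max lexx.
have c1 : clamp01 s <= 1 by rewrite ge_max ler01 ge_min lexx.
apply/mem_set; split=> [i|].
  by rewrite mxE; case: ifP => _ //; rewrite subr_ge0.
by rewrite big_ord_recl big_ord1 !mxE /= subrK.
Qed.

(* The point (1 - s, s) of the standard 1-simplex, for s in [0, 1].            *)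
Definition edge (s : R) : std_simplex R 1 :=
  exist (fun x => x \in std_simplex R 1) _ (edge_subproof s).

Definition path_of (X : set (C * C)) (s : simplex R 1 X) (u : R) : C * C :=
  \val (s (edge u)).

(* C^1 up to the boundary of [0, 1]. *)
Definition C1_on01 (f : R -> R) : Prop :=
  exists2 f' : R -> R, {within `[0, 1], continuous f'} &
    forall u : R, 0 < u < 1 -> is_derive u 1 f (f' u).

Definition C1_path (g : R -> C * C) : Prop :=
  [/\ C1_on01 (fun u => complex.Re (g u).1), C1_on01 (fun u => complex.Im (g u).1),
      C1_on01 (fun u => complex.Re (g u).2) & C1_on01 (fun u => complex.Im (g u).2)].

Definition cderive (f : R -> C) (u : R) : C :=
  (derive1 (fun v => complex.Re (f v)) u +i*
   derive1 (fun v => complex.Im (f v)) u)%C.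

Definition cintegral01 (f : R -> C) : C :=
  ((\int[lebesgue_measure]_(u in `[0, 1]) complex.Re (f u)) +i*
   (\int[lebesgue_measure]_(u in `[0, 1]) complex.Im (f u)))%C.

Definition path_integral (w : form1 R) (g : R -> C * C) : C :=
  cintegral01 (fun u =>
    bieval (form_dx w) (g u) * cderive (fst \o g) u +
    bieval (form_dy w) (g u) * cderive (snd \o g) u).

Definition smooth_chain (X : set (C * C)) (c : chain R 1 X) : Prop :=
  forall s, s \in dom c -> C1_path (path_of s).

Definition chain_integral (X : set (C * C)) (w : form1 R) (c : chain R 1 X) : C :=
  \sum_(s <- dom c) (coeff s c)%:~R * path_integral w (path_of s).

(* [v] is the integral of [w] over the class [h], i.e., over a C^1 cycle       *)
(* representing [h].                                                           *)
Definition is_integral (X : set (C * C)) (w : form1 R) (h : H1 R X) (v : C) :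
    Prop :=
  exists c : cycle1 R X,
    [/\ H1_class c = h, smooth_chain (\val c) & v = chain_integral w (\val c)].

End integration.

Section homology_bundle.
Variable R : realType.
Local Notation C := (cplx R).
Implicit Types (F : bipoly R).

(* [Phi] is a homeomorphism, over U, from U x {F = t0} onto F^-1(U), with      *)
(* inverse z |-> (F z, Psi z), and is the identity on the fibre over t0.       *)
Definition local_trivialization F (t0 : C) (U : set C)
    (Phi : C * level F t0 -> C * C) : Prop :=
  [/\ open U, U t0,
      {within [set q | U q.1], continuous Phi},
      (forall t z, U t -> bieval F (Phi (t, z)) = t) &
      (forall z, Phi (t0, z) = \val z) /\
      exists Psi : C * C -> level F t0,
        [/\ {within bieval F @^-1` U, continuous Psi},
            (forall t z, U t -> Psi (Phi (t, z)) = z) &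
            (forall z, U (bieval F z) -> Phi (bieval F z, Psi z) = z)]].

(* The parallel transport of the Gauss-Manin connection, from the fibre over   *)
(* t0 to the fibre over t, along a local trivialization.                       *)
Definition transported F (t0 t : C) (Phi : C * level F t0 -> C * C)
    (h0 : H1 R (level F t0)) (h : H1 R (level F t)) : Prop :=
  exists2 f : continuousType (level F t0) (level F t),
    (forall z, \val (f z) = Phi (t, z)) & h = H1_map f h0.

(* A multivalued section of the homology bundle is a univalued section of its  *)
(* pull-back by a map p : E -> C, such as the universal covering of the set of *)
(* regular values of F.                                                        *)
Definition horizontal_section F (E : topologicalType) (p : E -> C)
    (delta : forall e, H1 R (level F (p e))) : Prop :=
  forall e0, exists U, exists2 Phi : C * level F (p e0) -> C * C,
    local_trivialization U Phi &
    \forall e \near e0, U (p e) /\ transported Phi (delta e0) (delta e).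

End homology_bundle.

(* The order of vanishing of f at t0, +oo if all derivatives of f vanish at t0.*)
Definition vanishing_order (R : realType) (t0 : cplx R) (f : cplx R -> cplx R) :
    \bar R :=
  ereal_inf [set (k%:R)%:E | k in [set k : nat | derive1n k f t0 != 0]].

(* Main.v *)
(* The fibres of F = f(x) + y^2 carry the integrals I_k of x^k y dx and J_k of *)
(* x^k dx / F_y, k < n, over a horizontal cycle. Local primitives along the    *)
(* nonsingular fibres reduce these integrals to increments of primitives, and  *)
(* give I_k' = J_k (Gelfand-Leray). Division by f' yields D J = M I, where D   *)
(* has no zero among the regular values, and the integral of the form omega    *)
(* equals v_0 . I, with v_0 a polynomial vector of degree linear in d. Its     *)
(* j-th derivative is v_j . I / D^j, where v_{j+1} = D v_j' + v_j M - j D' v_j *)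
(* has degree at most deg v_0 + j n.                                           *)
(* The point is that v_N is a combination of v_0, ..., v_{N-1} over C[t] for   *)
(* some N linear in d. If the first r of these vectors form a basis over C(t)  *)
(* of the space spanned by all, the next ones belong to g^-1 times the lattice *)
(* they span, g being a minor of degree linear in d; modulo this lattice the   *)
(* dimension over C is at most r deg g, so a C-linear relation occurs soon.    *)
(* The functions v_j . I, j < N, then solve a linear differential system which *)
(* is regular at the regular values: if they all vanish at one point, they     *)
(* vanish identically by connectedness. Hence ord < N.                         *)

From Pilot Require Import Defs.
From HB Require Import structures.
From mathcomp Require Import all_boot all_order all_algebra perm.
From mathcomp Require Import complex.
From mathcomp Require Import freeg.
From mathcomp Require Import all_classical all_reals all_analysis measurable_realfun.
From mathcomp Require Import ring lra zify.

Set Implicit Arguments.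
Unset Strict Implicit.
Unset Printing Implicit Defensive.

Import Order.TTheory GRing.Theory Num.Theory.
Import numFieldNormedType.Exports.
Local Open Scope classical_set_scope.
Local Open Scope ring_scope.

(** * Complex calculus *)

(** Write the curve as [y^2 + f(x) = t] with [f] of degree [n + 1]. The periods [I_k] of [x^k y dx],
    [k < n], form a vector [I] with [D I' = M I], where [D] and [M] are polynomial in [t], their
    degrees depend only on [n], and [D] has no zero at a regular value ([picard_fuchs]). Subtracting
    exact forms and using [y^2 = t - f(x)] writes the integral of the given form as [v_0 . I], with
    polynomial coefficients of degree linear in [d] ([red_form]). Its derivatives are
    [v_j . I / D^j], with [v_j] given by an explicit recursion ([derive1n_comb]).

    Suppose [v_N] is a combination of [v_0, ..., v_{N-1}] with polynomial coefficients. Then the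
    functions [v_j . I], [j < N], satisfy a linear system whose only denominator is [D]. If all of
    them vanish at one regular point, they vanish nearby ([ode_zero]), hence everywhere over a
    connected base ([chain_neq0]). A nonzero integral therefore vanishes to order less than [N]
    ([vanishing_order_bound]). A relation over the field of fractions would not do: zeros of its
    leading coefficient are apparent singularities, where uniqueness fails. [chain_stops] produces a
    relation with leading coefficient 1 and with [N] linear in [d]. All [v_j] lie in one lattice
    with a single denominator [g], a minor of the first few of them; modulo the lattice spanned by
    those few vectors, they live in a space over the constants of dimension at most [n] times the
    degree of [g], so a relation with constant coefficients appears soon.

    The analytic input is that periods may be differentiated. Cycles are singular chains and local
    trivializations are only continuous, so integrals over transported cycles are defined by
    continuing fibrewise primitives along continuous paths ([Om]). This agrees with the usual
    integral on [C^1] paths ([path_integral_Om]) and is a homology invariant ([Om_triangle]). To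
    differentiate in [t], the end points of a transported simplex are replaced by holomorphic
    sections of [F]; the corrections depend on the vertices only and cancel on cycles
    ([transport_simplex], [transport_derivative]). This gives the Gelfand-Leray formula, from which
    the differential system follows by algebra. *)

Section modulus.
Variable R : realType.
Local Notation C := (cplx R).
Implicit Types (a b c : C) (z w : C * C) (r : R).

(** The norm of [cplx R] takes values in [cplx R]; a real-valued modulus lets the estimates be
    settled in the ordered field [R]. *)
Definition nm (a : C) : R := Normc.normc (a : R[i]).

Lemma normE a : `|a| = ((nm a)%:C)%C :> C.
Proof. by rewrite /nm; case: a => x y; rewrite normc_def. Qed.

Lemma nm_ge0 a : 0 <= nm a.
Proof. by rewrite -(ler0c (nm a)) -normE. Qed.

Lemma nm0 : nm 0 = 0. Proof. exact: Normc.normc0. Qed.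

Lemma nm1 : nm 1 = 1. Proof. exact: Normc.normc1. Qed.

Lemma nm_eq0 a : (nm a == 0) = (a == 0).
Proof. by apply/eqP/eqP => [/Normc.eq0_normc|->]; last exact: nm0. Qed.

Lemma nm_gt0 a : (0 < nm a) = (a != 0).
Proof. by rewrite lt_neqAle eq_sym nm_eq0 nm_ge0 andbT. Qed.

Lemma nmM a b : nm (a * b) = nm a * nm b.
Proof. exact: Normc.normcM. Qed.

Lemma nmV a : nm a^-1 = (nm a)^-1.
Proof. exact: Normc.normcV. Qed.

Lemma nmD a b : nm (a + b) <= nm a + nm b.
Proof. exact: le_normcD. Qed.

Lemma nmN a : nm (- a) = nm a.
Proof. exact: normcN. Qed.

Lemma nmB a b : nm (a - b) <= nm a + nm b.
Proof. by rewrite -(nmN b) nmD. Qed.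

Lemma nm_sym a b : nm (a - b) = nm (b - a).
Proof. by rewrite -nmN opprB. Qed.

Lemma nmX a n : nm (a ^+ n) = nm a ^+ n.
Proof. by elim: n => [|n IH]; rewrite ?expr0 ?nm1// !exprS nmM IH. Qed.

Lemma nm_real r : nm (r%:C%C) = `|r|.
Proof. by rewrite /nm /= expr0n /= addr0 sqrtr_sqr. Qed.

Lemma nm_sum (I : Type) (s : seq I) (P : pred I) (F : I -> C) :
  nm (\sum_(i <- s | P i) F i) <= \sum_(i <- s | P i) nm (F i).
Proof.
elim/big_ind2 : _ => [|x y x' y' h h'|//]; first by rewrite nm0.
exact: le_trans (nmD _ _) (lerD h h').
Qed.

Lemma nm_Re a : `|complex.Re a| <= nm a.
Proof.
case: a => x y; rewrite /nm /= -[leLHS]sqrtr_sqr ler_wsqrtr// lerDl.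
exact: sqr_ge0.
Qed.

Lemma nm_Im a : `|complex.Im a| <= nm a.
Proof.
case: a => x y; rewrite /nm /= -[leLHS]sqrtr_sqr ler_wsqrtr// lerDr.
exact: sqr_ge0.
Qed.

Lemma nm_ReIm a : nm a <= `|complex.Re a| + `|complex.Im a|.
Proof.
case: a => x y; rewrite /nm /=.
rewrite -[leRHS]ger0_norm ?addr_ge0// -sqrtr_sqr ler_wsqrtr//.
rewrite -(real_normK (num_real x)) -(real_normK (num_real y)).
by have := normr_ge0 x; have := normr_ge0 y; nra.
Qed.

Lemma lt_nmC a r : (`|a| < r%:C%C :> C) = (nm a < r).
Proof. by rewrite normE ltcR. Qed.

Lemma nbhs_nm a (A : set C) :
  nbhs a A <-> exists2 r, 0 < r & forall b, nm (b - a) < r -> A b.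
Proof.
split=> [/nbhs_ballP[e /= e0 eA]|[r r0 rA]].
  exists (complex.Re e) => [|b ba].
    by move: e0; rewrite ltcE /= => /andP[].
  apply: eA; rewrite -ball_normE /= -opprB normrN normE.
  by move: e0; rewrite !ltcE /= ba => /andP[/eqP -> _]; rewrite eqxx.
apply/nbhs_ballP; exists (r%:C%C) => /=; first by rewrite ltcR.
by move=> b; rewrite -ball_normE /= -opprB normrN lt_nmC; exact: rA.
Qed.

Definition n2 z : R := nm z.1 + nm z.2.

Lemma n2_ge0 z : 0 <= n2 z. Proof. by rewrite addr_ge0 ?nm_ge0. Qed.

Lemma n20 : n2 0 = 0. Proof. by rewrite /n2 nm0 addr0. Qed.

Lemma n2D z w : n2 (z + w) <= n2 z + n2 w.
Proof. by rewrite /n2 addrACA; apply: lerD; exact: nmD. Qed.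

Lemma n2_fst z : nm z.1 <= n2 z. Proof. by rewrite lerDl nm_ge0. Qed.
Lemma n2_snd z : nm z.2 <= n2 z. Proof. by rewrite lerDr nm_ge0. Qed.

Lemma nbhs_n2 z (A : set (C * C)) :
  nbhs z A <-> exists2 r, 0 < r & forall w, n2 (w - z) < r -> A w.
Proof.
split=> [[[P Q] /= [/nbhs_nm[r r0 rP] /nbhs_nm[s s0 sQ]] PQA]|[r r0 rA]].
  exists (Num.min r s); first by rewrite lt_min r0.
  move=> w; rewrite lt_min => /andP[wr ws]; apply: PQA; split => /=.
    by apply: rP; apply: le_lt_trans wr; exact: (n2_fst (w - z)).
  by apply: sQ; apply: le_lt_trans ws; exact: (n2_snd (w - z)).
exists ([set a | nm (a - z.1) < r / 2], [set a | nm (a - z.2) < r / 2]) => /=.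
  by split; apply/nbhs_nm; exists (r / 2) => //; rewrite divr_gt0.
move=> w [/= w1 w2]; apply: rA; rewrite /n2 /=.
by rewrite (splitr r); apply: ltrD.
Qed.

End modulus.

(** * Mean value inequalities *)

Section mean_value.
Variable R : realType.
Local Notation C := (cplx R).

(** The set of times at which the bound holds contains its supremum, by the local estimate there; if
    the supremum were less than 1, the same estimate would put a later time in the set. *)
Lemma mean_value_ineq (phi : R -> C) (K : R) :
  (forall u, 0 <= u <= 1 -> exists2 d, 0 < d &
     forall u', 0 <= u' <= 1 -> `|u' - u| < d ->
       nm (phi u' - phi u) <= K * `|u' - u|) ->
  nm (phi 1 - phi 0) <= K.
Proof.
move=> H; pose A := [set x : R | 0 <= x <= 1 /\ nm (phi x - phi 0) <= K * x].
have A0 : A 0 by split; rewrite ?lexx ?ler01// subrr nm0 mulr0.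
have hs : has_sup A by split; [exists 0 | exists 1 => x [/andP[]]].
have s01 : 0 <= sup A <= 1.
  by rewrite (ub_le_sup hs.2 A0) ge_sup//; [exists 0 | move=> x [/andP[]]].
have [d d0 hd] := H _ s01.
have [x Ax sx] := sup_adherent d0 hs.
have xs : x <= sup A := ub_le_sup hs.2 Ax.
have As : nm (phi (sup A) - phi 0) <= K * sup A.
  have xd : `|x - sup A| < d by rewrite distrC ger0_norm ?subr_ge0//; lra.
  have := hd x Ax.1 xd; rewrite distrC ger0_norm ?subr_ge0// nm_sym => h1.
  rewrite -(subrKA (phi x)) (le_trans (nmD _ _))//.
  by have := Ax.2; lra.
move: (s01) => /andP[s0]; rewrite le_eqVlt => /orP[/eqP s1|s1].
  by move: As; rewrite s1 mulr1.
pose y := sup A + Num.min (d / 2) (1 - sup A).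
have sy : sup A < y by rewrite ltrDl lt_min subr_gt0 s1 divr_gt0.
have y1 : y <= 1 by rewrite -lerBrDl ge_min lexx orbT.
have yd : y - sup A < d.
  by rewrite /y addrC addKr gt_min; apply/orP; left; lra.
have Ay : A y.
  split; first by rewrite y1 andbT; lra.
  have /hd : 0 <= y <= 1 by rewrite y1 andbT; lra.
  rewrite ger0_norm ?subr_ge0 ?(ltW sy)// => /(_ yd) h1.
  rewrite -(subrKA (phi (sup A))) (le_trans (nmD _ _))//; lra.
by have := ub_le_sup hs.2 Ay; rewrite leNgt sy.
Qed.

Definition seg (a b : C) (u : R) : C := a + u%:C%C * (b - a).

Lemma seg0 a b : seg a b 0 = a.
Proof. by rewrite /seg mul0r addr0. Qed.

Lemma seg1 a b : seg a b 1 = b.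
Proof. by rewrite /seg mul1r addrC subrK. Qed.

Lemma segB a b u v : seg a b u - seg a b v = (u - v)%:C%C * (b - a).
Proof. by rewrite /seg rmorphB /=; ring. Qed.

Lemma seg_ball a b c (r u : R) : nm (a - c) < r -> nm (b - c) < r ->
  0 <= u <= 1 -> nm (seg a b u - c) < r.
Proof.
move=> ar br /andP[u0 u1].
have -> : seg a b u - c = (1 - u)%:C%C * (a - c) + u%:C%C * (b - c).
  by rewrite /seg rmorphB /= ; ring.
apply: le_lt_trans (nmD _ _) _; rewrite !nmM !nm_real !ger0_norm ?subr_ge0//.
have [->|un0] := eqVneq u 0; first by rewrite subr0 mul1r mul0r addr0.
have up : 0 < u by rewrite lt_def un0.
have : u * nm (b - c) < u * r by rewrite ltr_pM2l.
have : (1 - u) * nm (a - c) <= (1 - u) * r by rewrite ler_wpM2l ?subr_ge0// ltW.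
lra.
Qed.

Lemma seg_itv (a b : C) (u : R) : nm (seg a b u - a) = `|u| * nm (b - a).
Proof. by rewrite /seg addrC addKr nmM nm_real. Qed.

Lemma mean_value_seg (f f' : C -> C) (S : set C) (a b : C) (K : R) :
  (forall u, 0 <= u <= 1 -> S (seg a b u)) ->
  (forall x, S x -> forall e : R, 0 < e -> exists2 d, 0 < d & forall y, S y ->
     nm (y - x) < d -> nm (f y - f x - f' x * (y - x)) <= e * nm (y - x)) ->
  (forall u, 0 <= u <= 1 -> nm (f' (seg a b u)) <= K) ->
  nm (f b - f a) <= K * nm (b - a).
Proof.
(* The slack [e] pays for the remainder of the expansion of [f], rescaled by [n + 1] because the
   parameter runs over an interval of length 1. *)
move=> abS Hf HK; apply/ler_addgt0Pr => e e0.
have := @mean_value_ineq (fun u => f (seg a b u)) (K * nm (b - a) + e).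
rewrite seg1 seg0; apply => u u01.
pose n := nm (b - a); have n0 : 0 <= n by exact: nm_ge0.
have n1 : 0 < n + 1 by rewrite ltr_wpDl.
have [d d0 Hd] := Hf _ (abS _ u01) _ (divr_gt0 e0 n1).
exists (d / (n + 1)); first exact: divr_gt0.
move=> u' u'01; rewrite ltr_pdivlMr// => ud.
have E : nm (seg a b u' - seg a b u) = `|u' - u| * n by rewrite segB nmM nm_real.
have := Hd _ (abS _ u'01); rewrite E => H1.
rewrite -[f (seg a b u') - _](subrK (f' (seg a b u) * (seg a b u' - seg a b u))).
apply: le_trans (nmD _ _) _.
have h1 : `|u' - u| * n < d.
  by apply: le_lt_trans ud; rewrite ler_wpM2l// lerDl.
have h3 : nm (f' (seg a b u) * (seg a b u' - seg a b u)) <= K * n * `|u' - u|.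
  by rewrite nmM E -[leRHS]mulrA (mulrC n) ler_wpM2r ?mulr_ge0//; apply: HK.
have h2 : e / (n + 1) * (`|u' - u| * n) <= e * `|u' - u|.
  have -> : e / (n + 1) * (`|u' - u| * n) = (e * `|u' - u|) * (n / (n + 1)) by ring.
  by rewrite ler_piMr ?mulr_ge0 ?(ltW e0)// ler_pdivrMr// mul1r lerDl.
by have := H1 h1; rewrite mulrDl -/n; lra.
Qed.

Lemma mean_value_seg2 (f f' : C -> C) (S : set C) (a b : C) (K : R) :
  (forall u, 0 <= u <= 1 -> S (seg a b u)) ->
  (forall x, S x -> exists M : R, forall y, S y ->
     nm (f y - f x - f' x * (y - x)) <= M * nm (y - x) ^+ 2) ->
  (forall u, 0 <= u <= 1 -> nm (f' (seg a b u)) <= K) ->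
  nm (f b - f a) <= K * nm (b - a).
Proof.
move=> abS Hf HK; apply: (mean_value_seg abS _ HK) => x Sx e e0.
have [M HM] := Hf _ Sx; have M1 : 0 < `|M| + 1 by rewrite ltr_wpDl.
exists (e / (`|M| + 1)) => [|y Sy]; first exact: divr_gt0.
rewrite ltr_pdivlMr// => yx; apply: le_trans (HM _ Sy) _.
rewrite expr2 mulrA ler_wpM2r ?nm_ge0//.
by have := ler_norm M; have := nm_ge0 (y - x); nra.
Qed.

End mean_value.

(** * Uniform complex differentiability with quadratic error *)

Section quadratic_differentiability.
Variable R : realType.
Local Notation C := (cplx R).
Implicit Types (S : set C) (g h k : C -> C) (M : R).

(* g is bounded on S, with a bounded derivative g1 and a uniformly quadratic  *)
(* error term.                                                                *)
Definition cd S g g1 := exists M : R, [/\ 0 <= M,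
  forall a, S a -> nm (g a) <= M, forall a, S a -> nm (g1 a) <= M &
  forall a b, S a -> S b -> nm (g b - g a - g1 a * (b - a)) <= M * nm (b - a) ^+ 2].

Lemma nmD3 (a b c : C) (x y z : R) : nm a <= x -> nm b <= y -> nm c <= z ->
  nm (a + b + c) <= x + y + z.
Proof.
move=> ax bY cz; apply: le_trans (nmD _ _) _; apply: lerD => //.
exact: le_trans (nmD _ _) (lerD ax bY).
Qed.

Lemma nmM_le (a b : C) (x y : R) : nm a <= x -> nm b <= y -> nm (a * b) <= x * y.
Proof. by move=> ax bY; rewrite nmM ler_pM ?nm_ge0. Qed.

(** For points at distance at most 1 the quadratic error is dominated by a linear one; for points
    further apart the bound on [g] is enough. *)
Lemma cd_lip S g g1 : cd S g g1 -> exists2 L, 0 <= L &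
  forall a b, S a -> S b -> nm (g b - g a) <= L * nm (b - a).
Proof.
move=> [M [M0 gM g1M gq]]; exists (2 * M) => [|a b Sa Sb]; first exact: mulr_ge0.
have n0 := nm_ge0 (b - a).
have [n1|n1] := leP (nm (b - a)) 1.
  rewrite -[g b - _](subrK (g1 a * (b - a))).
  apply: le_trans (nmD _ _) _; have := gq _ _ Sa Sb.
  have : nm (g1 a * (b - a)) <= M * nm (b - a) by apply: nmM_le => //; exact: g1M.
  have : 0 <= M * nm (b - a) * (1 - nm (b - a)).
    by rewrite !mulr_ge0 ?subr_ge0.
  by rewrite expr2; lra.
apply: le_trans (nmB _ _) _; have := gM _ Sa; have := gM _ Sb.
have : 0 <= M * (nm (b - a) - 1) by rewrite mulr_ge0 ?subr_ge0 ?(ltW n1).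
by lra.
Qed.

Lemma cd_ext S g g1 k k1 : (forall a, S a -> g a = k a) ->
  (forall a, S a -> g1 a = k1 a) -> cd S g g1 -> cd S k k1.
Proof.
move=> E E1 [M [M0 gM g1M gq]]; exists M; split=> // [a|a|a b] Sa.
- by rewrite -E// gM.
- by rewrite -E1// g1M.
- by move=> Sb; rewrite -!E// -E1// gq.
Qed.

Lemma cd_cst S (c : C) : cd S (fun=> c) (fun=> 0).
Proof.
exists (nm c); split=> [|//|a _|a b _ _]; rewrite ?nm_ge0 ?nm0 ?nm_ge0//.
by rewrite mul0r !subrr nm0 mulr_ge0 ?nm_ge0 ?exprn_ge0 ?nm_ge0.
Qed.

Lemma cd_id S (K : R) : (forall a, S a -> nm a <= K) -> cd S id (fun=> 1).
Proof.
move=> SK; exists (`|K| + 1); split=> [|a Sa|a Sa|a b _ _].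
- by rewrite addr_ge0.
- by rewrite (le_trans (SK _ Sa))// (le_trans (ler_norm _))// lerDl.
- by rewrite nm1 lerDr.
- by rewrite mul1r subrr nm0 mulr_ge0 ?addr_ge0 ?exprn_ge0 ?nm_ge0.
Qed.

Lemma cdD S g g1 k k1 : cd S g g1 -> cd S k k1 ->
  cd S (fun a => g a + k a) (fun a => g1 a + k1 a).
Proof.
move=> [M [M0 gM g1M gq]] [N [N0 kM k1M kq]]; exists (M + N).
split=> [|a Sa|a Sa|a b Sa Sb]; first exact: addr_ge0.
- by apply: le_trans (nmD _ _) _; rewrite lerD ?gM ?kM.
- by apply: le_trans (nmD _ _) _; rewrite lerD ?g1M ?k1M.
- have -> : g b + k b - (g a + k a) - (g1 a + k1 a) * (b - a) =
    (g b - g a - g1 a * (b - a)) + (k b - k a - k1 a * (b - a)) by ring.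
  by apply: le_trans (nmD _ _) _; rewrite mulrDl lerD ?gq ?kq.
Qed.

Lemma cdM S g g1 k k1 : cd S g g1 -> cd S k k1 ->
  cd S (fun a => g a * k a) (fun a => g1 a * k a + g a * k1 a).
Proof.
move=> cg ck; have [L L0 kL] := cd_lip ck.
case: cg ck => [M [M0 gM g1M gq]] [N [N0 kM k1M kq]].
exists (M * N + M * L + M * N).
split=> [|a Sa|a Sa|a b Sa Sb]; first by rewrite !addr_ge0 ?mulr_ge0.
- apply: le_trans (nmM_le (gM _ Sa) (kM _ Sa)) _.
  by rewrite -addrA lerDl addr_ge0 ?mulr_ge0.
- apply: le_trans (nmD _ _) _.
  have h1 := nmM_le (g1M _ Sa) (kM _ Sa); have h2 := nmM_le (gM _ Sa) (k1M _ Sa).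
  by have := mulr_ge0 M0 L0; lra.
- have -> : g b * k b - g a * k a - (g1 a * k a + g a * k1 a) * (b - a) =
    (g b - g a - g1 a * (b - a)) * k b + g1 a * (b - a) * (k b - k a)
    + g a * (k b - k a - k1 a * (b - a)) by ring.
  have h1 := nmM_le (gq _ _ Sa Sb) (kM _ Sb).
  have h2 := nmM_le (nmM_le (g1M _ Sa) (lexx (nm (b - a)))) (kL _ _ Sa Sb).
  have h3 := nmM_le (gM _ Sa) (kq _ _ Sa Sb).
  apply: le_trans (nmD3 h1 h2 h3) _.
  by rewrite le_eqVlt; apply/orP; left; apply/eqP; ring.
Qed.

Lemma cdV S g g1 (c : R) : 0 < c -> (forall a, S a -> c <= nm (g a)) -> cd S g g1 ->
  cd S (fun a => (g a)^-1) (fun a => - g1 a * (g a)^-1 ^+ 2).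
Proof.
move=> c0 gc cg; have [L L0 gL] := cd_lip cg.
case: cg => [M [M0 gM g1M gq]].
have gn a : S a -> g a != 0 by move=> /gc; rewrite -nm_gt0; exact: lt_le_trans.
have gi a : S a -> nm (g a)^-1 <= c^-1.
  by move=> Sa; rewrite nmV lef_pV2 ?posrE ?nm_gt0 ?gn ?gc.
have ci : 0 <= c^-1 by rewrite invr_ge0 ltW.
exists (c^-1 + M * c^-1 ^+ 2 + (M * M + M * L) * (c^-1 * c^-1 * c^-1)).
split=> [|a Sa|a Sa|a b Sa Sb].
- by rewrite !addr_ge0 ?mulr_ge0 ?exprn_ge0 ?addr_ge0 ?mulr_ge0.
- apply: le_trans (gi _ Sa) _.
  by rewrite -addrA lerDl addr_ge0 ?mulr_ge0 ?exprn_ge0 ?addr_ge0 ?mulr_ge0.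
- rewrite mulNr nmN expr2.
  have := nmM_le (g1M _ Sa) (nmM_le (gi _ Sa) (gi _ Sa)); rewrite -expr2.
  have : 0 <= (M * M + M * L) * (c^-1 * c^-1 * c^-1).
    by rewrite ?mulr_ge0 ?addr_ge0 ?mulr_ge0.
  lra.
- have -> : (g b)^-1 - (g a)^-1 - - g1 a * (g a)^-1 ^+ 2 * (b - a) =
     (- (g b - g a - g1 a * (b - a)) * g a + g1 a * (b - a) * (g b - g a)) *
       ((g a)^-1 * (g a)^-1 * (g b)^-1).
    by have := gn _ Sa; have := gn _ Sb => h1 h2; field; rewrite h1 h2.
  have h0 := gq _ _ Sa Sb; rewrite -nmN in h0.
  have h1 := nmM_le h0 (gM _ Sa).
  have h2 := nmM_le (nmM_le (g1M _ Sa) (lexx (nm (b - a)))) (gL _ _ Sa Sb).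
  have h3 := nmM_le (nmM_le (gi _ Sa) (gi _ Sa)) (gi _ Sb).
  have h4 := nmM_le (le_trans (nmD _ _) (lerD h1 h2)) h3.
  apply: le_trans h4 _; set n := nm (b - a); set e := c^-1 in ci *.
  have n0 : 0 <= n ^+ 2 by rewrite exprn_ge0 ?nm_ge0.
  rewrite [leRHS]mulrDl -[leLHS]add0r; apply: lerD.
    apply: mulr_ge0 => //; apply: addr_ge0 => //.
    by apply: mulr_ge0 => //; exact: exprn_ge0.
  by rewrite le_eqVlt; apply/orP; left; apply/eqP; ring.
Qed.

Lemma cd_comp S S' g g1 k k1 : (forall a, S a -> S' (k a)) ->
  cd S' g g1 -> cd S k k1 ->
  cd S (fun a => g (k a)) (fun a => g1 (k a) * k1 a).
Proof.
move=> SS cg ck; have [L L0 kL] := cd_lip ck.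
case: cg ck => [M [M0 gM g1M gq]] [N [N0 kM k1M kq]].
exists (M + M * N + M * L ^+ 2).
have p1 : 0 <= M * N by rewrite mulr_ge0.
have p2 : 0 <= M * L ^+ 2 by rewrite mulr_ge0 ?exprn_ge0.
split=> [|a Sa|a Sa|a b Sa Sb]; first by rewrite !addr_ge0.
- by have := gM _ (SS _ Sa); lra.
- by have := nmM_le (g1M _ (SS _ Sa)) (k1M _ Sa); lra.
- have -> : g (k b) - g (k a) - g1 (k a) * k1 a * (b - a) =
    (g (k b) - g (k a) - g1 (k a) * (k b - k a)) +
    g1 (k a) * (k b - k a - k1 a * (b - a)) by ring.
  have h1 := gq _ _ (SS _ Sa) (SS _ Sb).
  have h2 := nmM_le (g1M _ (SS _ Sa)) (kq _ _ Sa Sb).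
  have h3 := kL _ _ Sa Sb.
  apply: le_trans (nmD _ _) _; apply: le_trans (lerD h1 h2) _.
  have h4 : M * nm (k b - k a) ^+ 2 <= M * (L * nm (b - a)) ^+ 2.
    by rewrite ler_wpM2l// lerXn2r ?nnegrE ?nm_ge0// mulr_ge0 ?nm_ge0.
  have : 0 <= M * nm (b - a) ^+ 2 by rewrite mulr_ge0 ?exprn_ge0 ?nm_ge0.
  by move: h4; rewrite exprMn !mulrDl !mulrA; lra.
Qed.

Lemma cdX S g g1 n : cd S g g1 ->
  exists k1, cd S (fun a => g a ^+ n) k1 /\ forall a, k1 a = n%:R * g a ^+ n.-1 * g1 a.
Proof.
move=> cg; exists (fun a => n%:R * g a ^+ n.-1 * g1 a); split=> //.
elim: n => [|n IH].
  apply: cd_ext (cd_cst S 1) => a _; first by rewrite expr0.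
  by rewrite !mul0r.
apply: cd_ext (cdM cg IH) => a _; first by rewrite exprS.
case: n {IH} => [|n] /=; first by rewrite expr0; ring.
by rewrite !exprS -!natr1; ring.
Qed.

Lemma cd_poly S (K : R) (p : {poly C}) : (forall a, S a -> nm a <= K) ->
  cd S (horner p) (horner p^`()).
Proof.
move=> SK; elim/poly_ind: p => [|p c IH].
  by apply: cd_ext (cd_cst S 0) => a _; rewrite ?deriv0 hornerC.
apply: cd_ext (cdD (cdM IH (cd_id SK)) (cd_cst S c)) => a _.
  by rewrite !hornerE.
by rewrite derivMXaddC !hornerE; ring.
Qed.

End quadratic_differentiability.

(** * Local inverses of polynomials *)

Section local_inverse.
Variable R : realType.
Local Notation C := (cplx R).

Definition disc (c : C) (r : R) : set C := [set a | nm (a - c) < r].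

Lemma disc_bounded (c : C) (r : R) a : disc c r a -> nm a <= r + nm c.
Proof.
rewrite /disc /= => h; rewrite -(subrK c a) (le_trans (nmD _ _))//.
by rewrite lerD2r ltW.
Qed.

(** [b - w] splits into linear factors. If every root were at distance at least [r] from [v], the
    product of the factors at [v] would be too large. *)
Lemma poly_close_root (b : {poly C}) (v w : C) (r : R) : 0 < r -> (1 < size b)%N ->
  nm (b.[v] - w) < nm (lead_coef b) * r ^+ (size b).-1 ->
  exists2 u, b.[u] = w & nm (u - v) < r.
Proof.
move=> r0 sb bw; pose p := b - w%:P.
have sp : size p = size b.
  by rewrite size_polyDl// size_polyN (leq_ltn_trans (size_polyC_leq1 _)).
have lp : lead_coef p = lead_coef b.
  by rewrite lead_coefDl// size_polyN (leq_ltn_trans (size_polyC_leq1 _)).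
have [s ps] := closed_field_poly_normal p.
have ss : size s = (size b).-1.
  have p0 : lead_coef p != 0 by rewrite lead_coef_eq0 -size_poly_gt0 sp (ltn_trans _ sb).
  have := sp; rewrite ps size_scale// size_prod_XsubC => <-.
  by [].
have [/hasP[u us ur]|/hasPn H] := boolP (has (fun u => nm (u - v) < r) s).
  exists u => //; have : root p u.
    rewrite ps rootE hornerZ horner_prod (big_rem u)//= hornerXsubC subrr.
    by rewrite mul0r mulr0.
  by rewrite rootE !hornerE subr_eq0 => /eqP.
suff : nm (lead_coef b) * r ^+ (size b).-1 <= nm (b.[v] - w).
  by rewrite leNgt bw.
have -> : b.[v] - w = p.[v] by rewrite !hornerE.
rewrite ps lp hornerZ nmM ler_wpM2l ?nm_ge0// -ss horner_prod.
elim: s H {ps ss} => [_|u s IH H]; first by rewrite big_nil nm1.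
rewrite big_cons exprS nmM hornerXsubC ler_pM ?exprn_ge0 ?(ltW r0)//.
  by have := H u (mem_head _ _); rewrite -leNgt nm_sym.
by apply: IH => x xs; apply: H; rewrite in_cons xs orbT.
Qed.

(** Preimages exist by [poly_close_root], so no fixed point argument is involved. They are unique
    because [b] expands distances by a definite factor on a small disc, and the same factor turns
    the quadratic error of [b] into one for the inverse. *)
Lemma local_inverse (b : {poly C}) (v0 : C) (R0 : R) :
  0 < R0 -> b^`().[v0] != 0 ->
  exists r rho c (V : C -> C), [/\ [/\ 0 < r, r <= R0, 0 < rho & 0 < c],
    (forall v, disc v0 r v -> c <= nm b^`().[v]),
    (forall w, disc b.[v0] rho w -> b.[V w] = w /\ disc v0 r (V w)),
    (forall v, disc v0 r v -> disc b.[v0] rho b.[v] -> V b.[v] = v) &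
    cd (disc b.[v0] rho) V (fun w => (b^`().[V w])^-1)].
Proof.
move=> R00 b0; pose D := disc v0 1.
have DK : forall a, D a -> nm a <= 1 + nm v0 by move=> a /disc_bounded.
have [L L0 bL] := cd_lip (cd_poly b^`() DK).
have [M [M0 _ _ bM]] := cd_poly b DK.
pose c := nm b^`().[v0] / 2.
have c0 : 0 < c by rewrite divr_gt0// nm_gt0.
(* The bound by [c / (L + 1)] keeps the derivative of modulus at least [c] on the disc; the one by
   [c / (4 * (M + 1))] makes the quadratic error at most half of the linear term. *)
pose r := Num.min (Num.min R0 1) (Num.min (c / (L + 1)) (c / (4 * (M + 1)))).
have M1 : 0 < 4 * (M + 1) by rewrite mulr_gt0// ltr_wpDl.
have r0 : 0 < r.
  have L1 : 0 < L + 1 by rewrite ltr_wpDl.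
  by rewrite !lt_min R00 ltr01/= (divr_gt0 c0 L1) (divr_gt0 c0 M1).
have rR0 : r <= R0 by rewrite !ge_min lexx.
have r1 : r <= 1 by rewrite !ge_min lexx orbT.
have rL : r * (L + 1) <= c by rewrite -ler_pdivlMr ?ltr_wpDl// !ge_min lexx !orbT.
have rM : r * (4 * (M + 1)) <= c by rewrite -ler_pdivlMr// !ge_min lexx !orbT.
have Dv0 : D v0 by rewrite /D /disc /= subrr nm0.
have rD v : disc v0 r v -> D v by move=> h; exact: lt_le_trans h r1.
have cb v : disc v0 r v -> c <= nm b^`().[v].
  move=> vr; have := bL _ _ Dv0 (rD _ vr).
  have : nm b^`().[v0] <= nm b^`().[v] + nm (b^`().[v] - b^`().[v0]).
    by rewrite nm_sym -{1}(subrK b^`().[v] b^`().[v0]) addrC nmD.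
  have : L * nm (v - v0) <= L * r by rewrite ler_wpM2l// ltW.
  have : nm b^`().[v0] = 2 * c by rewrite /c mulrC divfK.
  lra.
have inj v v' : disc v0 r v -> disc v0 r v' ->
    nm (v' - v) * (c / 2) <= nm (b.[v'] - b.[v]).
  move=> vr v'r; have := bM _ _ (rD _ vr) (rD _ v'r).
  have h : nm (v' - v) <= 2 * r.
    have -> : v' - v = (v' - v0) - (v - v0) by ring.
    rewrite (le_trans (nmB _ _))// mulr2n mulrDl mul1r.
    by rewrite lerD// ltW.
  have : nm (b^`().[v] * (v' - v)) <=
      nm (b.[v'] - b.[v]) + nm (b.[v'] - b.[v] - b^`().[v] * (v' - v)).
    by rewrite -{1}(subKr (b.[v'] - b.[v]) (b^`().[v] * (v' - v))) nmB.
  rewrite nmM => h1 h2.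
  have h3 : c * nm (v' - v) <= nm b^`().[v] * nm (v' - v).
    by rewrite ler_wpM2r ?nm_ge0 ?cb.
  have : M * nm (v' - v) ^+ 2 <= nm (v' - v) * (c / 2).
    rewrite expr2 mulrCA ler_wpM2l ?nm_ge0//.
    have : M * nm (v' - v) <= M * (2 * r) by rewrite ler_wpM2l.
    by move: rM; lra.
  lra.
have sb : (1 < size b)%N.
  rewrite ltnNge; apply: contra b0 => /size1_polyC ->.
  by rewrite derivC horner0.
have lb : 0 < nm (lead_coef b).
  by rewrite nm_gt0 lead_coef_eq0 -size_poly_gt0 (ltn_trans _ sb).
(* Exactly the radius for which [poly_close_root] puts a preimage in the disc of radius [r]. *)
pose rho := nm (lead_coef b) * r ^+ (size b).-1.
have rho0 : 0 < rho by rewrite mulr_gt0 ?exprn_gt0.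
pose V w := xget v0 [set v | b.[v] = w /\ disc v0 r v].
have VE w : disc b.[v0] rho w -> b.[V w] = w /\ disc v0 r (V w).
  rewrite /disc /= nm_sym => wr.
  have [u bu ur] := poly_close_root r0 sb wr.
  by rewrite /V; case: xgetP => [v _ //|/(_ u) []].
exists r, rho, c, V; split=> //.
  move=> v vr /VE[bV Vr]; apply/eqP; rewrite -subr_eq0 -nm_eq0.
  have := inj _ _ vr Vr; rewrite bV subrr nm0 => h.
  by apply/eqP/le_anti; rewrite nm_ge0 andbT; have := nm_ge0 (V b.[v] - v); nra.
have cV w : disc b.[v0] rho w -> nm (b^`().[V w])^-1 <= c^-1.
  move=> /VE[_ Vr]; rewrite nmV lef_pV2 ?posrE ?cb//.
  exact: lt_le_trans (cb _ Vr).
have ci : 0 <= c^-1 by rewrite invr_ge0 ltW.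
exists (r + nm v0 + c^-1 + M * (2 / c) ^+ 2 * c^-1).
have p1 : 0 <= M * (2 / c) ^+ 2 * c^-1.
  by rewrite !mulr_ge0// ?exprn_ge0 ?divr_ge0// ltW.
have p2 : 0 <= r + nm v0 by rewrite addr_ge0 ?nm_ge0 ?ltW.
split=> [|w /VE[_ /disc_bounded]|w wr|w w' wr w'r].
- by apply: addr_ge0 => //; apply: addr_ge0.
- lra.
- by have := cV _ wr; lra.
have [bV Vr] := VE _ wr; have [bV' Vr'] := VE _ w'r.
have h := inj _ _ Vr Vr'; rewrite bV bV' in h.
have d0 : b^`().[V w] != 0.
  by rewrite -nm_gt0; exact: lt_le_trans (cb _ Vr).
have -> : V w' - V w - (b^`().[V w])^-1 * (w' - w) =
   - (b.[V w'] - b.[V w] - b^`().[V w] * (V w' - V w)) * (b^`().[V w])^-1.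
  by rewrite bV bV'; field.
have h1 := bM _ _ (rD _ Vr) (rD _ Vr'); rewrite -nmN in h1.
apply: le_trans (nmM_le h1 (cV _ wr)) _.
have h2 : nm (V w' - V w) <= (2 / c) * nm (w' - w).
  rewrite mulrAC ler_pdivlMr//; lra.
have h3 : M * nm (V w' - V w) ^+ 2 * c^-1 <= M * ((2 / c) * nm (w' - w)) ^+ 2 * c^-1.
  rewrite ler_wpM2r// ler_wpM2l// lerXn2r ?nnegrE ?nm_ge0// mulr_ge0 ?nm_ge0//.
  by rewrite divr_ge0 ?ltW.
apply: le_trans h3 _; rewrite exprMn.
have -> : M * ((2 / c) ^+ 2 * nm (w' - w) ^+ 2) * c^-1 =
  (M * (2 / c) ^+ 2 * c^-1) * nm (w' - w) ^+ 2 by ring.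
rewrite ler_wpM2r ?exprn_ge0 ?nm_ge0//; lra.
Qed.

End local_inverse.

(** * First-order expansions and real antiderivatives *)

Section derivatives.

Lemma is_derive_expansion (K : numFieldType) (f : K -> K) (x df : K) :
  is_derive x 1 f df <->
  forall e, 0 < e -> exists2 d, 0 < d &
    forall y, `|y - x| < d -> `|f y - f x - df * (y - x)| <= e * `|y - x|.
Proof.
split=> [[dv dfE] e e0|H].
  have : (fun h => h^-1 *: ((f \o shift x) (h *: 1) - f x)) @ 0^' --> df.
    by rewrite -dfE; exact: dv.
  move=> /cvgrPdist_lt/(_ _ e0) /nbhs_ballP[d /= d0 dH].
  exists d => // y yx; have [->|ynx] := eqVneq y x.
    by rewrite !subrr mulr0 subr0 normr0 mulr0.
  have h0 : y - x != 0 by rewrite subr_eq0.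
  have := dH (y - x); rewrite -ball_normE /= sub0r normrN => /(_ yx h0).
  rewrite /= scaler1 subrK => /ltW h.
  have -> : f y - f x - df * (y - x) =
      - (df - (y - x)^-1 *: (f y - f x)) * (y - x).
    by rewrite mulNr mulrBl opprB /GRing.scale /= mulrAC mulVf// mul1r.
  by rewrite normrM normrN ler_wpM2r.
have c : (fun h => h^-1 *: ((f \o shift x) (h *: 1) - f x)) @ 0^' --> df.
  apply/cvgrPdist_le => e e0; have [d d0 dH] := H _ e0.
  apply/nbhs_ballP; exists d => //= h; rewrite -ball_normE /= sub0r normrN => hd h0.
  have := dH (h + x); rewrite addrK => /(_ hd).
  rewrite /= scaler1 => hh.
  have -> : df - h^-1 *: (f (h + x) - f x) = - (f (h + x) - f x - df * h) / h.
    by rewrite /GRing.scale /=; field.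
  by rewrite normrM normrN normfV ler_pdivrMr ?normr_gt0.
apply: DeriveDef; first by apply/cvg_ex; exists df.
exact: (cvg_lim _ c).
Qed.

Variable R : realType.
Local Notation C := (cplx R).

Lemma quadratic_is_derive (f : C -> C) (a df : C) (K : R) :
  (\forall b \near a, nm (f b - f a - df * (b - a)) <= K * nm (b - a) ^+ 2) ->
  is_derive a 1 f df.
Proof.
move=> /nbhs_nm[r r0 rH]; apply/is_derive_expansion => e e0.
have [e' e'0 ->] : exists2 e' : R, 0 < e' & e = e'%:C%C.
  case: e e0 => x y; rewrite ltcE /= => /andP[/eqP -> x0]; by exists x.
have K1 : 0 < `|K| + 1 by rewrite ltr_wpDl.
exists ((Num.min r (e' / (`|K| + 1)))%:C%C); first by rewrite ltcR lt_min r0 divr_gt0.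
move=> b; rewrite lt_nmC lt_min ltr_pdivlMr// => /andP[br bK].
rewrite !normE -rmorphM lecR; apply: le_trans (rH _ br) _.
rewrite expr2 mulrA ler_wpM2r ?nm_ge0//.
have := ler_norm K; have := nm_ge0 (b - a); nra.
Qed.

Lemma continuous_antiderivative (k : R -> R) : continuous k ->
  exists F : R -> R, forall u : R, 0 <= u <= 1 -> is_derive u 1 F (k u).
Proof.
(* Integrating from -1 makes 0 an interior point, so that the derivative there is two-sided. *)
move=> ck; exists (fun x => \int[lebesgue_measure]_(t in `[(-1)%R, x]) k t) => u u01.
have u2 : u < 2 by lra.
have [||d dE] := @continuous_FTC1_closed R k (-1) u 2 u2 _ _ (ck u); last 1 first.
- by apply: DeriveDef => //; rewrite -derive1E.
- apply: continuous_compact_integrable; first exact: segment_compact.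
  exact: continuous_subspaceT.
- lra.
Qed.

Lemma clamp01_01 (u : R) : 0 <= clamp01 u <= 1.
Proof. by rewrite /clamp01 le_max lexx ge_max ler01 ge_min lexx. Qed.

Lemma clamp01_id (u : R) : 0 <= u <= 1 -> clamp01 u = u.
Proof. by move=> /andP[u0 u1]; rewrite /clamp01 min_r// max_r. Qed.

Lemma clamp01_lip (u v : R) : `|clamp01 u - clamp01 v| <= `|u - v|.
Proof.
rewrite /clamp01 /Num.max /Num.min.
have [|] := ltP 1 u; have [|] := ltP 1 v; have [|] := ltP 0 u; have [|] := ltP 0 v;
  rewrite ?ltr01 => *; rewrite ?subrr ?normr0 ?normr_ge0//;
  rewrite ler_norml; apply/andP; split;
  try (have := ler_norm (u - v)); try (have := ler_norm (v - u)); rewrite ?(distrC v u); lra.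
Qed.

Lemma lipschitz_continuous (f : R -> R) (L : R) :
  (forall u v, `|f u - f v| <= L * `|u - v|) -> continuous f.
Proof.
move=> H u; apply/cvgrPdist_lt => e e0; near=> v.
apply: le_lt_trans (H _ _) _.
have L1 : 0 < `|L| + 1 by rewrite ltr_wpDl.
have : `|u - v| * (`|L| + 1) < e.
  rewrite -ltr_pdivlMr//; near: v.
  by apply: cvgr_dist_lt; [exact: cvg_id|rewrite divr_gt0].
by have := ler_norm L; have := normr_ge0 (u - v); nra.
Unshelve. all: by end_near. Qed.

End derivatives.

(** * Primitives of holomorphic functions on a disc *)

Section primitive.
Variable R : realType.
Local Notation C := (cplx R).

Lemma complex_antiderivative (k : R -> C) (L : R) :
  (forall u v, nm (k u - k v) <= L * `|u - v|) ->
  exists2 F : R -> C, F 0 = 0 & forall u : R, 0 <= u <= 1 -> forall e : R, 0 < e ->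
    exists2 d, 0 < d & forall v : R, `|v - u| < d ->
      nm (F v - F u - (v - u)%:C%C * k u) <= e * `|v - u|.
Proof.
move=> kL.
have [|A dA] := @continuous_antiderivative R (fun u => complex.Re (k u)).
  apply: (@lipschitz_continuous _ _ L) => u v; apply: le_trans (kL u v).
  by apply: le_trans (nm_Re (k u - k v)); case: (k u) (k v) => [? ?] [? ?].
have [|B dB] := @continuous_antiderivative R (fun u => complex.Im (k u)).
  apply: (@lipschitz_continuous _ _ L) => u v; apply: le_trans (kL u v).
  by apply: le_trans (nm_Im (k u - k v)); case: (k u) (k v) => [? ?] [? ?].
exists (fun u => ((A u - A 0) +i* (B u - B 0))%C); first by rewrite !subrr.
move=> u u01 e e0; have e2 : 0 < e / 2 by rewrite divr_gt0.
have /is_derive_expansion/(_ _ e2)[d1 d10 H1] := dA _ u01.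
have /is_derive_expansion/(_ _ e2)[d2 d20 H2] := dB _ u01.
exists (Num.min d1 d2); first by rewrite lt_min d10.
move=> v; rewrite lt_min => /andP[/H1{}H1 /H2{}H2].
apply: le_trans (nm_ReIm _) _.
rewrite (splitr e) mulrDl; apply: lerD.
  apply: le_trans H1; case: (k u) => x y /=; rewrite mul0r subr0.
  by rewrite le_eqVlt; apply/orP; left; apply/eqP; congr `|_|; ring.
apply: le_trans H2; case: (k u) => x y /=; rewrite mul0r addr0.
by rewrite le_eqVlt; apply/orP; left; apply/eqP; congr `|_|; ring.
Qed.

(** [G a] is the integral of [g] along the segment from [c] to [a]. To compare [G a] and [G b], the
    mean value inequality is applied to the difference of the two radial integrals, minus
    [u (b - a) g] at the point of parameter [u] on the first segment. Its derivative is quadratic in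
    [b - a] because [g] is complex differentiable: this is Cauchy's theorem on a disc. *)
Lemma primitive_disc (c : C) (r : R) (g g1 : C -> C) : 0 < r ->
  cd (disc c r) g g1 ->
  exists G K, [/\ 0 <= K, G c = 0 & forall a b, disc c r a -> disc c r b ->
    nm (G b - G a - g a * (b - a)) <= K * nm (b - a) ^+ 2].
Proof.
move=> r0 cg; have [L L0 gL] := cd_lip cg.
case: cg => [M [M0 gM g1M gq]].
have cr : disc c r c by rewrite /disc /= subrr nm0.
have segr a u : disc c r a -> 0 <= u <= 1 -> disc c r (seg c a u).
  by move=> ar u01; apply: seg_ball.
(* Clamping leaves the integrand unchanged on the unit interval and makes it Lipschitz on the whole
   line, as [complex_antiderivative] requires. *)
pose k a u := (a - c) * g (seg c a (clamp01 u)).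
have kE a u : 0 <= u <= 1 -> k a u = (a - c) * g (seg c a u).
  by move=> u01; rewrite /k clamp01_id.
have H a : exists F : R -> C, disc c r a -> F 0 = 0 /\
    forall u : R, 0 <= u <= 1 -> forall e : R, 0 < e ->
    exists2 d, 0 < d & forall v : R, `|v - u| < d ->
      nm (F v - F u - (v - u)%:C%C * k a u) <= e * `|v - u|.
  have [ar|nar] := pselect (disc c r a); last by exists (fun=> 0).
  have [|F F0 FH] := @complex_antiderivative (k a) (nm (a - c) * (L * nm (a - c))).
    move=> u v; rewrite /k -mulrBr -mulrA; apply: nmM_le => //.
    apply: le_trans (gL _ _ _ _) _; try by apply: segr => //; exact: clamp01_01.
    rewrite segB nmM nm_real -mulrA ler_wpM2l// mulrC ler_wpM2l ?nm_ge0//.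
    exact: clamp01_lip.
  by exists F.
have [F FH] := choice H; pose K := M * (1 + r).
have K0 : 0 <= K by apply: mulr_ge0 => //; apply: addr_ge0 => //; exact: ltW.
exists (fun a => F a 1), K; split=> //.
  have [F0 Fc] := FH _ cr.
  apply/eqP; rewrite -nm_eq0 -[F c 1]subr0 -F0; apply/eqP/le_anti; rewrite nm_ge0 andbT.
  apply/ler_addgt0Pr => e e0; rewrite add0r.
  apply: mean_value_ineq => u u01; have [d d0 dH] := Fc u u01 e e0.
  by exists d => // v _ /dH; rewrite kE// subrr mul0r mulr0 subr0.
move=> a b ar br; have [Fa0 Fa] := FH _ ar; have [Fb0 Fb] := FH _ br.
apply/ler_addgt0Pr => e e0.
have := @mean_value_ineq _ (fun u => F b u - F a u - u%:C%C * (b - a) * g (seg c a u))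
  (K * nm (b - a) ^+ 2 + e).
rewrite Fa0 Fb0 !mul0r !subr0 mul1r seg1 (mulrC (b - a)).
apply => u u01.
pose h := b - a; pose n := nm h; pose ea := a - c.
have e4 : 0 < e / 4 by rewrite divr_gt0.
have [d1 d10 H1] := Fa _ u01 _ e4; have [d2 d20 H2] := Fb _ u01 _ e4.
pose d3 := (e / 4) / (n * (L * nm ea) + n * (M * nm ea ^+ 2) + 1).
have q0 : 0 <= n * (L * nm ea) + n * (M * nm ea ^+ 2).
  by rewrite addr_ge0 ?mulr_ge0 ?exprn_ge0 ?nm_ge0.
have d30 : 0 < d3 by apply: divr_gt0 => //; exact: ltr_wpDl.
exists (Num.min 1 (Num.min d3 (Num.min d1 d2))).
  by rewrite !lt_min ltr01 d30 d10 d20.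
move=> v v01; rewrite !lt_min => /and4P[v1 v3 /H1{}H1 /H2{}H2].
rewrite !kE// in H1 H2.
have sau := segr _ _ ar u01; have sav := segr _ _ ar v01; have sbu := segr _ _ br u01.
set w := (v - u)%:C%C in H1 H2; set U := u%:C%C; set V := v%:C%C.
have wE : w = V - U by rewrite /w rmorphB.
have E1 : seg c b u - seg c a u = U * h by rewrite /seg /h /U; ring.
have E2 : seg c a v - seg c a u = w * ea by rewrite segB.
have Q1 := gq _ _ sau sbu; rewrite E1 in Q1.
have Q2 := gq _ _ sau sav; rewrite E2 in Q2.
have Q3 := gL _ _ sau sav; rewrite E2 in Q3.
set gau := g (seg c a u) in Q1 Q2 Q3 H1 H2 *; set gav := g (seg c a v) in Q2 Q3 *.
set gbu := g (seg c b u) in Q1 H2; set g1u := g1 (seg c a u) in Q1 Q2.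
have Uu : nm U <= 1 by rewrite nm_real ger0_norm; case/andP: u01.
have wn : nm w = `|v - u| by rewrite nm_real.
have n0 : 0 <= n by exact: nm_ge0.
have ebr : nm (b - c) <= r by exact: ltW.
(* the main term is the exact derivative [w * d/ds (s h g(c + s (a - c)))] *)
have -> : F b v - F a v - V * (b - a) * gav - (F b u - F a u - U * (b - a) * gau) =
  ((F b v - F b u - w * ((b - c) * gbu)) - (F a v - F a u - w * ((a - c) * gau)))
  + w * ((b - c) * (gbu - gau - g1u * (U * h)) + U * h ^+ 2 * g1u)
  + (- (w * h * (gav - gau)) - U * h * (gav - gau - g1u * (w * ea))).
  rewrite /h /ea wE; ring.
apply: le_trans (nmD3 (le_trans (nmB _ _) (lerD H2 H1)) (lexx _) (nmB _ _)) _.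
have T2 : nm (w * ((b - c) * (gbu - gau - g1u * (U * h)) + U * h ^+ 2 * g1u)) <=
    `|v - u| * (K * n ^+ 2).
  rewrite nmM wn ler_wpM2l//.
  have Uh : nm (U * h) ^+ 2 <= n ^+ 2.
    rewrite lerXn2r ?nnegrE ?nm_ge0// nmM -[leRHS]mul1r ler_wpM2r//.
  have t1 := nmM_le ebr (le_trans Q1 (ler_wpM2l M0 Uh)).
  have t2 : nm (U * h ^+ 2 * g1u) <= 1 * n ^+ 2 * M.
    by apply: nmM_le; [apply: nmM_le => //; rewrite nmX|exact: g1M].
  apply: le_trans (nmD _ _) _; apply: le_trans (lerD t1 t2) _.
  by rewrite /K; lra.
have T3 : nm (- (w * h * (gav - gau))) <= `|v - u| * (e / 4).
  rewrite nmN nmM nmM wn -mulrA ler_wpM2l//.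
  apply: le_trans (ler_wpM2l n0 Q3) _; rewrite nmM wn.
  move: v3; rewrite ltr_pdivlMr ?ltr_wpDl//.
  have : 0 <= `|v - u| * (n * (M * nm ea ^+ 2)).
    by rewrite !mulr_ge0 ?exprn_ge0 ?nm_ge0.
  have := normr_ge0 (v - u); lra.
have T4 : nm (U * h * (gav - gau - g1u * (w * ea))) <= `|v - u| * (e / 4).
  have t0 : nm (U * h) <= n.
    by rewrite nmM -[leRHS]mul1r ler_wpM2r.
  apply: le_trans (nmM_le t0 Q2) _.
  rewrite nmM wn exprMn expr2.
  have -> : n * (M * (`|v - u| * `|v - u| * nm ea ^+ 2)) =
    `|v - u| * (`|v - u| * (n * (M * nm ea ^+ 2))) by ring.
  rewrite ler_wpM2l//.
  move: v3; rewrite ltr_pdivlMr ?ltr_wpDl//.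
  have : 0 <= `|v - u| * (n * (L * nm ea)) by rewrite !mulr_ge0 ?nm_ge0.
  have := normr_ge0 (v - u); lra.
by move: T2 T3 T4; rewrite -/h -/n; lra.
Qed.

End primitive.

(** * Primitives along the fibres of p(x) + q(y) *)

Section charts.
Variable R : realType.
Local Notation C := (cplx R).
Implicit Types (p q : {poly C}) (z : C * C) (a : C) (P : C * C -> C).

Definition lev p q z : C := p.[z.1] + q.[z.2].

(** Along the fibre through [z], the differential of [P] takes the value [a] on the tangent vector
    [(q', - p')]. The two inequalities express this with [x] or with [y] as the coordinate; nothing
    is divided by [q'] or [p'], so both charts are treated alike. *)
Definition fder p q a P z := exists K : R, \forall z' \near z,
  lev p q z' = lev p q z ->
  nm (q^`().[z.2] * (P z' - P z) - a * (z'.1 - z.1)) <= K * n2 (z' - z) ^+ 2 /\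
  nm (p^`().[z.1] * (P z' - P z) + a * (z'.2 - z.2)) <= K * n2 (z' - z) ^+ 2.

Definition nonsing p q z := q^`().[z.2] != 0 \/ p^`().[z.1] != 0.

Definition lprim p q (a : C * C -> C) P z0 :=
  nonsing p q z0 /\ \forall z \near z0, fder p q (a z) P z.

Definition swp z := (z.2, z.1).

Lemma swpK : involutive swp. Proof. by case. Qed.

Lemma lev_swap p q z : lev q p (swp z) = lev p q z.
Proof. by rewrite /lev addrC. Qed.

Lemma n2_swap z : n2 (swp z) = n2 z.
Proof. by rewrite /n2 addrC. Qed.

Lemma n2_swapB z w : n2 (swp w - z) = n2 (w - swp z).
Proof. by rewrite -n2_swap. Qed.

Lemma near_swap z (A : set (C * C)) :
  (\forall w \near z, A w) -> \forall w \near swp z, A (swp w).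
Proof.
move=> /nbhs_n2[r r0 rA]; apply/nbhs_n2; exists r => // w wz; apply: rA.
by rewrite n2_swapB.
Qed.

(** Exchanging the coordinates reverses the tangent vector [(q', - p')], whence the sign. *)
Lemma fder_swap p q a P z : fder p q a P z -> fder q p (- a) (P \o swp) (swp z).
Proof.
move=> [K /near_swap H]; exists K; apply: filterS H => w.
rewrite -(lev_swap p q (swp w)) swpK lev_swap n2_swapB /= => H E.
have [h1 h2] := H E; rewrite swpK; split; last by rewrite mulNr.
by rewrite mulNr opprK.
Qed.

(* Around a point where dF/dy <> 0, the fibres of F = p + q are the graphs    *)
(* x |-> (x, V (t - p x)).                                                    *)
Lemma chart_box p q z0 (R0 : R) : 0 < R0 -> q^`().[z0.2] != 0 ->
  exists d rho c r (V : C -> C), [/\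
    [/\ 0 < d, 0 < rho, 0 < c, d <= r & r <= R0],
    (forall v, disc z0.2 r v -> c <= nm q^`().[v]),
    (forall z x, n2 (z - z0) < d -> disc z0.1 d x ->
       disc q.[z0.2] rho (lev p q z - p.[x])),
    (forall w, disc q.[z0.2] rho w -> q.[V w] = w /\ disc z0.2 r (V w)) &
    (forall v, disc z0.2 r v -> disc q.[z0.2] rho q.[v] -> V q.[v] = v) /\
    cd (disc q.[z0.2] rho) V (fun w => (q^`().[V w])^-1)].
Proof.
move=> R00 q0; have [r [rho [c [V [[r0 rR rho0 c0] cq VE Vu cV]]]]] := local_inverse R00 q0.
have [Lp Lp0 pL] := cd_lip (cd_poly p (@disc_bounded _ z0.1 1)).
have [Lq Lq0 qL] := cd_lip (cd_poly q (@disc_bounded _ z0.2 1)).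
have D1 : 0 < 2 * Lp + Lq + 1 by lra.
(* Two first coordinates in the box differ by at most [2 d] and a second one from its centre by [d],
   so the argument of [V] moves by at most [(2 Lp + Lq) d]. *)
pose d := Num.min (Num.min 1 r) (rho / (2 * Lp + Lq + 1)).
have d0 : 0 < d by rewrite !lt_min ltr01 r0 divr_gt0.
have d1 : d <= 1 by rewrite !ge_min lexx.
have dr : d <= r by rewrite !ge_min lexx orbT.
have dL : d * (2 * Lp + Lq + 1) <= rho by rewrite -ler_pdivlMr// !ge_min lexx !orbT.
exists d, rho, c, r, V; split=> // z x zd xd.
have zx : disc z0.1 1 z.1.
  by rewrite /disc /=; have := n2_fst (z - z0); rewrite /=; lra.
have zy : disc z0.2 1 z.2.
  by rewrite /disc /=; have := n2_snd (z - z0); rewrite /=; lra.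
have x1 : disc z0.1 1 x by apply: lt_le_trans xd _.
have o2 : disc z0.2 1 z0.2 by rewrite /disc /= subrr nm0.
rewrite /disc /= /lev.
have -> : p.[z.1] + q.[z.2] - p.[x] - q.[z0.2] =
  (p.[z.1] - p.[x]) + (q.[z.2] - q.[z0.2]) by ring.
apply: le_lt_trans (nmD _ _) _.
have h1 := pL _ _ x1 zx; have h2 := qL _ _ o2 zy.
have h3 : nm (z.1 - x) <= 2 * d.
  have -> : z.1 - x = (z.1 - z0.1) - (x - z0.1) by ring.
  apply: le_trans (nmB _ _) _; have := n2_fst (z - z0); move: xd; rewrite /disc /=; lra.
have h4 : nm (z.2 - z0.2) <= d by have := n2_snd (z - z0); rewrite /=; lra.
have : Lp * nm (z.1 - x) <= Lp * (2 * d) by rewrite ler_wpM2l.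
have : Lq * nm (z.2 - z0.2) <= Lq * d by rewrite ler_wpM2l.
by move: dL; rewrite mulrDr mulr1; lra.
Qed.

(** Two points of a fibre in the box are joined inside the fibre by lifting the segment between
    their first coordinates. The lift is Lipschitz, so the quadratic errors of [P] along it are
    smaller than any linear bound, and the mean value inequality applies with an arbitrarily small
    constant. *)
Lemma fder0_cst_chart p q P z0 : q^`().[z0.2] != 0 ->
  (\forall z \near z0, fder p q 0 P z) ->
  exists2 d, 0 < d & forall z z', n2 (z - z0) < d -> n2 (z' - z0) < d ->
    lev p q z = lev p q z' -> P z = P z'.
Proof.
move=> q0 /nbhs_n2[e e0 eP].
have [|d0 [rho [c [r [V [[d00 rho0 c0 dr re] cq box VE [Vu cV]]]]]]] :=
  @chart_box p q z0 (e / 2) _ q0; first exact: divr_gt0.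
pose d := Num.min d0 (e / 2).
have dd0 : d <= d0 by rewrite ge_min lexx.
have de : d <= e / 2 by rewrite ge_min lexx orbT.
exists d => [|z z' zd z'd tE]; first by rewrite lt_min d00 divr_gt0.
have zd0 := lt_le_trans zd dd0; have z'd0 := lt_le_trans z'd dd0.
have zx : disc z0.1 d z.1 by apply: le_lt_trans zd; exact: (n2_fst (z - z0)).
have z'x : disc z0.1 d z'.1 by apply: le_lt_trans z'd; exact: (n2_fst (z' - z0)).
pose x u := seg z.1 z'.1 u; pose w u := lev p q z - p.[x u]; pose l u := (x u, V (w u)).
have xd u : 0 <= u <= 1 -> disc z0.1 d (x u) by move=> u01; apply: seg_ball.
have wr u : 0 <= u <= 1 -> disc q.[z0.2] rho (w u).
  by move=> /xd xu; apply: box => //; exact: lt_le_trans xu dd0.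
have yr (y : C * C) : n2 (y - z0) < d -> V q.[y.2] = y.2.
  move=> yd; apply: Vu.
    apply: le_lt_trans (n2_snd (y - z0)) _.
    exact: lt_le_trans (lt_le_trans yd dd0) dr.
  have := box y y.1 (lt_le_trans yd dd0); rewrite /lev addrC addKr; apply.
  apply: lt_le_trans dd0; apply: le_lt_trans yd; exact: (n2_fst (y - z0)).
have l0 : l 0 = z.
  rewrite /l /w /x seg0 /lev addrC addKr yr//; by case: (z).
have l1 : l 1 = z'.
  rewrite /l /w /x seg1 tE /lev addrC addKr yr//; by case: (z').
have le u : 0 <= u <= 1 -> n2 (l u - z0) < e.
  move=> u01; rewrite /n2 /=; have [_ h2] := VE _ (wr _ u01).
  have := xd _ u01; move: h2; rewrite /disc /=; lra.
have levl u : 0 <= u <= 1 -> lev p q (l u) = lev p q z.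
  by move=> u01; rewrite {1}/lev /= (VE _ (wr _ u01)).1 /w addrC subrK.
have [Lp Lp0 pL] := cd_lip (cd_poly p (@disc_bounded _ z0.1 d)).
have [LV LV0 VL] := cd_lip cV.
pose N := nm (z'.1 - z.1) * (1 + LV * Lp).
have N0 : 0 <= N by rewrite mulr_ge0 ?nm_ge0// addr_ge0 ?mulr_ge0.
have lN u v : 0 <= u <= 1 -> 0 <= v <= 1 -> n2 (l v - l u) <= N * `|v - u|.
  move=> u01 v01.
  have h1 := VL _ _ (wr _ u01) (wr _ v01).
  have h2 := pL _ _ (xd _ u01) (xd _ v01).
  have E : nm (x v - x u) = `|v - u| * nm (z'.1 - z.1) by rewrite segB nmM nm_real.
  have E2 : w v - w u = p.[x u] - p.[x v] by rewrite /w; ring.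
  rewrite E2 in h1; rewrite E in h2.
  have h3 : LV * nm (p.[x u] - p.[x v]) <= LV * (Lp * (`|v - u| * nm (z'.1 - z.1))).
    by apply: ler_wpM2l => //; move: h2; rewrite (nm_sym p.[x v]).
  rewrite /n2 /= E /N; lra.
apply/eqP; rewrite eq_sym -subr_eq0 -nm_eq0; apply/eqP/le_anti; rewrite nm_ge0 andbT.
apply/ler_addgt0Pr => g g0; rewrite add0r.
have := @mean_value_ineq _ (P \o l) g; rewrite /= l0 l1; apply => u u01.
have [K /nbhs_n2[d1 d10 H1]] := eP _ (le _ u01).
have N1 : 0 < N + 1 by rewrite ltr_wpDl.
have B0 : 0 < `|K| * N ^+ 2 + 1 by rewrite ltr_wpDl// mulr_ge0 ?exprn_ge0.
exists (Num.min (d1 / (N + 1)) (g * c / (`|K| * N ^+ 2 + 1))).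
  by rewrite lt_min !divr_gt0// mulr_gt0.
move=> v v01; rewrite lt_min !ltr_pdivlMr// => /andP[vd vg].
have lvu := lN _ _ u01 v01.
have [||h _] := H1 (l v).
- by apply: le_lt_trans lvu _; have := normr_ge0 (v - u); lra.
- by rewrite !levl.
move: h; rewrite mul0r subr0 nmM => h.
have hc : c <= nm q^`().[(l u).2] by apply: cq; exact: (VE _ (wr _ u01)).2.
have h2 : K * n2 (l v - l u) ^+ 2 <= `|K| * (N * `|v - u|) ^+ 2.
  apply: le_trans (ler_wpM2r _ (ler_norm K)) _; first by rewrite exprn_ge0 ?n2_ge0.
  by rewrite ler_wpM2l// lerXn2r ?nnegrE ?n2_ge0// mulr_ge0.
have h3 : c * nm (P (l v) - P (l u)) <= g * c * `|v - u|.
  apply: (le_trans (ler_wpM2r (nm_ge0 _) hc)); apply: (le_trans h); apply: (le_trans h2).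
  rewrite exprMn mulrA [X in _ * X]expr2 mulrA ler_wpM2r//.
  by have := normr_ge0 (v - u); lra.
by rewrite -(ler_pM2l c0); lra.
Qed.

Lemma fder0_cst p q P z0 : lprim p q (fun=> 0) P z0 ->
  exists2 d, 0 < d & forall z z', n2 (z - z0) < d -> n2 (z' - z0) < d ->
    lev p q z = lev p q z' -> P z = P z'.
Proof.
move=> [[q0|p0] H]; first exact: fder0_cst_chart H.
have [||d d0 dH] := @fder0_cst_chart q p (P \o swp) (swp z0) => //.
  apply: filterS (near_swap H) => w /fder_swap; rewrite swpK oppr0.
  by apply.
exists d => // z z' zd z'd E; have := dH (swp z) (swp z').
rewrite !lev_swap /= !swpK; by apply => //; rewrite n2_swapB swpK.
Qed.

End charts.

(** * Primitives in a chart and their dependence on the fibre *)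

Section local_primitives.
Variable R : realType.
Local Notation C := (cplx R).
Implicit Types (p q : {poly C}) (z : C * C) (a : C) (P : C * C -> C).

Lemma n2_sqr z : nm z.1 ^+ 2 <= n2 z ^+ 2 /\ nm z.1 * n2 z <= n2 z ^+ 2.
Proof.
split; last by rewrite expr2 ler_wpM2r ?n2_ge0 ?n2_fst.
by rewrite lerXn2r ?nnegrE ?nm_ge0 ?n2_ge0 ?n2_fst.
Qed.

Lemma lev_lip p q z0 (d : R) : exists2 L, 0 <= L & forall z z',
  n2 (z - z0) < d -> n2 (z' - z0) < d ->
  nm (lev p q z' - lev p q z) <= L * n2 (z' - z).
Proof.
have [Lp Lp0 pL] := cd_lip (cd_poly p (@disc_bounded _ z0.1 d)).
have [Lq Lq0 qL] := cd_lip (cd_poly q (@disc_bounded _ z0.2 d)).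
exists (Lp + Lq) => [|z z' zd z'd]; first exact: addr_ge0.
have h1 := pL _ _ (le_lt_trans (n2_fst (z - z0)) zd) (le_lt_trans (n2_fst (z' - z0)) z'd).
have h2 := qL _ _ (le_lt_trans (n2_snd (z - z0)) zd) (le_lt_trans (n2_snd (z' - z0)) z'd).
have -> : lev p q z' - lev p q z = (p.[z'.1] - p.[z.1]) + (q.[z'.2] - q.[z.2]).
  by rewrite /lev; ring.
apply: le_trans (nmD _ _) _; rewrite mulrDl; apply: lerD.
  by apply: le_trans h1 _; rewrite ler_wpM2l// (n2_fst (z' - z)).
by apply: le_trans h2 _; rewrite ler_wpM2l// (n2_snd (z' - z)).
Qed.

(** In the chart [y = V (t - p x)], [P] is the integral [Pi t x] of [x^i V^j] from the centre to [x]
    on the fibre of level [t], and [psi] is its derivative in [t], obtained under the integral sign: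
    the integral of [x^i] times the derivative of [V^j]. The first estimate is joint in [t] and [x];
    the second says that [psi] is again a fibrewise primitive. *)
Lemma chart_primitive p q z0 (i j : nat) : q^`().[z0.2] != 0 ->
  exists P psi (d K : R), [/\ 0 < d,
    forall z z', n2 (z - z0) < d -> n2 (z' - z0) < d ->
      nm (P z' - P z - z.1 ^+ i * z.2 ^+ j * (z'.1 - z.1)
          - psi z * (lev p q z' - lev p q z)) <= K * n2 (z' - z) ^+ 2 &
    forall z, n2 (z - z0) < d -> exists M : R, forall z', n2 (z' - z0) < d ->
      lev p q z' = lev p q z ->
      nm (psi z' - psi z - j%:R * z.1 ^+ i * z.2 ^+ j.-1 / q^`().[z.2] * (z'.1 - z.1))
        <= M * n2 (z' - z) ^+ 2].
Proof.
move=> q0.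
have [d [rho [c [r [V [[d0 rho0 c0 dr _] cq box VE [Vu cV]]]]]]] :=
  @chart_box _ p q z0 1 ltr01 q0.
set S := disc q.[z0.2] rho in box VE Vu cV; set D := disc z0.1 d.
have [G1 [cG G1E]] := cdX j cV.
have [G2 cG1] : exists G2, cd S G1 G2.
  have cinv : exists k, cd S (fun w => (q^`().[V w])^-1) k.
    have VS w : S w -> disc z0.2 r (V w) by move=> /VE[].
    have := cd_comp VS (cd_poly q^`() (@disc_bounded _ z0.2 r)) cV.
    by move=> /(cdV c0 _) => H; eexists; apply: H => w /VS/cq.
  have [k ck] := cinv; have [k2 [ck2 _]] := cdX j.-1 cV.
  have H := cdM (cdM (cd_cst S j%:R) ck2) ck.
  eexists; apply: (cd_ext _ _ H) => w _; last by reflexivity.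
  by rewrite G1E.
pose T := lev p q @` [set z | n2 (z - z0) < d].
have TS t x : T t -> D x -> S (t - p.[x]) by move=> [z zd <-] xd; exact: box.
have cp : cd D (horner p) (horner p^`()) := cd_poly p (@disc_bounded _ z0.1 d).
have [g1 [cx _]] := cdX i (cd_id (@disc_bounded _ z0.1 d)).
have prim G G' : cd S G G' -> exists Pi : C -> C -> C, forall t, T t -> exists K : R,
    Pi t z0.1 = 0 /\ forall x y, D x -> D y ->
    nm (Pi t y - Pi t x - x ^+ i * G (t - p.[x]) * (y - x)) <= K * nm (y - x) ^+ 2.
  move=> cG'; suff H t : exists Pi : C -> C, T t -> exists K : R,
    Pi z0.1 = 0 /\ forall x y, D x -> D y ->
    nm (Pi y - Pi x - x ^+ i * G (t - p.[x]) * (y - x)) <= K * nm (y - x) ^+ 2.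
    by have [Pi PiH] := choice H; exists Pi.
  have [Tt|nTt] := pselect (T t); last by exists (fun=> 0).
  have ct : cd D (fun x => t - p.[x]) (fun x => - p^`().[x]).
    apply: cd_ext (cdD (cd_cst D t) (cdM (cd_cst D (-1)) cp)) => x _.
      by rewrite mulN1r.
    by rewrite mul0r !add0r mulN1r.
  have := cdM cx (cd_comp (TS t ^~ Tt) cG' ct).
  move=> /(primitive_disc d0)[Pi [K [K0 Pi0 PiH]]].
  by exists Pi => _; exists K.
have [Pi PiH] := prim _ _ cG; have [Pi1 Pi1H] := prim _ _ cG1.
have [Lp Lp0 pL] := cd_lip cp; have [LG LG0 GL] := cd_lip cG.
have [Lx Lx0 xL] := cd_lip cx.
case: cG => [MG [MG0 GM _ Gq]]; case: cx => [Mx [Mx0 xM _ _]].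
pose P z := Pi (lev p q z) z.1; pose psi z := Pi1 (lev p q z) z.1.
have zD z : n2 (z - z0) < d -> D z.1.
  by move=> zd; apply: le_lt_trans zd; exact: (n2_fst (z - z0)).
have zT z : n2 (z - z0) < d -> T (lev p q z) by exists z.
have z0D : D z0.1 by rewrite /D /disc /= subrr nm0.
have Vz z : n2 (z - z0) < d -> V (lev p q z - p.[z.1]) = z.2.
  move=> zd; have := box z z.1 zd (zD _ zd); rewrite /lev addrC addKr => h.
  apply: Vu => //; apply: lt_le_trans dr; apply: le_lt_trans zd.
  exact: (n2_snd (z - z0)).
have [L L0 levL] := lev_lip p q z0 d.
(* [Pi t] has Lipschitz derivative uniformly in t *)
pose KL := Lx * MG + Mx * (LG * Lp).
have KL0 : 0 <= KL by apply: addr_ge0; apply: mulr_ge0 => //; apply: mulr_ge0.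
have B1 t x y : T t -> D x -> D y ->
    nm (Pi t y - Pi t x - x ^+ i * V (t - p.[x]) ^+ j * (y - x)) <= KL * nm (y - x) ^+ 2.
  move=> Tt xd yd; have [K [_ KH]] := PiH _ Tt.
  have xyD u : 0 <= u <= 1 -> D (seg x y u) by move=> u01; apply: seg_ball.
  have := @mean_value_seg2 _ (fun s => Pi t s - x ^+ i * V (t - p.[x]) ^+ j * s)
    (fun s => s ^+ i * V (t - p.[s]) ^+ j - x ^+ i * V (t - p.[x]) ^+ j)
    D x y (KL * nm (y - x)) xyD.
  rewrite expr2 mulrA.
  have -> : Pi t y - x ^+ i * V (t - p.[x]) ^+ j * y
    - (Pi t x - x ^+ i * V (t - p.[x]) ^+ j * x) =
    Pi t y - Pi t x - x ^+ i * V (t - p.[x]) ^+ j * (y - x) by ring.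
  apply => [s sd|u u01].
    exists K => s' s'd; have := KH _ _ sd s'd.
    apply: le_trans; rewrite le_eqVlt; apply/orP; left; apply/eqP; congr (nm _).
    by ring.
  set s := seg x y u; have sd : D s := xyD _ u01.
  have -> : s ^+ i * V (t - p.[s]) ^+ j - x ^+ i * V (t - p.[x]) ^+ j =
    (s ^+ i - x ^+ i) * V (t - p.[s]) ^+ j
     + x ^+ i * (V (t - p.[s]) ^+ j - V (t - p.[x]) ^+ j) by ring.
  have sx : nm (s - x) <= nm (y - x).
    rewrite /s seg_itv ler_piMl ?nm_ge0//; case/andP: u01 => u0 u1.
    by rewrite ger0_norm.
  have h1 : nm (s ^+ i - x ^+ i) <= Lx * nm (y - x).
    by apply: le_trans (xL _ _ xd sd) _; rewrite ler_wpM2l.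
  have h2 : nm (V (t - p.[s]) ^+ j - V (t - p.[x]) ^+ j) <= LG * (Lp * nm (y - x)).
    apply: le_trans (GL _ _ (TS _ _ Tt xd) (TS _ _ Tt sd)) _.
    rewrite ler_wpM2l//; have -> : t - p.[s] - (t - p.[x]) = p.[x] - p.[s] by ring.
    apply: le_trans (pL _ _ sd xd) _; rewrite nm_sym ler_wpM2l//.
  apply: le_trans (nmD _ _) _.
  apply: le_trans (lerD (nmM_le h1 (GM _ (TS _ _ Tt sd))) (nmM_le (xM _ xd) h2)) _.
  by rewrite le_eqVlt; apply/orP; left; apply/eqP; rewrite /KL; ring.
(* Differentiation under the integral sign: the difference vanishes at the centre, and its
   derivative in [x] is the quadratic error of [V^j] times [x^i]. The factor [d] bounds the length
   of the segment. *)
have B2 t t' x : T t -> T t' -> D x ->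
    nm (Pi t' x - Pi t x - (t' - t) * Pi1 t x) <= Mx * MG * d * nm (t' - t) ^+ 2.
  move=> Tt Tt' xd; have [K [P0 KH]] := PiH _ Tt; have [K' [P0' KH']] := PiH _ Tt'.
  have [K1 [P10 KH1]] := Pi1H _ Tt.
  have xyD u : 0 <= u <= 1 -> D (seg z0.1 x u) by move=> u01; apply: seg_ball.
  have := @mean_value_seg2 _ (fun s => Pi t' s - Pi t s - (t' - t) * Pi1 t s)
    (fun s => s ^+ i * V (t' - p.[s]) ^+ j - s ^+ i * V (t - p.[s]) ^+ j -
              (t' - t) * (s ^+ i * G1 (t - p.[s])))
    D z0.1 x (Mx * (MG * nm (t' - t) ^+ 2)) xyD.
  rewrite P0 P0' P10 mulr0 !subr0 => H; apply: le_trans (H _ _) _.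
  - move=> s sd; exists (`|K| + `|K'| + nm (t' - t) * `|K1|) => s' s'd.
    have h1 := KH _ _ sd s'd; have h2 := KH' _ _ sd s'd; have h3 := KH1 _ _ sd s'd.
    set A := Pi t s' - _ - _ in h1; set A' := Pi t' s' - _ - _ in h2.
    set A1 := Pi1 t s' - _ - _ in h3; set N := nm (s' - s) ^+ 2 in h1 h2 h3 *.
    have N0 : 0 <= N by rewrite exprn_ge0 ?nm_ge0.
    have -> : Pi t' s' - Pi t s' - (t' - t) * Pi1 t s' -
       (Pi t' s - Pi t s - (t' - t) * Pi1 t s) -
       (s ^+ i * V (t' - p.[s]) ^+ j - s ^+ i * V (t - p.[s]) ^+ j -
          (t' - t) * (s ^+ i * G1 (t - p.[s]))) * (s' - s) =
       A' + (- A) + - ((t' - t) * A1) by rewrite /A /A' /A1; ring.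
    have e1 : nm (- A) <= `|K| * N.
      by rewrite nmN; apply: le_trans h1 _; rewrite ler_wpM2r ?ler_norm.
    have e2 : nm A' <= `|K'| * N.
      by apply: le_trans h2 _; rewrite ler_wpM2r ?ler_norm.
    have e3 : nm A1 <= `|K1| * N.
      by apply: le_trans h3 _; rewrite ler_wpM2r ?ler_norm.
    have e4 : nm (- ((t' - t) * A1)) <= nm (t' - t) * (`|K1| * N).
      by rewrite nmN; apply: nmM_le.
    by apply: le_trans (nmD3 e2 e1 e4) _; lra.
  - move=> u u01; set s := seg z0.1 x u; have sd : D s := xyD _ u01.
    have -> : s ^+ i * V (t' - p.[s]) ^+ j - s ^+ i * V (t - p.[s]) ^+ j -
       (t' - t) * (s ^+ i * G1 (t - p.[s])) =
      s ^+ i * (V (t' - p.[s]) ^+ j - V (t - p.[s]) ^+ j -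
        G1 (t - p.[s]) * ((t' - p.[s]) - (t - p.[s]))) by ring.
    have -> : t' - t = (t' - p.[s]) - (t - p.[s]) by ring.
    apply: nmM_le; first exact: xM.
    exact: (Gq _ _ (TS _ _ Tt sd) (TS _ _ Tt' sd)).
  - have : nm (x - z0.1) <= d by exact: ltW.
    have M0 : 0 <= Mx * (MG * nm (t' - t) ^+ 2).
      by apply: mulr_ge0 => //; apply: mulr_ge0 => //; rewrite exprn_ge0 ?nm_ge0.
    by move=> /(ler_wpM2l M0); lra.
have B3 t t' x : T t -> T t' -> D x ->
    nm (x ^+ i * V (t' - p.[x]) ^+ j - x ^+ i * V (t - p.[x]) ^+ j) <=
      Mx * (LG * nm (t' - t)).
  move=> Tt Tt' xd; rewrite -mulrBr; apply: nmM_le; first exact: xM.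
  have -> : t' - t = (t' - p.[x]) - (t - p.[x]) by ring.
  exact: (GL _ _ (TS _ _ Tt xd) (TS _ _ Tt' xd)).
exists P, psi, d, (KL + Mx * (LG * L) + Mx * MG * d * L ^+ 2); split=> //.
  move=> z z' zd z'd; set t := lev p q z; set t' := lev p q z'.
  have tt : nm (t' - t) <= L * n2 (z' - z) by exact: levL.
  have zz : nm (z'.1 - z.1) <= n2 (z' - z) by exact: (n2_fst (z' - z)).
  have c1 := B1 t' _ _ (zT _ z'd) (zD _ zd) (zD _ z'd).
  have c2 := B2 t t' _ (zT _ zd) (zT _ z'd) (zD _ zd).
  have c3 := B3 t t' _ (zT _ zd) (zT _ z'd) (zD _ zd).
  (* Pass from [z] to [z'] by changing the level at fixed [x] ([B2]) and then moving within the new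
     fibre ([B1]); [B3] corrects the integrand, which is taken at the old level. *)
  have -> : P z' - P z - z.1 ^+ i * z.2 ^+ j * (z'.1 - z.1) - psi z * (t' - t) =
    (Pi t' z'.1 - Pi t' z.1 - z.1 ^+ i * V (t' - p.[z.1]) ^+ j * (z'.1 - z.1)) +
    (z.1 ^+ i * V (t' - p.[z.1]) ^+ j - z.1 ^+ i * V (t - p.[z.1]) ^+ j) * (z'.1 - z.1) +
    (Pi t' z.1 - Pi t z.1 - (t' - t) * Pi1 t z.1).
    by rewrite Vz// /P /psi; ring.
  have N0 := n2_ge0 (z' - z).
  have f1 : KL * nm (z'.1 - z.1) ^+ 2 <= KL * n2 (z' - z) ^+ 2.
    by rewrite ler_wpM2l// lerXn2r ?nnegrE ?nm_ge0.
  have f2 : Mx * MG * d * nm (t' - t) ^+ 2 <= Mx * MG * d * (L * n2 (z' - z)) ^+ 2.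
    rewrite ler_wpM2l ?lerXn2r ?nnegrE ?nm_ge0// ?mulr_ge0//; exact: ltW.
  have f3 : Mx * (LG * nm (t' - t)) <= Mx * (LG * (L * n2 (z' - z))).
    by rewrite ler_wpM2l// ler_wpM2l.
  apply: le_trans (nmD3 (le_trans c1 f1) (nmM_le (le_trans c3 f3) zz) (le_trans c2 f2)) _.
  by rewrite le_eqVlt; apply/orP; left; apply/eqP; ring.
move=> z zd; have [K [_ KH]] := Pi1H _ (zT _ zd).
exists `|K| => z' z'd E; rewrite /psi E.
have := KH _ _ (zD _ zd) (zD _ z'd); rewrite G1E Vz//.
have -> : z.1 ^+ i * (j%:R * z.2 ^+ j.-1 / q^`().[z.2]) =
  j%:R * z.1 ^+ i * z.2 ^+ j.-1 / q^`().[z.2] by ring.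
move=> h; apply: le_trans h _; apply: le_trans (ler_wpM2r _ (ler_norm K)) _.
  by rewrite exprn_ge0 ?nm_ge0.
by rewrite ler_wpM2l//; exact: (n2_sqr (z' - z)).1.
Qed.

End local_primitives.

(** * Gelfand-Leray pairs of primitives *)

Section gelfand_leray.
Variable R : realType.
Local Notation C := (cplx R).
Implicit Types (p q : {poly C}) (z : C * C) (a : C) (P : C * C -> C).

Lemma near_fst z (A : set C) : (\forall x \near z.1, A x) -> \forall w \near z, A w.1.
Proof.
move=> /nbhs_nm[r r0 rA]; apply/nbhs_n2; exists r => // w wz; apply: rA.
by apply: le_lt_trans wz; exact: (n2_fst (w - z)).
Qed.

Lemma near_snd z (A : set C) : (\forall x \near z.2, A x) -> \forall w \near z, A w.2.
Proof.
move=> /nbhs_nm[r r0 rA]; apply/nbhs_n2; exists r => // w wz; apply: rA.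
by apply: le_lt_trans wz; exact: (n2_snd (w - z)).
Qed.

Lemma horner_neq0_near p (x0 : C) : p.[x0] != 0 -> \forall x \near x0, p.[x] != 0.
Proof.
move=> p0; have [L L0 pL] := cd_lip (cd_poly p (@disc_bounded _ x0 1)).
have n0 : 0 < nm p.[x0] by rewrite nm_gt0.
have L1 : 0 < L + 1 by rewrite ltr_wpDl.
apply/nbhs_nm; exists (Num.min 1 (nm p.[x0] / (L + 1))).
  by rewrite lt_min ltr01 divr_gt0.
move=> x; rewrite lt_min ltr_pdivlMr// => /andP[x1 xL].
apply/eqP => px; have := pL x0 x; rewrite px sub0r nmN /disc /= subrr nm0 => H.
by have := H ltr01 x1; have := nm_ge0 (x - x0); nra.
Qed.

Lemma nonsing_near p q z0 : nonsing p q z0 -> \forall z \near z0, nonsing p q z.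
Proof.
move=> [|] /horner_neq0_near H.
  by apply: filterS (near_snd H) => z; left.
by apply: filterS (near_fst H) => z; right.
Qed.

Lemma n2_ball_near z0 z (d : R) : n2 (z - z0) < d -> \forall w \near z, n2 (w - z0) < d.
Proof.
move=> zd; apply/nbhs_n2; exists (d - n2 (z - z0)); first by rewrite subr_gt0.
move=> w wz; have -> : w - z0 = (w - z) + (z - z0) by rewrite addrA subrK.
by apply: le_lt_trans (n2D _ _) _; lra.
Qed.

Lemma taylor_lev p q z : exists K : R, \forall z' \near z,
  nm (lev p q z' - lev p q z - p^`().[z.1] * (z'.1 - z.1) - q^`().[z.2] * (z'.2 - z.2))
    <= K * n2 (z' - z) ^+ 2.
Proof.
have [M [M0 _ _ pM]] := cd_poly p (@disc_bounded _ z.1 1).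
have [N [N0 _ _ qN]] := cd_poly q (@disc_bounded _ z.2 1).
exists (M + N); apply/nbhs_n2; exists 1 => // w wz.
have d1 : disc z.1 1 w.1 by apply: le_lt_trans wz; exact: (n2_fst (w - z)).
have d2 : disc z.2 1 w.2 by apply: le_lt_trans wz; exact: (n2_snd (w - z)).
have e1 : disc z.1 1 z.1 by rewrite /disc /= subrr nm0.
have e2 : disc z.2 1 z.2 by rewrite /disc /= subrr nm0.
have h1 := pM _ _ e1 d1; have h2 := qN _ _ e2 d2.
rewrite /lev; set A := p.[w.1] - p.[z.1] - _ in h1; set B := q.[w.2] - q.[z.2] - _ in h2.
have -> : p.[w.1] + q.[w.2] - (p.[z.1] + q.[z.2]) - p^`().[z.1] * (w.1 - z.1)
  - q^`().[z.2] * (w.2 - z.2) = A + B by rewrite /A /B; ring.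
have n0 := n2_ge0 (w - z).
rewrite mulrDl; apply: le_trans (nmD _ _) _; apply: lerD.
  apply: le_trans h1 _; rewrite ler_wpM2l// lerXn2r ?nnegrE ?nm_ge0//.
  exact: (n2_fst (w - z)).
apply: le_trans h2 _; rewrite ler_wpM2l// lerXn2r ?nnegrE ?nm_ge0//.
exact: (n2_snd (w - z)).
Qed.

Lemma nmM_absK (c x : C) (M N : R) : 0 <= N -> nm x <= M * N -> nm (c * x) <= nm c * `|M| * N.
Proof.
move=> N0 h; rewrite nmM -mulrA ler_wpM2l ?nm_ge0//; apply: le_trans h _.
by rewrite ler_wpM2r// ler_norm.
Qed.

(* The form c dx + e dy on the fibre, evaluated on the tangent vector         *)
(* (q'(y), - p'(x)).                                                          *)
Lemma fder_form p q (c e : C) P z :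
  (exists M : R, \forall z' \near z, lev p q z' = lev p q z ->
     nm (P z' - P z - c * (z'.1 - z.1) - e * (z'.2 - z.2)) <= M * n2 (z' - z) ^+ 2) ->
  fder p q (c * q^`().[z.2] - e * p^`().[z.1]) P z.
Proof.
move=> [M H]; have [N T] := taylor_lev p q z.
set p1 := p^`().[z.1] in T *; set q1 := q^`().[z.2] in T *.
exists (nm q1 * `|M| + nm e * `|N| + (nm p1 * `|M| + nm c * `|N|)).
near=> w.
have h' : lev p q w = lev p q z ->
    nm (P w - P z - c * (w.1 - z.1) - e * (w.2 - z.2)) <= M * n2 (w - z) ^+ 2.
  by near: w.
have t : nm (lev p q w - lev p q z - p1 * (w.1 - z.1) - q1 * (w.2 - z.2)) <=
    N * n2 (w - z) ^+ 2 by near: w.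
move=> E; have h := h' E; move: h t; set n := n2 (w - z) ^+ 2.
have n0 : 0 <= n by rewrite exprn_ge0 ?n2_ge0.
rewrite E subrr sub0r => h t.
split.
  have -> : q1 * (P w - P z) - (c * q1 - e * p1) * (w.1 - z.1) =
    q1 * (P w - P z - c * (w.1 - z.1) - e * (w.2 - z.2)) +
    (- e) * (- (p1 * (w.1 - z.1)) - q1 * (w.2 - z.2)) by ring.
  apply: le_trans (nmD _ _) _.
  apply: le_trans (lerD (nmM_absK _ n0 h) (nmM_absK _ n0 t)) _.
  rewrite nmN !mulrDl; have := mulr_ge0 (mulr_ge0 (nm_ge0 p1) (normr_ge0 M)) n0.
  have := mulr_ge0 (mulr_ge0 (nm_ge0 c) (normr_ge0 N)) n0; lra.
have -> : p1 * (P w - P z) + (c * q1 - e * p1) * (w.2 - z.2) =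
    p1 * (P w - P z - c * (w.1 - z.1) - e * (w.2 - z.2)) +
    (- c) * (- (p1 * (w.1 - z.1)) - q1 * (w.2 - z.2)) by ring.
apply: le_trans (nmD _ _) _.
apply: le_trans (lerD (nmM_absK _ n0 h) (nmM_absK _ n0 t)) _.
rewrite nmN !mulrDl; have := mulr_ge0 (mulr_ge0 (nm_ge0 q1) (normr_ge0 M)) n0.
have := mulr_ge0 (mulr_ge0 (nm_ge0 e) (normr_ge0 N)) n0; lra.
Unshelve. all: by end_near. Qed.

(** Converse of [fder_form]: at a nonsingular point one of [p'], [q'] can be divided out, and the
    relation [p' dx + q' dy = 0] up to second order restores the form [c dx + e dy]. *)
Lemma fder_formV p q (c e : C) P z : nonsing p q z ->
  fder p q (c * q^`().[z.2] - e * p^`().[z.1]) P z ->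
  exists M : R, \forall z' \near z, lev p q z' = lev p q z ->
     nm (P z' - P z - c * (z'.1 - z.1) - e * (z'.2 - z.2)) <= M * n2 (z' - z) ^+ 2.
Proof.
move=> ns [M H]; have [N T] := taylor_lev p q z.
set p1 := p^`().[z.1] in T H ns *; set q1 := q^`().[z.2] in T H ns *.
pose K := nm q1^-1 * `|M| + nm (q1^-1 * e) * `|N|
  + (nm p1^-1 * `|M| + nm (p1^-1 * c) * `|N|).
exists K; near=> w.
have h' : lev p q w = lev p q z ->
    nm (q1 * (P w - P z) - (c * q1 - e * p1) * (w.1 - z.1)) <= M * n2 (w - z) ^+ 2 /\
    nm (p1 * (P w - P z) + (c * q1 - e * p1) * (w.2 - z.2)) <= M * n2 (w - z) ^+ 2.
  by near: w.
have t : nm (lev p q w - lev p q z - p1 * (w.1 - z.1) - q1 * (w.2 - z.2)) <=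
    N * n2 (w - z) ^+ 2 by near: w.
move=> E; have [h1 h2] := h' E; move: h1 h2 t; set n := n2 (w - z) ^+ 2.
have n0 : 0 <= n by rewrite exprn_ge0 ?n2_ge0.
rewrite E subrr sub0r => h1 h2 t.
have k1 := mulr_ge0 (mulr_ge0 (nm_ge0 q1^-1) (normr_ge0 M)) n0.
have k2 := mulr_ge0 (mulr_ge0 (nm_ge0 (q1^-1 * e)) (normr_ge0 N)) n0.
have k3 := mulr_ge0 (mulr_ge0 (nm_ge0 p1^-1) (normr_ge0 M)) n0.
have k4 := mulr_ge0 (mulr_ge0 (nm_ge0 (p1^-1 * c)) (normr_ge0 N)) n0.
case: ns => [q0|p0].
  have -> : P w - P z - c * (w.1 - z.1) - e * (w.2 - z.2) =
    q1^-1 * (q1 * (P w - P z) - (c * q1 - e * p1) * (w.1 - z.1)) +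
    q1^-1 * e * (- (p1 * (w.1 - z.1)) - q1 * (w.2 - z.2)) by field.
  apply: le_trans (nmD _ _) _.
  apply: le_trans (lerD (nmM_absK _ n0 h1) (nmM_absK _ n0 t)) _.
  by rewrite /K !mulrDl; lra.
have -> : P w - P z - c * (w.1 - z.1) - e * (w.2 - z.2) =
    p1^-1 * (p1 * (P w - P z) + (c * q1 - e * p1) * (w.2 - z.2)) +
    p1^-1 * c * (- (p1 * (w.1 - z.1)) - q1 * (w.2 - z.2)) by field.
apply: le_trans (nmD _ _) _.
apply: le_trans (lerD (nmM_absK _ n0 h2) (nmM_absK _ n0 t)) _.
by rewrite /K !mulrDl; lra.
Unshelve. all: by end_near. Qed.

(* P is a fibrewise primitive of x^k y dx; its derivative psi transversally   *)
(* to the fibres is a fibrewise primitive of the Gelfand-Leray form x^k dx /  *)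
(* F_y.                                                                       *)
Definition gl_pair p q k P psi z0 :=
  (exists d K : R, 0 < d /\ forall z z', n2 (z - z0) < d -> n2 (z' - z0) < d ->
     nm (P z' - P z - z.1 ^+ k * z.2 * (z'.1 - z.1)
          - psi z * (lev p q z' - lev p q z)) <= K * n2 (z' - z) ^+ 2) /\
  lprim p q (fun z => z.1 ^+ k) psi z0.

(** Where [q'] is nonzero this is [chart_primitive] for [x^k y dx]. Where [p'] is nonzero, integrate
    by parts: [(k + 1) x^k y dx = d (x^{k+1} y) - x^{k+1} dy], and apply [chart_primitive] to the
    last form with the coordinates exchanged. *)
Lemma gl_pair_exists p q k z0 : nonsing p q z0 -> exists P psi, gl_pair p q k P psi z0.
Proof.
move=> [q0|p0].
  have [P [psi [d [K [d0 PH psiH]]]]] := chart_primitive p k 1 q0.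
  exists P, psi; split.
    by exists d, K; split=> // z z' zd z'd; rewrite -[z.2 in leLHS]expr1 PH.
  split; first by left.
  near=> z; have zd : n2 (z - z0) < d by near: z; apply/nbhs_n2; exists d.
  have qz : q^`().[z.2] != 0 by near: z; exact: near_snd (horner_neq0_near q0).
  have -> : z.1 ^+ k = z.1 ^+ k / q^`().[z.2] * q^`().[z.2] - 0 * p^`().[z.1].
    by rewrite mul0r subr0 divfK.
  apply: fder_form; have [M MH] := psiH _ zd; exists M.
  near=> w; have wd : n2 (w - z0) < d by near: w; exact: n2_ball_near.
  move=> E.
  by have := MH _ wd E; rewrite mul0r subr0 !mul1r expr0 mulr1.
have [|P [psi [d [K [d0 PH psiH]]]]] := @chart_primitive _ q p (swp z0) 0 k.+1.
  exact: p0.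
pose m : C := k.+1%:R; have m0 : m != 0 by rewrite pnatr_eq0.
exists (fun z => (z.1 ^+ k.+1 * z.2 - P (swp z)) / m), (fun z => - psi (swp z) / m).
split.
  have [g [cg gE]] := cdX k.+1 (cd_id (@disc_bounded _ z0.1 d)).
  have [L L0 xL] := cd_lip cg; case: cg => [M [M0 _ _ xM]].
  exists d, (nm m^-1 * (M * (d + nm z0.2) + L + `|K|)); split=> // z z' zd z'd.
  have zx : disc z0.1 d z.1 by apply: le_lt_trans zd; exact: (n2_fst (z - z0)).
  have z'x : disc z0.1 d z'.1 by apply: le_lt_trans z'd; exact: (n2_fst (z' - z0)).
  have zy : disc z0.2 d z.2 by apply: le_lt_trans zd; exact: (n2_snd (z - z0)).
  have := PH (swp z) (swp z'); rewrite !n2_swapB !swpK !lev_swap => /(_ zd z'd).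
  rewrite expr0 mul1r /= => h.
  have h1 := xM _ _ zx z'x; rewrite gE /= mulr1 -/m in h1.
  have h2 := xL _ _ zx z'x.
  have -> : (z'.1 ^+ k.+1 * z'.2 - P (swp z')) / m - (z.1 ^+ k.+1 * z.2 - P (swp z)) / m
    - z.1 ^+ k * z.2 * (z'.1 - z.1) - - psi (swp z) / m * (lev p q z' - lev p q z)
   = m^-1 * ((z'.1 ^+ k.+1 - z.1 ^+ k.+1 - m * z.1 ^+ k * (z'.1 - z.1)) * z.2 +
      (z'.1 ^+ k.+1 - z.1 ^+ k.+1) * (z'.2 - z.2) +
      - (P (swp z') - P (swp z) - z.1 ^+ k.+1 * (z'.2 - z.2)
         - psi (swp z) * (lev p q z' - lev p q z))).
    by field.
  rewrite nmM -[leRHS]mulrA ler_wpM2l ?nm_ge0//.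
  have n0 := n2_ge0 (z' - z).
  have [s1 s2] := n2_sqr (z' - z).
  have f1 := nmM_le (le_trans h1 (ler_wpM2l M0 s1)) (disc_bounded zy).
  have f2 := nmM_le h2 (n2_snd (z' - z)).
  have f3 : nm (- (P (swp z') - P (swp z) - z.1 ^+ k.+1 * (z'.2 - z.2)
         - psi (swp z) * (lev p q z' - lev p q z))) <= `|K| * n2 (z' - z) ^+ 2.
    rewrite nmN; apply: le_trans h _; rewrite ler_wpM2r ?exprn_ge0//.
    exact: ler_norm.
  apply: le_trans (nmD3 f1 f2 f3) _.
  have f4 : L * nm (z'.1 - z.1) * n2 (z' - z) <= L * n2 (z' - z) ^+ 2.
    by rewrite -mulrA ler_wpM2l.
  by rewrite /= in f4 *; lra.
split; first by right.
near=> z; have zd : n2 (z - z0) < d by near: z; apply/nbhs_n2; exists d.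
have pz : p^`().[z.1] != 0 by near: z; exact: near_fst (horner_neq0_near p0).
have -> : z.1 ^+ k = 0 * q^`().[z.2] - (- (z.1 ^+ k / p^`().[z.1])) * p^`().[z.1].
  by rewrite mul0r sub0r mulNr opprK divfK.
apply: fder_form; have [|M MH] := psiH (swp z); first by rewrite n2_swapB swpK.
exists (nm m^-1 * `|M|).
near=> w; have wd : n2 (w - z0) < d by near: w; exact: n2_ball_near.
move=> E.
have := MH (swp w); rewrite !n2_swapB !swpK !lev_swap => /(_ wd E).
rewrite expr0 mulr1 /= -/m => h.
have -> : - psi (swp w) / m - - psi (swp z) / m - 0 * (w.1 - z.1) -
    - (z.1 ^+ k / p^`().[z.1]) * (w.2 - z.2) =
  - m^-1 * (psi (swp w) - psi (swp z) - m * z.1 ^+ k / p^`().[z.1] * (w.2 - z.2)).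
  by field; rewrite pz; move: m0; rewrite /m -natr1 addrC.

by rewrite mulNr nmN; apply: nmM_absK => //; rewrite exprn_ge0 ?n2_ge0.
Unshelve. all: by end_near. Qed.

Lemma gl_pair_lprim p q k P psi z0 : nonsing p q z0 -> gl_pair p q k P psi z0 ->
  lprim p q (fun z => z.1 ^+ k * z.2 * q^`().[z.2]) P z0.
Proof.
move=> ns [[d [K [d0 H]]] _]; split=> //; near=> z.
have zd : n2 (z - z0) < d by near: z; apply/nbhs_n2; exists d.
have -> : z.1 ^+ k * z.2 * q^`().[z.2] =
  z.1 ^+ k * z.2 * q^`().[z.2] - 0 * p^`().[z.1] by rewrite mul0r subr0.
apply: fder_form; exists K; near=> w.
have wd : n2 (w - z0) < d by near: w; exact: n2_ball_near.
move=> E.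
by have := H _ _ zd wd; rewrite E subrr mul0r mulr0 subr0.
Unshelve. all: by end_near. Qed.

Lemma near_near z (A : set (C * C)) :
  (\forall w \near z, A w) -> \forall w \near z, \forall w' \near w, A w'.
Proof.
move=> /nbhs_n2[r r0 rA]; apply/nbhs_n2; exists r => // w wz.
by apply: filterS (n2_ball_near wz) => w'; exact: rA.
Qed.

Lemma lprim_near p q (a : C * C -> C) P z0 : lprim p q a P z0 -> \forall z \near z0, lprim p q a P z.
Proof.
move=> [/nonsing_near H1 /near_near H2]; near=> z; split; near: z => //.
Unshelve. all: by end_near. Qed.

Lemma gl_pair_near p q k P psi z0 : gl_pair p q k P psi z0 ->
  \forall z \near z0, gl_pair p q k P psi z.
Proof.
move=> [[d [K [d0 H]]] /lprim_near l]; near=> z; split; last by near: z.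
have zd : n2 (z - z0) < d by near: z; apply/nbhs_n2; exists d.
exists (d - n2 (z - z0)), K; split=> [|w w' wz w'z]; first by rewrite subr_gt0.
have aux x : n2 (x - z) < d - n2 (z - z0) -> n2 (x - z0) < d.
  move=> xz; have -> : x - z0 = (x - z) + (z - z0) by rewrite addrA subrK.
  by apply: le_lt_trans (n2D _ _) _; lra.
by apply: H; exact: aux.
Unshelve. all: by end_near. Qed.

End gelfand_leray.

(** * Linearity and uniqueness of primitives; local sections *)

Section fibre_derivations.
Variable R : realType.
Local Notation C := (cplx R).
Implicit Types (p q : {poly C}) (z : C * C) (P Q : C * C -> C) (a b : C * C -> C).

(** A function [k] of the level is constant on each fibre and acts there as a scalar. This is how
    multiplication by polynomials in [t] enters. *)
Lemma fder_axpy p q (a b : C) (k : C -> C) P Q z :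
  fder p q a P z -> fder p q b Q z ->
  fder p q (a + k (lev p q z) * b) (fun w => P w + k (lev p q w) * Q w) z.
Proof.
move=> [K HK] [M HM]; set t := lev p q z; exists (K + nm (k t) * `|M|).
apply: filterS2 HK HM => w h h' E; have [h1 h2] := h E; have [h3 h4] := h' E; rewrite E.
have n0 : 0 <= n2 (w - z) ^+ 2 by rewrite exprn_ge0 ?n2_ge0.
split.
  have -> : q^`().[z.2] * (P w + k t * Q w - (P z + k t * Q z)) -
      (a + k t * b) * (w.1 - z.1) =
    (q^`().[z.2] * (P w - P z) - a * (w.1 - z.1)) +
    k t * (q^`().[z.2] * (Q w - Q z) - b * (w.1 - z.1)) by ring.
  by rewrite mulrDl; apply: le_trans (nmD _ _) _; apply: lerD => //; exact: nmM_absK.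
have -> : p^`().[z.1] * (P w + k t * Q w - (P z + k t * Q z)) +
    (a + k t * b) * (w.2 - z.2) =
  (p^`().[z.1] * (P w - P z) + a * (w.2 - z.2)) +
  k t * (p^`().[z.1] * (Q w - Q z) + b * (w.2 - z.2)) by ring.
by rewrite mulrDl; apply: le_trans (nmD _ _) _; apply: lerD => //; exact: nmM_absK.
Qed.

Lemma lprim_axpy p q a b (k : C -> C) P Q z0 :
  lprim p q a P z0 -> lprim p q b Q z0 ->
  lprim p q (fun z => a z + k (lev p q z) * b z) (fun w => P w + k (lev p q w) * Q w) z0.
Proof.
move=> [ns HP] [_ HQ]; split=> //; near=> z; apply: fder_axpy; near: z => //.
Unshelve. all: by end_near. Qed.

Lemma lprim_ext p q a b P z0 : a =1 b -> lprim p q a P z0 -> lprim p q b P z0.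
Proof.
by move=> E [ns H]; split=> //; apply: filterS H => z; rewrite E.
Qed.

Lemma lprim_sub_cst p q a P Q z0 : lprim p q a P z0 -> lprim p q a Q z0 ->
  exists2 d, 0 < d & forall z z', n2 (z - z0) < d -> n2 (z' - z0) < d ->
    lev p q z = lev p q z' -> P z' - P z = Q z' - Q z.
Proof.
move=> hP hQ.
have : lprim p q (fun=> 0) (fun w => P w + -1 * Q w) z0.
  by apply: lprim_ext (lprim_axpy (fun=> -1) hP hQ) => z; ring.
move=> /fder0_cst[d d0 H]; exists d => // z z' zd z'd /(H _ _ zd z'd) E.
have -> : P z' = (P z' + -1 * Q z') + Q z' by ring.
by rewrite -E; ring.
Qed.

Lemma local_section p q z0 : nonsing p q z0 ->
  exists (s : C -> C * C) (s1 : C -> C) (d L : R),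
  [/\ 0 < d, 0 <= L, s (lev p q z0) = z0,
    forall t, nm (t - lev p q z0) < d -> lev p q (s t) = t &
    forall t t', nm (t - lev p q z0) < d -> nm (t' - lev p q z0) < d ->
      n2 (s t' - s t) <= L * nm (t' - t) /\
      nm ((s t').1 - (s t).1 - s1 t * (t' - t)) <= L * nm (t' - t) ^+ 2].
Proof.
set t0 := lev p q z0; move=> [q0|p0].
  have [d [rho [c [r [V [[d0 rho0 _ dr _] _ _ VE [Vu cV]]]]]]] :=
    @chart_box _ p q z0 1 ltr01 q0.
  have E t : nm (t - t0) < rho -> disc q.[z0.2] rho (t - p.[z0.1]).
    rewrite /disc /= /t0 /lev; have -> // : t - p.[z0.1] - q.[z0.2] = t - (p.[z0.1] + q.[z0.2]).
    by rewrite opprD addrA.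
  have [L L0 VL] := cd_lip cV.
  exists (fun t => (z0.1, V (t - p.[z0.1]))), (fun=> 0), rho, L; split=> //.
  - rewrite /t0 /lev addrC addKr Vu ?/disc /= ?subrr ?nm0//; first by case: (z0).
    exact: lt_le_trans d0 dr.
  - by move=> t /E/VE[tE _]; rewrite /lev /= tE addrC subrK.
  - move=> t t' /E td /E t'd; split.
      rewrite /n2 /= subrr nm0 add0r; apply: le_trans (VL _ _ td t'd) _.
      by have -> : t' - p.[z0.1] - (t - p.[z0.1]) = t' - t by ring.
    by rewrite /= subrr mul0r subr0 nm0 mulr_ge0 ?exprn_ge0 ?nm_ge0.
have [d [rho [c [r [V [[d0 rho0 _ dr _] _ _ VE [Vu cV]]]]]]] :=
  @chart_box _ q p (swp z0) 1 ltr01 p0; rewrite /= in Vu VE cV.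
have E t : nm (t - t0) < rho -> disc p.[z0.1] rho (t - q.[z0.2]).
  rewrite /disc /= /t0 /lev; have -> // : t - q.[z0.2] - p.[z0.1] = t - (p.[z0.1] + q.[z0.2]).
  by rewrite opprD addrA addrAC.
have [L L0 VL] := cd_lip cV; case: cV => [M [M0 _ _ VM]].
have tE t t' : t' - q.[z0.2] - (t - q.[z0.2]) = t' - t by ring.
exists (fun t => (V (t - q.[z0.2]), z0.2)),
  (fun t => (p^`().[V (t - q.[z0.2])])^-1), rho, (L + M); split=> //.
- exact: addr_ge0.
- rewrite /t0 /lev addrK Vu ?/disc /= ?subrr ?nm0//; first by case: (z0).
  exact: lt_le_trans d0 dr.
- by move=> t /E/VE[h _]; rewrite /lev /= h subrK.
- move=> t t' /E td /E t'd; split.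
    rewrite /n2 /= subrr nm0 addr0; apply: le_trans (VL _ _ td t'd) _.
    by rewrite tE ler_wpM2r ?nm_ge0// lerDl.
  have := VM _ _ td t'd; rewrite tE /= => h; apply: le_trans h _.
  by rewrite ler_wpM2r ?exprn_ge0 ?nm_ge0// lerDr.
Qed.

End fibre_derivations.

(** * Continuation of primitives over the square *)

Section continuation.
Variable R : realType.
Local Notation C := (cplx R).
Implicit Types (p q : {poly C}) (z : C * C) (P Q : C * C -> C) (a b : C * C -> C).
Implicit Types (u v : R * R).

Lemma locally_constant (phi : R -> C) :
  (forall x : R, 0 <= x <= 1 -> exists2 d : R, 0 < d &
     forall y : R, 0 <= y <= 1 -> `|y - x| < d -> phi y = phi x) -> phi 1 = phi 0.
Proof.
move=> H; apply/eqP; rewrite -subr_eq0 -nm_eq0; apply/eqP/le_anti; rewrite nm_ge0 andbT.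
apply: mean_value_ineq => x x01; have [d d0 dH] := H _ x01.
exists d => // y y01 /(dH _ y01) ->; by rewrite subrr nm0 mul0r.
Qed.

(** A Lebesgue number, uniform in the parameter [t]. The index [d] depends on [u] only, so the same
    local primitive serves on all fibres close to the one over [t0]. *)
Lemma cover (D : Type) (L : D -> C * C -> Prop) (s : C -> R * R -> C * C) (t0 : C)
    (K : set (R * R)) :
  (forall d z, L d z -> \forall w \near z, L d w) -> compact K ->
  (forall u, K u -> (fun x : C * (R * R) => s x.1 x.2) @ (t0, u) --> s t0 u) ->
  (forall u, K u -> exists d, L d (s t0 u)) ->
  exists2 e : R, 0 < e & forall u, K u -> exists d,
    forall t u', nm (t - t0) < e -> ball u e u' -> L d (s t u').
Proof.
move=> openL /compact_near_coveringP cK cs ex.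
pose Q (e : R) u := exists d, forall t u', nm (t - t0) < e -> ball u e u' -> L d (s t u').
have H : \forall e \near 0^'+, K `<=` Q e.
  apply: (cK R 0^'+ Q) => u Ku; have [d Ld] := ex u Ku.
  have [e' e'0 eE] : exists2 e' : R, 0 < e' & forall t v,
      nm (t - t0) < e' -> ball u e' v -> L d (s t v).
    have := cs u Ku _ (openL _ _ Ld); rewrite near_simpl.
    move=> [[A B] /= [/nbhs_nm[r r0 rA] /nbhs_ballP[r' /= r'0 rB]] AB].
    exists (Num.min r r') => [|t v]; first by rewrite lt_min r0.
    rewrite lt_min => /andP[tr _] uv; apply: (AB (t, v)); split => /=; first exact: rA.
    by apply: rB; apply: le_ball uv; rewrite ge_min lexx orbT.
  exists (ball u (e' / 2), [set x | x < e' / 2]) => /=.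
    split; first by apply: nbhsx_ballx; rewrite divr_gt0.
    by apply: nbhs_right_lt; rewrite divr_gt0.
  move=> [v x] [/= uv xe]; exists d => t u' tx vu'; apply: eE.
    by lra.
  by rewrite (splitr e'); apply: ball_triangle uv _; apply: le_ball vu'; exact: ltW.
near (0:R)^'+ => e; exists e; first by near: e; exact: nbhs_right_gt.
by near: e.
Unshelve. all: by end_near. Qed.

Definition square : set (R * R) := [set u | 0 <= u.1 <= 1 /\ 0 <= u.2 <= 1].

Lemma compact_square : compact square.
Proof.
have -> : square = `[0, 1]%classic `*` `[0, 1]%classic.
  by apply/seteqP; split => u /=; rewrite !in_itv.
by apply: compact_setX; exact: segment_compact.
Qed.

Definition dist2 u v : R := Num.max `|u.1 - v.1| `|u.2 - v.2|.

Lemma dist2_ball u v (e : R) : dist2 u v < e <-> ball u e v.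
Proof. by rewrite /dist2 gt_max; split => [/andP[]|[]] //= h1 h2; apply/andP. Qed.

Definition mix u v (x : R) : R * R := (u.1 + x * (v.1 - u.1), u.2 + x * (v.2 - u.2)).

Lemma mix_square u v x : 0 <= x <= 1 -> square u -> square v -> square (mix u v x).
Proof.
have aux (a b : R) : 0 <= x <= 1 -> 0 <= a <= 1 -> 0 <= b <= 1 -> 0 <= a + x * (b - a) <= 1.
  move=> /andP[x0 x1] /andP[a0 a1] /andP[b0 b1].
  have y0 : 0 <= 1 - x by rewrite subr_ge0.
  have := mulr_ge0 y0 a0; have := mulr_ge0 x0 b0.
  have : 0 <= (1 - x) * (1 - a) by rewrite mulr_ge0// subr_ge0.
  have : 0 <= x * (1 - b) by rewrite mulr_ge0// subr_ge0.
  lra.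
by move=> x01 [h1 h2] [h3 h4]; split; exact: aux.
Qed.

Lemma mix0 u v : mix u v 0 = u.
Proof. by case: u => a b; rewrite /mix /=; congr pair; ring. Qed.

Lemma mix1 u v : mix u v 1 = v.
Proof. by case: v => a b; rewrite /mix /=; congr pair; ring. Qed.

Lemma mix_ball u v w (e x : R) : 0 <= x <= 1 -> ball w e u -> ball w e v ->
  ball w e (mix u v x).
Proof.
have aux (a b c : R) : 0 <= x <= 1 -> ball c e a -> ball c e b -> ball c e (a + x * (b - a)).
  rewrite -!ball_normE /= => /andP[x0 x1] h1 h2.
  have -> : c - (a + x * (b - a)) = (1 - x) * (c - a) + x * (c - b) by ring.
  apply: le_lt_trans (ler_normD _ _) _; have y0 : 0 <= 1 - x by rewrite subr_ge0.
  rewrite !normrM (ger0_norm x0) (ger0_norm y0).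
  have [->|xn0] := eqVneq x 0; first by rewrite subr0 mul1r mul0r addr0.
  have xp : 0 < x by rewrite lt_def xn0.
  have : x * `|c - b| < x * e by rewrite ltr_pM2l.
  have : (1 - x) * `|c - a| <= (1 - x) * e by rewrite ler_wpM2l// ltW.
  lra.
by move=> x01 [h1 h2] [h3 h4]; split; exact: aux.
Qed.

Lemma mix_lip u v (x y : R) : dist2 (mix u v x) (mix u v y) <= `|x - y| * dist2 v u.
Proof.
rewrite /dist2 /mix /= ge_max.
have E (a b : R) : a + x * (b - a) - (a + y * (b - a)) = (x - y) * (b - a) by ring.
by rewrite !E !normrM !ler_wpM2l// le_max lexx ?orbT.
Qed.

(** [g] is a continuation along [s] of local primitives. Only its increments are prescribed, since
    primitives are determined up to a constant on a fibre. *)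
Definition along p q a (s : R * R -> C * C) (g : R * R -> C) :=
  forall u, square u -> exists2 P, lprim p q a P (s u) &
    exists2 e : R, 0 < e & forall v v', square v -> square v' ->
      ball u e v -> ball u e v' -> g v' - g v = P (s v') - P (s v).

(** The difference of two primitives is locally constant along the image of the segment from [u] to
    [v], which stays in one fibre. *)
Lemma overlap p q a (s : R * R -> C * C) (t : C) P Q u v : continuous s ->
  (forall w, lev p q (s w) = t) ->
  (forall x, 0 <= x <= 1 -> lprim p q a P (s (mix u v x))) ->
  (forall x, 0 <= x <= 1 -> lprim p q a Q (s (mix u v x))) ->
  P (s v) - P (s u) = Q (s v) - Q (s u).
Proof.
move=> cs st hP hQ.
have : forall w w', P w - P w' - (Q w - Q w') = (P w - Q w) - (P w' - Q w').
  by move=> *; ring.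
move=> E; apply/eqP; rewrite -subr_eq0 E subr_eq0; apply/eqP.
pose phi x := P (s (mix u v x)) - Q (s (mix u v x)).
suff : phi 1 = phi 0 by rewrite /phi mix0 mix1.
apply: locally_constant => x x01.
have [d d0 dH] := lprim_sub_cst (hP _ x01) (hQ _ x01).
have : \forall w \near s (mix u v x), n2 (w - s (mix u v x)) < d by apply/nbhs_n2; exists d.
move=> /cs /nbhs_ballP[r /= r0 rH].
have m1 : 0 < dist2 v u + 1 by rewrite ltr_wpDl// /dist2 le_max normr_ge0.
exists (r / (dist2 v u + 1)); first exact: divr_gt0.
move=> y y01; rewrite ltr_pdivlMr// => yx.
have sy : n2 (s (mix u v y) - s (mix u v x)) < d.
  apply: rH; apply/dist2_ball; apply: le_lt_trans (mix_lip _ _ _ _) _.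
  by rewrite distrC; have := normr_ge0 (y - x); lra.
have sx : n2 (s (mix u v x) - s (mix u v x)) < d by rewrite subrr n20.
have := dH _ _ sx sy; rewrite !st => /(_ erefl) H.
by rewrite /phi -(subrK (P (s (mix u v x))) (P (s (mix u v y)))) H; ring.
Qed.

(* On close pairs the increments of the local primitives define a cocycle,    *)
(* which is integrated along the rays issued from the origin.                 *)
Lemma along_exists p q a (s : R * R -> C * C) (t : C) : continuous s ->
  (forall u, lev p q (s u) = t) ->
  (forall u, square u -> exists P, lprim p q a P (s u)) ->
  exists g, along p q a s g.
Proof.
move=> cs st ex.
have [|u Ku|e e0 eH] := @cover _ (fun P z => lprim p q a P z) (fun=> s) 0 square _ compact_square _ ex.
- by move=> P z; exact: lprim_near.
- apply: (cvg_comp snd s _ (cs u)); exact: cvg_snd.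
have H u : exists P : C * C -> C,
    square u -> forall v, ball u e v -> lprim p q a P (s v).
  have [Ku|nKu] := pselect (square u); last by exists (fun=> 0).
  have [P PH] := eH _ Ku; exists P => _ v; apply: (PH 0).
  by rewrite subrr nm0.
have [Pr PrH] := choice H.
pose D u v := Pr u (s v) - Pr u (s u).
have bb u : ball u e u by exact: ballxx.
have ov u v v' w : square u -> square v -> square v' -> square w ->
    ball u e v -> ball u e v' -> ball w e v -> ball w e v' ->
    Pr w (s v') - Pr w (s v) = Pr u (s v') - Pr u (s v).
  move=> Ku Kv Kv' Kw uv uv' wv wv'.
  by apply: (overlap (a := a) cs st) => x x01; apply: PrH => //; exact: mix_ball.
have [N [N0 Ne]] : exists N : nat, (0 < N)%N /\ N%:R^-1 < e / 2.
  have e2 : 0 < (e / 2)^-1 by rewrite invr_gt0 divr_gt0.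
  exists (Num.truncn (e / 2)^-1).+1; split=> //.
  rewrite -[ltRHS]invrK ltf_pV2 ?posrE//.
  by have := truncnS_gt (e / 2)^-1.
have Nn0 : (0 : R) < N%:R by rewrite ltr0n.
pose A u (j : nat) : R * R := mix (0, 0) u (j%:R / N%:R).
have jN (j : nat) : (j <= N)%N -> 0 <= (j%:R / N%:R : R) <= 1.
  by move=> jN; rewrite divr_ge0//= ler_pdivrMr// mul1r ler_nat.
have K0 : square (0, 0) by split; rewrite /= lexx ler01.
have AK u j : square u -> (j <= N)%N -> square (A u j).
  by move=> Ku /jN h; exact: mix_square.
pose g u := \sum_(0 <= j < N) D (A u j) (A u j.+1).
have AA u v (d : R) j : (j <= N)%N -> ball u d v -> ball (A u j) d (A v j).
  move=> /jN/andP[h0 h1] /dist2_ball uv; apply/dist2_ball; apply: le_lt_trans uv.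
  have E (x y : R) : `|0 + j%:R / N%:R * (x - 0) - (0 + j%:R / N%:R * (y - 0))| <= `|x - y|.
    rewrite !subr0 !add0r -mulrBr normrM (ger0_norm h0).
    by rewrite -[leRHS]mul1r ler_wpM2r.
  by rewrite /A /mix /dist2 /= ge_max !le_max !E orbT.
have AS u j : square u -> ball (A u j) (e / 2) (A u j.+1).
  move=> [u1 u2]; apply/dist2_ball; apply: le_lt_trans Ne.
  apply: le_trans (mix_lip _ _ _ _) _.
  have -> : j%:R / N%:R - j.+1%:R / N%:R = - N%:R^-1 :> R by rewrite -natr1; ring.
  have Ni : 0 <= N%:R^-1 :> R by rewrite invr_ge0 ltW.
  rewrite normrN ger0_norm// -[leRHS]mulr1 ler_wpM2l// /dist2 /= !subr0 ge_max.
  by move: u1 u2 => /andP[? ?] /andP[? ?]; rewrite !ger0_norm//; apply/andP.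
have key u v : square u -> square v -> ball u (e / 2) v -> g v - g u = D u v.
  move=> Ku Kv uv; rewrite /g -sumrB.
  (* The increments around the small quadrilateral with vertices [A u j], [A u j.+1], [A v j.+1],
     [A v j] cancel, since one primitive covers all of it; summed over [j], the transversal
     increments telescope. *)
  have step j : (j < N)%N -> D (A v j) (A v j.+1) - D (A u j) (A u j.+1) =
      D (A u j.+1) (A v j.+1) - D (A u j) (A v j).
    move=> jN'; have jN1 := ltnW jN'.
    have b1 : ball (A u j) e (A v j) by apply: le_ball (AA _ _ _ _ jN1 uv); lra.
    have b2 : ball (A u j) e (A v j.+1).
      by rewrite (splitr e); apply: ball_triangle (AS _ j Ku) (AA _ _ _ _ jN' uv).
    have b3 : ball (A v j) e (A v j.+1) by apply: le_ball (AS _ j Kv); lra.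
    have b4 : ball (A u j) e (A u j.+1) by apply: le_ball (AS _ j Ku); lra.
    have b5 : ball (A u j.+1) e (A v j.+1) by apply: le_ball (AA _ _ _ _ jN' uv); lra.
    have Ku1 := AK _ _ Ku jN1; have Ku2 := AK _ _ Ku jN'.
    have Kv1 := AK _ _ Kv jN1; have Kv2 := AK _ _ Kv jN'.
    rewrite /D (ov (A u j) (A v j) (A v j.+1) (A v j))//.
    rewrite (ov (A u j) (A u j.+1) (A v j.+1) (A u j.+1))//; ring.
  rewrite (eq_big_nat _ _ (F2 := fun j => D (A u j.+1) (A v j.+1) - D (A u j) (A v j))).
    rewrite telescope_sumr// /A divff ?gt_eqF// !mul0r !mix0 !mix1.
    by rewrite /D subrr subr0.
  by move=> j /andP[_ /step].
exists g => u Ku; exists (Pr u); first exact: PrH.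
exists (e / 4); first by rewrite divr_gt0.
move=> v v' Kv Kv' uv uv'.
have vv' : ball v (e / 2) v'.
  have -> : e / 2 = e / 4 + e / 4 by lra.
  by apply: ball_triangle uv'; exact: ball_sym.
rewrite (key _ _ Kv Kv' vv') /D; apply: ov => //.
- by apply: le_ball uv; lra.
- by apply: le_ball uv'; lra.
- by apply: le_ball vv'; lra.
Qed.

End continuation.

(** * Integrals over paths and singular chains *)

Section path_integrals.
Variable R : realType.
Local Notation C := (cplx R).
Implicit Types (p q : {poly C}) (z : C * C) (P Q : C * C -> C) (a b : C * C -> C).
Implicit Types (c : R -> C * C) (g h : R -> C).

Definition along1 p q a c g :=
  forall u : R, 0 <= u <= 1 -> exists2 P, lprim p q a P (c u) &
    exists2 e : R, 0 < e & forall v v' : R, 0 <= v <= 1 -> 0 <= v' <= 1 ->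
      `|v - u| < e -> `|v' - u| < e -> g v' - g v = P (c v') - P (c v).

Lemma along_line p q a (s : R * R -> C * C) G (l : R -> R * R) : along p q a s G ->
  (forall u, 0 <= u <= 1 -> square (l u)) ->
  (forall u v, dist2 (l u) (l v) <= `|u - v|) ->
  along1 p q a (s \o l) (G \o l).
Proof.
move=> H lK lL u u01; have [P PH [e e0 eH]] := H _ (lK _ u01).
exists P => //; exists e => // v v' v01 v'01 vu v'u.
by apply: eH => /=; try (by apply: lK); apply/dist2_ball; apply: le_lt_trans (lL _ _) _;
  rewrite distrC.
Qed.

Lemma along1_exists p q a c (t : C) : continuous c -> (forall u, lev p q (c u) = t) ->
  (forall u, 0 <= u <= 1 -> exists P, lprim p q a P (c u)) -> exists g, along1 p q a c g.
Proof.
(* A path is treated as a map of the square that ignores the second coordinate. *)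
move=> cc ct ex; have [|//|u [u1 _]|G GH] := @along_exists _ p q a (c \o fst) t.
- by move=> u; apply: continuous_comp; [exact: cvg_fst|exact: cc].
- by move=> u; exact: ct.
- exact: ex.
exists (fun u => G (u, 0)).
apply: (along_line (l := fun u => (u, 0)) GH) => [u u01|u v]; first by split; rewrite //= lexx ler01.
by rewrite /dist2 /= subrr normr0 ge_max lexx normr_ge0.
Qed.

Lemma along1_ext p q a b c g : a =1 b -> along1 p q a c g -> along1 p q b c g.
Proof.
move=> E H u u01; have [P PH eH] := H _ u01; exists P => //.
exact: lprim_ext E PH.
Qed.

Lemma along1_axpy p q a b (k : C -> C) c g h (t : C) : (forall u, lev p q (c u) = t) ->
  along1 p q a c g -> along1 p q b c h ->
  along1 p q (fun z => a z + k (lev p q z) * b z) c (fun u => g u + k t * h u).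
Proof.
move=> ct H H' u u01; have [P PH [e e0 eH]] := H _ u01.
have [P' PH' [e' e'0 eH']] := H' _ u01.
exists (fun w => P w + k (lev p q w) * P' w); first exact: lprim_axpy.
exists (Num.min e e'); first by rewrite lt_min e0.
move=> v v' v01 v'01; rewrite !lt_min => /andP[h1 h2] /andP[h3 h4]; rewrite !ct.
have E1 := eH v v' v01 v'01 h1 h3; have E2 := eH' v v' v01 v'01 h2 h4.
have -> : g v' + k t * h v' - (g v + k t * h v) = (g v' - g v) + k t * (h v' - h v) by ring.
by rewrite E1 E2; ring.
Qed.

Lemma along1_0 p q c g (t : C) : continuous c -> (forall u, lev p q (c u) = t) ->
  along1 p q (fun=> 0) c g -> g 1 = g 0.
Proof.
move=> cc ct H; apply: locally_constant => u u01.
have [P PH [e e0 eH]] := H _ u01; have [d d0 dH] := fder0_cst PH.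
have : \forall w \near c u, n2 (w - c u) < d by apply/nbhs_n2; exists d.
move=> /cc /nbhs_ballP[r /= r0 rH].
exists (Num.min e r); first by rewrite lt_min e0.
move=> v v01; rewrite lt_min => /andP[ve vr].
have := eH u v u01 v01; rewrite subrr normr0 => /(_ e0 ve).
rewrite (dH (c v) (c u)) ?ct ?subrr ?n20//; last first.
  by apply: rH; rewrite -ball_normE /= distrC.
by move=> E; apply/eqP; rewrite -subr_eq0 E.
Qed.

Lemma along1_uniq p q a c g h (t : C) : continuous c -> (forall u, lev p q (c u) = t) ->
  along1 p q a c g -> along1 p q a c h -> g 1 - g 0 = h 1 - h 0.
Proof.
move=> cc ct hg hh; have H := along1_axpy (fun=> -1) ct hg hh.
have E : (fun z => a z + -1 * a z) =1 (fun=> 0) by move=> z; ring.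
have := along1_0 cc ct (along1_ext E H); rewrite !mulN1r => e.
have -> : g 1 = (g 1 - h 1) + h 1 by ring.
by rewrite e; ring.
Qed.

(* The integral, along a continuous path in a fibre of F = p + q, of the form *)
(* whose value on the tangent vector (q', - p') is a.                         *)
Definition Om p q a c : C := xget 0 [set v | exists2 g, along1 p q a c g & v = g 1 - g 0].

Lemma OmE p q a c g (t : C) : continuous c -> (forall u, lev p q (c u) = t) ->
  along1 p q a c g -> Om p q a c = g 1 - g 0.
Proof.
move=> cc ct hg; rewrite /Om; case: xgetP => [v _ [h hh ->]|/(_ (g 1 - g 0)) []].
  exact: along1_uniq cc ct hh hg.
by exists g.
Qed.

Lemma Om_axpy p q a b (k : C -> C) c (t : C) : continuous c ->
  (forall u, lev p q (c u) = t) ->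
  (forall u, 0 <= u <= 1 -> exists P, lprim p q a P (c u)) ->
  (forall u, 0 <= u <= 1 -> exists P, lprim p q b P (c u)) ->
  Om p q (fun z => a z + k (lev p q z) * b z) c = Om p q a c + k t * Om p q b c.
Proof.
move=> cc ct /(along1_exists cc ct)[g gH] /(along1_exists cc ct)[h hH].
rewrite (OmE cc ct gH) (OmE cc ct hH) (OmE cc ct (along1_axpy k ct gH hH)); ring.
Qed.

Lemma Om_prim p q a P c (t : C) : continuous c -> (forall u, lev p q (c u) = t) ->
  (forall u, 0 <= u <= 1 -> lprim p q a P (c u)) -> Om p q a c = P (c 1) - P (c 0).
Proof.
move=> cc ct H; apply: (OmE (g := P \o c) cc ct) => u u01; exists P; first exact: H.
by exists 1.
Qed.

(** Evaluates the integral with a prescribed subdivision and prescribed primitives, which can then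
    be kept fixed while the fibre varies. On each cell the continuation and the prescribed primitive
    differ by a locally constant function. *)
Lemma Om_sum p q a c (t : C) (N : nat) (P : nat -> C * C -> C) : continuous c ->
  (forall u, lev p q (c u) = t) ->
  (forall u, 0 <= u <= 1 -> exists P, lprim p q a P (c u)) -> (0 < N)%N ->
  (forall j, (j < N)%N -> forall u, j%:R / N%:R <= u <= j.+1%:R / N%:R ->
     lprim p q a (P j) (c u)) ->
  Om p q a c = \sum_(0 <= j < N) (P j (c (j.+1%:R / N%:R)) - P j (c (j%:R / N%:R))).
Proof.
move=> cc ct /(along1_exists cc ct)[g gH] N0 PH; rewrite (OmE cc ct gH).
have Nn0 : (0 : R) < N%:R by rewrite ltr0n.
have -> : g 1 - g 0 = \sum_(0 <= j < N) (g (j.+1%:R / N%:R) - g (j%:R / N%:R)).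
  by rewrite (telescope_sumr (fun j => g (j%:R / N%:R)))// mul0r divff// gt_eqF.
apply: eq_big_nat => j /andP[_ jN].
pose l (x : R) := j%:R / N%:R + x * (j.+1%:R / N%:R - j%:R / N%:R).
have jj : j.+1%:R / N%:R - j%:R / N%:R = N%:R^-1 :> R by rewrite -natr1; ring.
have Ni : 0 <= N%:R^-1 :> R by rewrite invr_ge0 ltW.
have j0 : 0 <= j%:R / N%:R :> R by rewrite divr_ge0.
have j1 : j.+1%:R / N%:R <= 1 :> R by rewrite ler_pdivrMr// mul1r ler_nat.
have lb x : 0 <= x <= 1 -> j%:R / N%:R <= l x <= j.+1%:R / N%:R.
  move=> /andP[x0 x1]; rewrite /l jj lerDl mulr_ge0//=.
  have : x * N%:R^-1 <= N%:R^-1 by rewrite ler_piMl.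
  by move: jj; lra.
have l01 x : 0 <= x <= 1 -> 0 <= l x <= 1.
  by move=> /lb/andP[h1 h2]; rewrite (le_trans j0 h1) (le_trans h2 j1).
have l0 : l 0 = j%:R / N%:R by rewrite /l mul0r addr0.
have l1 : l 1 = j.+1%:R / N%:R by rewrite /l mul1r addrC subrK.
suff : g (l 1) - P j (c (l 1)) = g (l 0) - P j (c (l 0)).
  rewrite l0 l1 => E; have -> : forall x y, g x - g y = (g x - P j (c x)) + P j (c x) - g y.
    by move=> x y; ring.
  by rewrite E; ring.
apply: (@locally_constant _ (fun x => g (l x) - P j (c (l x)))) => x x01.
have [Q QH [e e0 eH]] := gH _ (l01 _ x01).
have [d d0 dH] := lprim_sub_cst QH (PH _ jN _ (lb _ x01)).
have : \forall w \near c (l x), n2 (w - c (l x)) < d by apply/nbhs_n2; exists d.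
move=> /cc /nbhs_ballP[r /= r0 rH].
exists (Num.min e r); first by rewrite lt_min e0.
move=> y y01; rewrite lt_min => /andP[ye yr].
have ll : `|l y - l x| <= `|y - x|.
  have -> : l y - l x = (y - x) * N%:R^-1 by rewrite /l jj; ring.
  rewrite normrM (ger0_norm Ni) ler_piMr// invf_le1// ler1n//.
have := eH (l x) (l y) (l01 _ x01) (l01 _ y01); rewrite subrr normr0.
move=> /(_ e0 (le_lt_trans ll ye)) E.
have := dH (c (l x)) (c (l y)); rewrite !ct subrr n20 => /(_ d0 _ erefl) E'.
have {}E' := E' (rH _ _).
have -> : g (l y) = (g (l y) - g (l x)) + g (l x) by ring.
rewrite E E'; first by ring.
by rewrite -ball_normE /= distrC; exact: le_lt_trans ll yr.
Qed.

End path_integrals.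

(** * Parametrizations of the standard simplices *)

Section simplices.
Variable R : realType.
Local Notation C := (cplx R).

Lemma rV_continuous (T : topologicalType) (k : nat) (f : T -> 'rV[R]_k.+1) :
  (forall i, continuous (fun x => f x ord0 i)) -> continuous f.
Proof.
move=> H x A /nbhs_ballP[e /= e0 eA].
have : \forall y \near x, forall i, ball (f x ord0 i) e (f y ord0 i).
  by apply: filter_forall => i; apply: H; exact: nbhsx_ballx.
apply: filterS => y yH; apply: eA; split=> // i j.
by rewrite (ord1 i); exact: yH.
Qed.

Lemma clamp01_continuous : continuous (@clamp01 R).
Proof.
apply: (@lipschitz_continuous _ _ 1) => u v; rewrite mul1r; exact: clamp01_lip.
Qed.

Lemma edge_continuous : continuous (@edge R).
Proof.
apply: continuous_comp_initial; apply: rV_continuous => i.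
have -> : (fun x => (set_val \o @edge R) x ord0 i) =
    (fun x => if i == ord0 then 1 - clamp01 x else clamp01 x).
  by apply/funext => x; rewrite /= mxE.
case: (i == ord0) => x; last exact: clamp01_continuous.
by apply: cvgB; [exact: cvg_cst|exact: clamp01_continuous].
Qed.

Lemma triangle_subproof (u : R * R) :
  \row_(j < 3) (if j == 0 :> nat then 1 - clamp01 u.1
    else if j == 1 :> nat then clamp01 u.1 * (1 - clamp01 u.2)
    else clamp01 u.1 * clamp01 u.2) \in std_simplex R 2.
Proof.
have /andP[a0 a1] := clamp01_01 u.1; have /andP[b0 b1] := clamp01_01 u.2.
apply/mem_set; split=> [i|].
  by rewrite mxE; case: ifP => _; [rewrite subr_ge0|case: ifP => _; rewrite mulr_ge0// subr_ge0].
by rewrite !big_ord_recl big_ord0 !mxE /=; ring.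
Qed.

(* The square, with its left side collapsed, as the standard 2-simplex.       *)
Definition triangle (u : R * R) : std_simplex R 2 :=
  exist (fun x => x \in std_simplex R 2) _ (triangle_subproof u).

Lemma triangle_continuous : continuous triangle.
Proof.
apply: continuous_comp_initial; apply: rV_continuous => i.
have -> : (fun x => (set_val \o triangle) x ord0 i) =
   (fun u => if i == 0 :> nat then 1 - clamp01 u.1
    else if i == 1 :> nat then clamp01 u.1 * (1 - clamp01 u.2)
    else clamp01 u.1 * clamp01 u.2).
  by apply/funext => x; rewrite /= mxE.
have c1 : continuous (fun u : R * R => clamp01 u.1).
  by move=> u; apply: continuous_comp; [exact: cvg_fst|exact: clamp01_continuous].
have c2 : continuous (fun u : R * R => clamp01 u.2).
  by move=> u; apply: continuous_comp; [exact: cvg_snd|exact: clamp01_continuous].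
case: (_ == 0%N :> nat) => u; first by apply: cvgB; [exact: cvg_cst|exact: c1].
case: (_ == 1%N :> nat); apply: cvgM; [exact: c1| |exact: c1|exact: c2].
by apply: cvgB; [exact: cvg_cst|exact: c2].
Qed.

Lemma triangle_face0 (v : R) : face ord0 (edge v) = triangle (1, v).
Proof.
apply: val_inj; apply/rowP => j; rewrite !mxE /=.
have c1 : clamp01 (1 : R) = 1 by rewrite clamp01_id// ler01 lexx.
case: unliftP => [j' ->|->] /=; last by rewrite c1 subrr.
by rewrite c1 !mul1r mxE; case: j' => -[|[|]].
Qed.

Lemma triangle_face1 (v : R) : face (fintype.lift ord0 ord0) (edge v) = triangle (v, 1).
Proof.
apply: val_inj; apply/rowP => j; rewrite !mxE /=.
have c1 : clamp01 (1 : R) = 1 by rewrite clamp01_id// ler01 lexx.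
case: unliftP => [j' ->|->] /=; last by rewrite c1 subrr mulr0.
by rewrite c1 mxE; case: j' => -[|[|]] //= i; rewrite mulr1.
Qed.

Lemma triangle_face2 (v : R) : face ord_max (edge v) = triangle (v, 0).
Proof.
apply: val_inj; apply/rowP => j; rewrite !mxE /=.
have c0 : clamp01 (0 : R) = 0 by rewrite clamp01_id// ler01 lexx.
case: unliftP => [j' ->|->] /=; last by rewrite c0 mulr0.
by rewrite c0 mxE; case: j' => -[|[|]] //= i; rewrite subr0 mulr1.
Qed.

Lemma triangle_left (v : R) : triangle (0, v) = triangle (0, 0).
Proof.
apply: val_inj; apply/rowP => j; rewrite !mxE /=.
have -> : clamp01 (0 : R) = 0 by rewrite clamp01_id// ler01 lexx.
by rewrite !mul0r.
Qed.

End simplices.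

(** * Additive functionals on singular chains *)

Section chains.
Variable R : realType.
Local Notation C := (cplx R).

Definition ch (k : nat) (T : topologicalType) (phi : simplex R k T -> C)
    (c : chain R k T) : C :=
  \sum_(s <- dom c) (coeff s c)%:~R * phi s.

(** Identifies the explicit sum with the extension given by the universal property of the free
    group, from which additivity follows. *)
Lemma chE k T (phi : simplex R k T -> C) c :
  ch phi c = fglift (M := zmodule C) phi c.
Proof.
rewrite /ch -[c in RHS]freeg_sumE.
pose G : {additive chain R k T -> zmodule C} := HB.pack (fglift (M := zmodule C) phi)
  (Algebra.isZmodMorphism.Build _ _ (fglift (M := zmodule C) phi)
     (@lift_is_additive _ _ _ _)).
rewrite -[fglift _ _]/(G _) raddf_sum; apply: eq_bigr => s _.
by rewrite /= liftU /GRing.scale /= mulrzl.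
Qed.

Lemma chU k T (phi : simplex R k T -> C) s : ch phi (<< s >> : chain R k T) = phi s.
Proof. by rewrite chE liftU scale1r. Qed.

Lemma chB k T (phi : simplex R k T -> C) : zmod_morphism (ch phi).
Proof. by move=> c c'; rewrite !chE; exact: (@lift_is_additive int _ (zmodule C)). Qed.

HB.instance Definition _ k T (phi : simplex R k T -> C) :=
  Algebra.isZmodMorphism.Build _ _ (ch phi) (chB phi).

Lemma ch_eq k T (phi psi : simplex R k T -> C) c : phi =1 psi -> ch phi c = ch psi c.
Proof. by move=> E; apply: eq_bigr => s _; rewrite E. Qed.

Lemma chain_additive_eq0 k T (V : zmodType) (G : {additive chain R k T -> V}) :
  (forall s : simplex R k T, G << s >> = 0) -> forall c, G c = 0.
Proof.
move=> G0 c; rewrite -[c]freeg_sumE raddf_sum big1// => s _.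
have -> : (<< coeff s c *g s >> : chain R k T) = << s >> *~ coeff s c.
  by rewrite freegU_mulz intz.
by rewrite raddfMz G0 mul0rz.
Qed.

Lemma ch_boundary k T (phi : simplex R k T -> C) (b : chain R k.+1 T) :
  ch phi (boundary b) =
  ch (fun s => \sum_(i < k.+2) (-1) ^+ i * phi (s \o face i : simplex R k T)) b.
Proof.
apply/eqP; rewrite -subr_eq0; apply/eqP.
set psi := (fun s : simplex R k.+1 T => _).
have GB : zmod_morphism (fun b => ch phi (boundary b) - ch psi b).
  by move=> x y /=; rewrite !raddfB /=; ring.
pose G : {additive chain R k.+1 T -> C} := HB.pack (fun b => ch phi (boundary b) - ch psi b)
  (Algebra.isZmodMorphism.Build _ _ _ GB).
apply: (chain_additive_eq0 (G := G)) => s /=.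
rewrite boundaryU chU raddf_sum /= /psi -sumrB big1// => i _.
have E (m : int) (x : chain R k T) : ch phi (m *: x) = m%:~R * ch phi x.
  by rewrite -[m in LHS]intz scaler_int raddfMz /= mulrzl.
by rewrite E chU rmorphXn rmorphN1 subrr.
Qed.

Lemma ch_pushforward k (T U : topologicalType) (f : continuousType T U)
    (phi : simplex R k U -> C) (c : chain R k T) :
  ch phi (Defs.pushforward f c) = ch (fun s => phi (f \o s : simplex R k U)) c.
Proof.
apply/eqP; rewrite -subr_eq0; apply/eqP.
set psi := (fun s : simplex R k T => _).
have GB : zmod_morphism (fun b : chain R k T => ch phi (Defs.pushforward f b) - ch psi b).
  by move=> x y /=; rewrite !raddfB /=; ring.
pose G : {additive chain R k T -> C} := HB.pack (fun b => ch phi (Defs.pushforward f b) - ch psi b)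
  (Algebra.isZmodMorphism.Build _ _ _ GB).
by apply: (chain_additive_eq0 (G := G)) => s /=; rewrite Defs.pushforwardU !chU subrr.
Qed.

Lemma face_edge0 (u : std_simplex R 0) : face ord0 u = edge 1.
Proof.
apply: val_inj; apply/rowP => j; rewrite !mxE /=.
have -> : clamp01 (1 : R) = 1 by rewrite clamp01_id// ler01 lexx.
have [_ u1] := set_valP u; rewrite big_ord1 in u1.
case: unliftP => [j' ->|->] /=; last by rewrite subrr.
by rewrite (ord1 j') -[RHS]u1.
Qed.

Lemma face_edge1 (u : std_simplex R 0) : face ord_max u = edge 0.
Proof.
apply: val_inj; apply/rowP => j; rewrite !mxE /=.
have -> : clamp01 (0 : R) = 0 by rewrite clamp01_id// ler01 lexx.
have [_ u1] := set_valP u; rewrite big_ord1 in u1.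
case: unliftP => [j' ->|->] //=.
by rewrite (ord1 j') subr0 -[RHS]u1.
Qed.

Lemma vertex_subproof : (\row_(j < 1) (1 : R)) \in std_simplex R 0.
Proof.
by apply/mem_set; split=> [i|]; [rewrite mxE|rewrite big_ord1 mxE].
Qed.

Definition vertex : std_simplex R 0 :=
  exist (fun x => x \in std_simplex R 0) _ vertex_subproof.

(** The functional is the 0-cochain [e] composed with the boundary map. It makes every correction
    that depends on end points only disappear on cycles. *)
Lemma ch_vertices (T : topologicalType) (e : T -> C) (c : chain R 1 T) :
  boundary c = 0 -> ch (fun s : simplex R 1 T => e (s (edge 1)) - e (s (edge 0))) c = 0.
Proof.
move=> bc; pose phi (s : simplex R 0 T) := e (s vertex).
have := congr1 (ch phi) bc; rewrite ch_boundary raddf0 => <-; apply: ch_eq => s.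
rewrite big_ord_recl big_ord1 /phi /= face_edge0.
have -> : fintype.lift ord0 (ord0 : 'I_1) = ord_max by exact: val_inj.
by rewrite face_edge1 expr0 expr1 mul1r mulN1r.
Qed.

End chains.

(** * The fundamental theorem of calculus along paths *)

Section fundamental_theorem.
Variable R : realType.
Local Notation C := (cplx R).

Lemma horner_continuous (p : {poly C}) : continuous (horner p).
Proof.
elim/poly_ind: p => [|p c IH] x.
  have -> : horner (0 : {poly C}) = fun=> 0 by apply/funext => y; rewrite horner0.
  exact: (@cst_continuous C C).
have -> : horner (p * 'X + c%:P) = fun y => p.[y] * y + c.
  by apply/funext => y; rewrite !hornerE.
apply: (@cvgD _ C^o _ (nbhs x) _ (fun y => p.[y] * y) (fun=> c)); last exact: cvg_cst.
by apply: (@cvgM _ _ (nbhs x) _ (horner p) id); [exact: IH|exact: cvg_id].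
Qed.

Lemma bieval_continuous (F : bipoly R) : continuous (bieval F).
Proof.
elim/poly_ind: F => [|F c IH] z.
  have -> : bieval (0 : bipoly R) = fun=> 0.
    by apply/funext => y; rewrite /bieval !horner0.
  exact: (@cst_continuous _ C).
have -> : bieval (F * 'X + c%:P) = fun y => bieval F y * y.2 + c.[y.1].
  by apply/funext => y; rewrite /bieval !hornerE.
apply: (@cvgD _ C^o _ (nbhs z) _ (fun y => bieval F y * y.2) (fun y => c.[y.1])).
  by apply: (@cvgM _ _ (nbhs z) _ (bieval F) snd); [exact: IH|exact: cvg_snd].
by apply: (@continuous_comp _ _ _ fst (horner c)); [exact: cvg_fst|exact: horner_continuous].
Qed.

Lemma Re_continuous : continuous (fun a : C => complex.Re a).
Proof.
move=> a A /nbhs_ballP[e /= e0 eA]; apply/nbhs_nm; exists e => // b ba; apply: eA.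
rewrite -ball_normE /= distrC; apply: le_lt_trans ba; apply: le_trans (nm_Re (b - a)).
by case: a b => [? ?] [? ?].
Qed.

Lemma Im_continuous : continuous (fun a : C => complex.Im a).
Proof.
move=> a A /nbhs_ballP[e /= e0 eA]; apply/nbhs_nm; exists e => // b ba; apply: eA.
rewrite -ball_normE /= distrC; apply: le_lt_trans ba; apply: le_trans (nm_Im (b - a)).
by case: a b => [? ?] [? ?].
Qed.

(** The integrand [h] is controlled on the open interval only, because the two-sided derivative of a
    path at an end point depends on its values outside the interval; the end points are negligible
    for the integral. *)
Lemma ftc01 (F f h : R -> R) : {within `[0, 1], continuous f} ->
  (forall u : R, 0 < u < 1 -> is_derive u 1 F (f u)) ->
  (forall u : R, 0 <= u <= 1 -> forall e : R, 0 < e -> exists2 d, 0 < d &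
     forall v : R, 0 <= v <= 1 -> `|v - u| < d -> `|F v - F u| < e) ->
  (forall u : R, 0 < u < 1 -> h u = f u) ->
  \int[lebesgue_measure]_(u in `[0, 1]) h u = F 1 - F 0.
Proof.
move=> cf dF cF hf.
have cf' : measurable_fun (`]0%R, 1%R[%classic : set R) f.
  have m01 : measurable_fun (`[0%R, 1%R]%classic : set R) f.
    exact: subspace_continuous_measurable_fun.
  by apply: measurable_funS m01 => //; exact: subset_itv_oo_cc.
have E : {in `]0%R, 1%R[, f =1 h}.
  by move=> u; rewrite in_itv /= => /hf ->.
have mh : measurable_fun (`]0%R, 1%R[%classic : set R) h.
  apply: eq_measurable_fun cf' => u; rewrite inE; exact: E.
rewrite /Rintegral -(@eq_integral_itv_bounded _ 0 1 h f true false)//.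
rewrite (@continuous_FTC2 _ f F 0 1)//.
- split=> [u| |].
  + by rewrite in_itv /= => /dF[].
  + apply/cvgrPdist_lt => e e0; have [|d d0 H] := cF 0 _ _ e0; first by rewrite lexx ler01.
    near=> v; rewrite distrC; apply: H.
      by apply/andP; split; near: v; [exact: nbhs_right_ge|exact: nbhs_right_le].
    rewrite subr0 ger0_norm; near: v; [exact: nbhs_right_lt|exact: nbhs_right_ge].
  + apply/cvgrPdist_lt => e e0; have [|d d0 H] := cF 1 _ _ e0; first by rewrite ler01 lexx.
    near=> v; rewrite distrC; apply: H.
      by apply/andP; split; near: v; [exact: nbhs_left_ge|exact: nbhs_left_le].
    rewrite distrC ger0_norm ?subr_ge0; last by near: v; exact: nbhs_left_le.
    rewrite ltrBlDr -ltrBlDl; near: v; apply: nbhs_left_gt.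
    by rewrite ltrBlDr ltrDl.
- by move=> u; rewrite in_itv /= derive1E => /dF[].
Unshelve. all: by end_near. Qed.

Definition cexp (phi : R -> C) (u : R) (d : C) := forall e : R, 0 < e ->
  exists2 r, 0 < r & forall v : R, `|v - u| < r ->
    nm (phi v - phi u - (v - u)%:C%C * d) <= e * `|v - u|.

Lemma cexp_ReIm (phi : R -> C) (u : R) (d : C) :
  is_derive u 1 (fun v => complex.Re (phi v)) (complex.Re d) ->
  is_derive u 1 (fun v => complex.Im (phi v)) (complex.Im d) -> cexp phi u d.
Proof.
move=> /is_derive_expansion H1 /is_derive_expansion H2 e e0.
have e2 : 0 < e / 2 by rewrite divr_gt0.
have [d1 d10 {}H1] := H1 _ e2; have [d2 d20 {}H2] := H2 _ e2.
exists (Num.min d1 d2); first by rewrite lt_min d10.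
move=> v; rewrite lt_min => /andP[/H1{}H1 /H2{}H2].
apply: le_trans (nm_ReIm _) _; rewrite (splitr e) mulrDl; apply: lerD.
  move: H1; case: (phi v) (phi u) (d) => [x y] [x' y'] [a b] /=.
  by rewrite mul0r subr0 (mulrC a).
move: H2; case: (phi v) (phi u) (d) => [x y] [x' y'] [a b] /=.
by rewrite mul0r addr0 (mulrC b).
Qed.

Lemma cexp_Re (phi : R -> C) (u : R) (d : C) : cexp phi u d ->
  is_derive u 1 (fun v => complex.Re (phi v)) (complex.Re d).
Proof.
move=> H; apply/is_derive_expansion => e e0; have [r r0 {}H] := H _ e0.
exists r => // v /H; apply: le_trans; apply: le_trans (nm_Re _).
case: (phi v) (phi u) (d) => [x y] [x' y'] [a b] /=.
by rewrite mul0r subr0 (mulrC a).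
Qed.

Lemma cexp_Im (phi : R -> C) (u : R) (d : C) : cexp phi u d ->
  is_derive u 1 (fun v => complex.Im (phi v)) (complex.Im d).
Proof.
move=> H; apply/is_derive_expansion => e e0; have [r r0 {}H] := H _ e0.
exists r => // v /H; apply: le_trans; apply: le_trans (nm_Im _).
case: (phi v) (phi u) (d) => [x y] [x' y'] [a b] /=.
by rewrite mul0r addr0 (mulrC b).
Qed.

Lemma cexp_lip (phi : R -> C) (u : R) (d : C) : cexp phi u d ->
  exists2 r, 0 < r & forall v : R, `|v - u| < r ->
    nm (phi v - phi u) <= (1 + nm d) * `|v - u|.
Proof.
move=> /(_ _ ltr01)[r r0 H]; exists r => // v /H h.
rewrite -(subrK ((v - u)%:C%C * d) (phi v - phi u)) (le_trans (nmD _ _))//.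
by rewrite mulrDl; apply: lerD => //; rewrite nmM nm_real mulrC.
Qed.

(** A chain rule in which [g] need not be a function of [x] and [y]: only its increments from [u]
    are compared with theirs. It is applied to the continuation of a primitive along a path. *)
Lemma cexp_comp (g x y : R -> C) (u r M : R) (c e x' y' : C) : 0 < r ->
  (forall v, `|v - u| < r ->
    nm (g v - g u - c * (x v - x u) - e * (y v - y u)) <=
      M * n2 (x v - x u, y v - y u) ^+ 2) ->
  cexp x u x' -> cexp y u y' -> cexp g u (c * x' + e * y').
Proof.
move=> r0 H cx cy k k0.
have [d1 d10 H1] := cexp_lip cx; have [d2 d20 H2] := cexp_lip cy.
pose S := nm c + nm e + 1; have S0 : 0 < S by rewrite ltr_wpDl// addr_ge0 ?nm_ge0.
have kS : 0 < k / 2 / S by rewrite !divr_gt0.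
have [d3 d30 H3] := cx _ kS; have [d4 d40 H4] := cy _ kS.
pose L := (1 + nm x') + (1 + nm y').
have L0 : 0 <= L by rewrite !addr_ge0 ?nm_ge0.
pose Q := `|M| * L ^+ 2 + 1; have Q0 : 0 < Q by rewrite ltr_wpDl// mulr_ge0 ?exprn_ge0.
exists (Num.min r (Num.min (Num.min d1 d2) (Num.min (Num.min d3 d4) (k / 2 / Q)))).
  by rewrite !lt_min r0 d10 d20 d30 d40 !divr_gt0.
move=> v; rewrite !lt_min ltr_pdivlMr//.
move=> /and3P[/H h /andP[/H1 h1 /H2 h2] /andP[/andP[/H3 h3 /H4 h4] vQ]].
have -> : g v - g u - (v - u)%:C%C * (c * x' + e * y') =
  (g v - g u - c * (x v - x u) - e * (y v - y u)) +
  c * (x v - x u - (v - u)%:C%C * x') + e * (y v - y u - (v - u)%:C%C * y') by ring.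
have N0 := normr_ge0 (v - u).
have t1 : M * n2 (x v - x u, y v - y u) ^+ 2 <= `|M| * (L * `|v - u|) ^+ 2.
  apply: le_trans (ler_wpM2r _ (ler_norm M)) _; first by rewrite exprn_ge0 ?n2_ge0.
  rewrite ler_wpM2l// lerXn2r ?nnegrE ?n2_ge0 ?mulr_ge0//.
  by rewrite /n2 /L /= mulrDl lerD.
apply: le_trans (nmD3 (le_trans h t1) (nmM_le (lexx _) h3) (nmM_le (lexx _) h4)) _.
have t2 : `|M| * (L * `|v - u|) ^+ 2 <= k / 2 * `|v - u|.
  rewrite exprMn mulrA [X in _ * X]expr2 mulrA ler_wpM2r//.
  by move: vQ; rewrite /Q mulrDr mulr1; lra.
have t3 : (nm c + nm e) * (k / 2 / S * `|v - u|) <= k / 2 * `|v - u|.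
  have -> : (nm c + nm e) * (k / 2 / S * `|v - u|) =
    (k / 2 * `|v - u|) * ((nm c + nm e) / S) by ring.
  rewrite ler_piMr ?mulr_ge0 ?(ltW k0)// ler_pdivrMr// mul1r /S lerDl//.
by rewrite mulrDl in t3; lra.
Qed.

Lemma n2_path_near (c : R -> C * C) (u e : R) : continuous c -> 0 < e ->
  exists2 d, 0 < d & forall v : R, `|v - u| < d -> n2 (c v - c u) < e.
Proof.
move=> cc e0.
have : \forall w \near c u, n2 (w - c u) < e by apply/nbhs_n2; exists e.
move=> /cc /nbhs_ballP[d /= d0 dH]; exists d => // v vu.
by apply: dH; rewrite -ball_normE /= distrC.
Qed.

Definition form_tangent (p q : {poly C}) (w : form1 R) (z : C * C) : C :=
  bieval (form_dx w) z * q^`().[z.2] - bieval (form_dy w) z * p^`().[z.1].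

Lemma within01_mul (f k : R -> R) : continuous f -> {within `[0, 1], continuous k} ->
  {within `[0, 1], continuous (fun x => f x * k x)}.
Proof.
move=> cf ck x; apply: (@cvgM _ _ (nbhs (x : subspace `[0, 1])) _ f k); last exact: ck.
exact: (continuous_subspaceT cf).
Qed.

Lemma within01_add (f k : R -> R) : {within `[0, 1], continuous f} ->
  {within `[0, 1], continuous k} -> {within `[0, 1], continuous (fun x => f x + k x)}.
Proof.
move=> cf ck x.
by apply: (@cvgD _ _ _ (nbhs (x : subspace `[0, 1])) _ f k); [exact: cf|exact: ck].
Qed.

(** The continuation [g] of the primitives is an antiderivative of the integrand: [fder_formV]
    expands its increments in those of the coordinates, and [cexp_comp] differentiates. The real and
    imaginary parts are then integrated separately. *)
Lemma path_integral_Om (p q : {poly C}) (w : form1 R) (c : R -> C * C) (t : C) :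
  continuous c -> (forall u, lev p q (c u) = t) ->
  (forall u, 0 <= u <= 1 -> exists P, lprim p q (form_tangent p q w) P (c u)) ->
  C1_path c -> path_integral w c = Om p q (form_tangent p q w) c.
Proof.
move=> cc ct ex [[x1 cx1 dx1] [x2 cx2 dx2] [y1 cy1 dy1] [y2 cy2 dy2]].
have [g gH] := along1_exists cc ct ex; rewrite (OmE cc ct gH).
pose A u := bieval (form_dx w) (c u); pose B u := bieval (form_dy w) (c u).
have gq u : 0 <= u <= 1 -> exists M r, 0 < r /\ forall v, 0 <= v <= 1 -> `|v - u| < r ->
    nm (g v - g u - A u * ((c v).1 - (c u).1) - B u * ((c v).2 - (c u).2)) <=
      M * n2 (c v - c u) ^+ 2.
  move=> u01; have [P PH [e e0 eH]] := gH _ u01.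
  have [M /nbhs_n2[r r0 rH]] := fder_formV PH.1 (nbhs_singleton PH.2).
  have [d d0 dH] := n2_path_near u cc r0.
  exists M, (Num.min e d); split; first by rewrite lt_min e0.
  move=> v v01; rewrite lt_min => /andP[ve vd].
  have -> : g v - g u = P (c v) - P (c u) by apply: eH; rewrite ?subrr ?normr0.
  by apply: rH; [exact: dH|rewrite !ct].
have gc u : 0 <= u <= 1 -> forall e : R, 0 < e -> exists2 d, 0 < d &
    forall v, 0 <= v <= 1 -> `|v - u| < d -> nm (g v - g u) < e.
  move=> u01 e e0; have [M [r [r0 rH]]] := gq _ u01.
  pose S := nm (A u) + nm (B u) + `|M| + 1.
  have S0 : 0 < S by rewrite ltr_wpDl// !addr_ge0 ?nm_ge0.
  have m0 : 0 < Num.min 1 (e / S) by rewrite lt_min ltr01 divr_gt0.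
  have [d d0 dH] := n2_path_near u cc m0.
  exists (Num.min r d); first by rewrite lt_min r0.
  move=> v v01; rewrite lt_min => /andP[vr /dH]; rewrite lt_min ltr_pdivlMr// => /andP[n1 ne].
  have h := rH _ v01 vr; set n := n2 (c v - c u) in h n1 ne.
  have n0 : 0 <= n by exact: n2_ge0.
  have h1 := nmM_le (lexx (nm (A u))) (n2_fst (c v - c u)).
  have h2 := nmM_le (lexx (nm (B u))) (n2_snd (c v - c u)).
  have -> : g v - g u = (g v - g u - A u * ((c v).1 - (c u).1) - B u * ((c v).2 - (c u).2))
     + A u * ((c v).1 - (c u).1) + B u * ((c v).2 - (c u).2) by ring.
  apply: le_lt_trans (nmD3 h h1 h2) _; rewrite -/n.
  have : M * n ^+ 2 <= `|M| * n.
    apply: le_trans (ler_wpM2r _ (ler_norm M)) _; first by rewrite exprn_ge0.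
    by rewrite ler_wpM2l// expr2 ler_piMl// ltW.
  by move: ne; rewrite /S; lra.
pose X u := (x1 u +i* x2 u)%C; pose Y u := (y1 u +i* y2 u)%C.
have gd u : 0 < u < 1 -> cexp g u (A u * X u + B u * Y u).
  move=> u01; have u01' : 0 <= u <= 1 by case/andP: u01 => ? ?; rewrite !ltW.
  have [M [r [r0 rH]]] := gq _ u01'.
  have r'0 : 0 < Num.min r (Num.min u (1 - u)).
    by rewrite !lt_min r0 subr_gt0.
  apply: (@cexp_comp g (fun v => (c v).1) (fun v => (c v).2) u _ M (A u) (B u) (X u) (Y u) r'0).
  - move=> v; rewrite !lt_min => /and3P[vr]; rewrite !ltr_norml => /andP[? ?] /andP[? ?].
    by apply: rH => //; apply/andP; split; lra.
  - by apply: cexp_ReIm; [exact: dx1|exact: dx2].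
  - by apply: cexp_ReIm; [exact: dy1|exact: dy2].
have Ec u : 0 < u < 1 -> cderive (fst \o c) u = X u /\ cderive (snd \o c) u = Y u.
  move=> u01; have /= [_ E1] := dx1 _ u01; have /= [_ E2] := dx2 _ u01.
  have /= [_ E3] := dy1 _ u01; have /= [_ E4] := dy2 _ u01.
  by rewrite /cderive !derive1E /= E1 E2 E3 E4.
have cA : continuous A.
  move=> u; apply: (@continuous_comp _ _ _ c (bieval (form_dx w))); first exact: cc.
  exact: bieval_continuous.
have cB : continuous B.
  move=> u; apply: (@continuous_comp _ _ _ c (bieval (form_dy w))); first exact: cc.
  exact: bieval_continuous.
have cRe (f : R -> C) : continuous f -> continuous (fun u => complex.Re (f u)).
  by move=> cf u; apply: (@continuous_comp _ _ _ f); [exact: cf|exact: Re_continuous].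
have cIm (f : R -> C) : continuous f -> continuous (fun u => complex.Im (f u)).
  by move=> cf u; apply: (@continuous_comp _ _ _ f); [exact: cf|exact: Im_continuous].
have cN (f : R -> R) : continuous f -> continuous (fun u => - f u).
  by move=> cf u; apply: cvgN; exact: cf.
have -> : g 1 - g 0 = ((complex.Re (g 1) - complex.Re (g 0)) +i*
                       (complex.Im (g 1) - complex.Im (g 0)))%C.
  by case: (g 1) (g 0) => [? ?] [? ?].
rewrite /path_integral /cintegral01; congr (_ +i* _)%C.
- apply: (@ftc01 (fun u => complex.Re (g u)) (fun u =>
    (complex.Re (A u) * x1 u + - complex.Im (A u) * x2 u) +
    (complex.Re (B u) * y1 u + - complex.Im (B u) * y2 u))).
  + by apply: within01_add; apply: within01_add; apply: within01_mul => //;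
      do ?apply: cN; (apply: cRe || apply: cIm).
  + move=> u /gd /cexp_Re[h1 h2]; apply: DeriveDef => //; rewrite h2.
    by case: (A u) (B u) => [? ?] [? ?] /=; rewrite !mulNr.
  + move=> u /gc H e /H[d d0 {}H]; exists d => // v v01 /(H _ v01).
    apply: le_lt_trans; apply: le_trans (nm_Re _).
    by case: (g v) (g u) => [? ?] [? ?].
  + move=> u /Ec[-> ->]; rewrite -/(A u) -/(B u).
    by case: (A u) (B u) => [? ?] [? ?] /=; rewrite !mulNr.
- apply: (@ftc01 (fun u => complex.Im (g u)) (fun u =>
    (complex.Re (A u) * x2 u + complex.Im (A u) * x1 u) +
    (complex.Re (B u) * y2 u + complex.Im (B u) * y1 u))).
  + by apply: within01_add; apply: within01_add; apply: within01_mul => //;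
      (apply: cRe || apply: cIm).
  + move=> u /gd /cexp_Im[h1 h2]; apply: DeriveDef => //; rewrite h2.
    by case: (A u) (B u) => [? ?] [? ?] /=.
  + move=> u /gc H e /H[d d0 {}H]; exists d => // v v01 /(H _ v01).
    apply: le_lt_trans; apply: le_trans (nm_Im _).
    by case: (g v) (g u) => [? ?] [? ?].
  + move=> u /Ec[-> ->]; rewrite -/(A u) -/(B u).
    by case: (A u) (B u) => [? ?] [? ?] /=.
Qed.

End fundamental_theorem.

(** * Forms with local primitives on the fibres *)

Section fibre_forms.
Variable R : realType.
Local Notation C := (cplx R).
Implicit Types (p q : {poly C}) (z : C * C) (a b : C * C -> C).

Definition lint p q a := forall z, nonsing p q z -> exists P, lprim p q a P z.

Lemma lint_ext p q a b : a =1 b -> lint p q a -> lint p q b.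
Proof. by move=> E H z /H[P PH]; exists P; apply: lprim_ext PH. Qed.

Lemma lint_axpy p q a b (k : C -> C) : lint p q a -> lint p q b ->
  lint p q (fun z => a z + k (lev p q z) * b z).
Proof.
move=> ha hb z ns; have [P PH] := ha _ ns; have [Q QH] := hb _ ns.
by eexists; apply: lprim_axpy PH QH.
Qed.

Lemma lint_pow p q k : lint p q (fun z => z.1 ^+ k).
Proof. by move=> z /(gl_pair_exists k)[P [psi [_ H]]]; exists psi. Qed.

Lemma lint_pow_dx p q k : lint p q (fun z => z.1 ^+ k * z.2 * q^`().[z.2]).
Proof.
move=> z ns; have [P [psi H]] := gl_pair_exists k ns; exists P.
exact: gl_pair_lprim H.
Qed.

Lemma bieval0 z : bieval (0 : bipoly R) z = 0.
Proof. by rewrite /bieval !horner0. Qed.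

Lemma bievalMXaddC (F : bipoly R) (c : {poly C}) z :
  bieval (F * 'X + c%:P) z = bieval F z * z.2 + c.[z.1].
Proof. by rewrite /bieval !hornerE. Qed.

Lemma dxMXaddC (F : bipoly R) (c : {poly C}) :
  dx (F * 'X + c%:P) = dx F * 'X + (c^`())%:P.
Proof.
apply/polyP => i; rewrite /dx coef_map_id0 ?deriv0// !coefD !coefMX !coefC.
by case: i => [|i] /=; rewrite ?add0r// coef_map_id0 ?deriv0// !addr0.
Qed.

Lemma taylor_bieval (F : bipoly R) z : exists K : R, 0 <= K /\ \forall z' \near z,
  nm (bieval F z' - bieval F z - bieval (dx F) z * (z'.1 - z.1)
      - bieval (dy F) z * (z'.2 - z.2)) <= K * n2 (z' - z) ^+ 2.
Proof.
elim/poly_ind: F => [|F c [K [K0 H]]].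
  exists 0; split=> //; near=> w; have -> : dx (0 : bipoly R) = 0 by rewrite /dx map_poly0.
  by rewrite /dy deriv0 !bieval0 !mul0r !subr0 nm0.
have [M [M0 _ _ cM]] := cd_poly c (@disc_bounded _ z.1 1).
set A := bieval (dx F) z in H *; set B := bieval (dy F) z in H *.
exists (K * (nm z.2 + 1) + (nm A + nm B) + M); split.
  by apply: addr_ge0 => //; apply: addr_ge0; [apply: mulr_ge0|];
    rewrite ?addr_ge0 ?nm_ge0.
near=> w.
have w1 : n2 (w - z) < 1 by near: w; apply/nbhs_n2; exists 1.
have h : nm (bieval F w - bieval F z - A * (w.1 - z.1) - B * (w.2 - z.2))
    <= K * n2 (w - z) ^+ 2 by near: w.
have c1 : nm (c.[w.1] - c.[z.1] - c^`().[z.1] * (w.1 - z.1)) <= M * nm (w.1 - z.1) ^+ 2.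
  apply: cM; first by rewrite /disc /= subrr nm0.
  by apply: le_lt_trans w1; exact: (n2_fst (w - z)).
rewrite dxMXaddC /dy derivMXaddC -/(dy F) !bievalMXaddC.
have -> : bieval (F + dy F * 'X) z = bieval F z + B * z.2.
  by rewrite /bieval !hornerE.
rewrite -/A; have -> : bieval F w * w.2 + c.[w.1] - (bieval F z * z.2 + c.[z.1]) -
    (A * z.2 + c^`().[z.1]) * (w.1 - z.1) - (bieval F z + B * z.2) * (w.2 - z.2) =
  (bieval F w - bieval F z - A * (w.1 - z.1) - B * (w.2 - z.2)) * w.2 +
  (A * (w.1 - z.1) + B * (w.2 - z.2)) * (w.2 - z.2) +
  (c.[w.1] - c.[z.1] - c^`().[z.1] * (w.1 - z.1)) by ring.
have n0 := n2_ge0 (w - z).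
have w2 : nm w.2 <= nm z.2 + 1.
  rewrite -[w.2](subrK z.2) addrC (le_trans (nmD _ _))// lerD2l.
  by apply: ltW; apply: le_lt_trans w1; exact: (n2_snd (w - z)).
have [s1 _] := n2_sqr (w - z).
have f1 := nmM_le h w2.
have g1 := nmM_le (lexx (nm A)) (n2_fst (w - z)).
have g2 := nmM_le (lexx (nm B)) (n2_snd (w - z)).
have f2 := nmM_le (le_trans (nmD _ _) (lerD g1 g2)) (n2_snd (w - z)).
have f3 := le_trans c1 (ler_wpM2l M0 s1).
by apply: le_trans (nmD3 f1 f2 f3) _; rewrite le_eqVlt; apply/orP; left; apply/eqP; ring.
Unshelve. all: by end_near. Qed.

Definition exact_form (S : bipoly R) := Form1 (dx S) (dy S).

Lemma lprim_exact p q (S : bipoly R) z : nonsing p q z ->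
  lprim p q (form_tangent p q (exact_form S)) (bieval S) z.
Proof.
move=> ns; split=> //; near=> w; apply: fder_form.
have [K [_ H]] := taylor_bieval S w.
by exists K; apply: filterS H.
Unshelve. all: by end_near. Qed.

End fibre_forms.

(** * Integrals over homology classes of a fibre *)

Section fibre_homology.
Variable R : realType.
Local Notation C := (cplx R).
Variables (F : bipoly R) (p q : {poly C}).
Hypothesis FE : forall z, bieval F z = lev p q z.
Implicit Types (t : C) (a : C * C -> C).

Lemma path_of_continuous t (s : simplex R 1 (level F t)) : continuous (path_of s).
Proof.
move=> u; apply: (@continuous_comp _ _ _ (@edge R) (set_val \o s)).
  exact: edge_continuous.
apply: continuous_comp; first exact: cts_fun.
exact: initial_continuous.
Qed.

Lemma lev_path_of t (s : simplex R 1 (level F t)) u : lev p q (path_of s u) = t.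
Proof. by rewrite -FE; exact: (set_valP (s (edge u))). Qed.

(** A primitive is continued over the whole triangle, so the integrals over the faces are
    differences of one function [G] at the corners of the square. The left side of the square is
    collapsed to a vertex, hence [G] agrees at its two ends and the alternating sum vanishes. *)
Lemma Om_triangle t a (s : simplex R 2 (level F t)) :
  (forall z, lev p q z = t -> nonsing p q z) -> lint p q a ->
  \sum_(i < 3) (-1) ^+ i * Om p q a (path_of (s \o face i : simplex R 1 (level F t))) = 0.
Proof.
move=> ns la; pose g0 (u : R * R) : C * C := \val (s (triangle u)).
have cg0 : continuous g0.
  move=> u; apply: (@continuous_comp _ _ _ (@triangle R) (set_val \o s)).
    exact: triangle_continuous.
  apply: continuous_comp; first exact: cts_fun.
  exact: initial_continuous.
have lg0 u : lev p q (g0 u) = t by rewrite -FE; exact: (set_valP (s (triangle u))).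
have [|G GH] := @along_exists _ p q a g0 t cg0 lg0.
  by move=> u _; apply/la/ns.
have line (l : R -> R * R) : (forall u, 0 <= u <= 1 -> square (l u)) ->
    (forall u v, dist2 (l u) (l v) <= `|u - v|) -> continuous (g0 \o l) ->
    Om p q a (g0 \o l) = G (l 1) - G (l 0).
  move=> l1 l2 cl; have := along_line GH l1 l2.
  by move=> /(OmE (t := t) cl) -> //= u; exact: lg0.
have e01 : 0 <= (0 : R) <= 1 by rewrite lexx ler01.
have e11 : 0 <= (1 : R) <= 1 by rewrite lexx ler01.
have F0 : path_of (s \o face ord0 : simplex R 1 _) = g0 \o (fun v => (1, v)).
  by apply/funext => v; rewrite /path_of /g0 /= triangle_face0.
have F1 : path_of (s \o face (fintype.lift ord0 ord0) : simplex R 1 _) =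
    g0 \o (fun v => (v, 1)).
  by apply/funext => v; rewrite /path_of /g0 /= triangle_face1.
have F2 : path_of (s \o face ord_max : simplex R 1 _) = g0 \o (fun v => (v, 0)).
  by apply/funext => v; rewrite /path_of /g0 /= triangle_face2.
have G0 : G (0, 1) = G (0, 0).
  have cst : g0 \o (fun v => (0, v)) = fun=> g0 (0, 0).
    by apply/funext => v; rewrite /g0 /= triangle_left.
  have al : along1 p q a (fun=> g0 (0, 0)) (G \o (fun v => (0, v))).
    rewrite -cst; apply: (along_line GH) => [u u01|u v]; first by split.
    by rewrite /dist2 /= subrr normr0 ge_max lexx normr_ge0.
  have al0 : along1 p q a (fun=> g0 (0, 0)) (fun=> 0).
    move=> u u01; have [P PH] := la _ (ns _ (lg0 (0, 0))); exists P => //.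
    by exists 1 => // v v' *; rewrite !subrr.
  have := along1_uniq (t := t) (@cst_continuous _ _ _) (fun=> lg0 _) al al0.
  by rewrite /= subrr => E; apply/eqP; rewrite -subr_eq0 E.
rewrite !big_ord_recl big_ord0 /=.
have -> : fintype.lift ord0 (fintype.lift ord0 ord0) = ord_max :> 'I_3 by exact: val_inj.
have H0 := line (fun v => (1, v)); have H1 := line (fun v => (v, 1)).
have H2 := line (fun v => (v, 0)).
rewrite F0 F1 F2 H0 ?H1 ?H2.
- rewrite /bump /= !expr0 G0; ring.
- by move=> u u01; split.
- by move=> u v; rewrite /dist2 /= subrr normr0 ge_max lexx normr_ge0.
- by rewrite -F2; exact: path_of_continuous.
- by move=> u u01; split.
- by move=> u v; rewrite /dist2 /= subrr normr0 ge_max lexx normr_ge0.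
- by rewrite -F1; exact: path_of_continuous.
- by move=> u u01; split.
- by move=> u v; rewrite /dist2 /= subrr normr0 ge_max lexx normr_ge0.
- by rewrite -F0; exact: path_of_continuous.
Qed.

Definition hom t a (h : H1 R (level F t)) : C :=
  ch (fun s => Om p q a (path_of s)) (\val (repr h)).

(** Independence of the representative: two of them differ by a boundary, on which the functional
    vanishes by [Om_triangle]. *)
Lemma homE t a (c : cycle1 R (level F t)) :
  (forall z, lev p q z = t -> nonsing p q z) -> lint p q a ->
  hom a (H1_class c) = ch (fun s => Om p q a (path_of s)) (\val c).
Proof.
move=> ns la; have /eqmodP/asboolP[b bE] : (repr (H1_class c) = c %[mod H1 R (level F t)])%qT.
  by rewrite reprK.
rewrite /hom; apply/eqP; rewrite -subr_eq0 -raddfB bE /= ch_boundary.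
by rewrite /ch big1// => s _; rewrite (Om_triangle _ ns la) mulr0.
Qed.

Lemma is_integral_hom t (w : form1 R) (h : H1 R (level F t)) (v : C) :
  (forall z, lev p q z = t -> nonsing p q z) -> lint p q (form_tangent p q w) ->
  is_integral w h v -> v = hom (form_tangent p q w) h.
Proof.
move=> ns la [c [<- smooth ->]]; rewrite homE// /chain_integral /ch.
apply: eq_big_seq => s sc; congr (_ * _).
apply: (path_integral_Om (t := t)).
- exact: path_of_continuous.
- exact: lev_path_of.
- by move=> u _; apply/la/ns; exact: lev_path_of.
- exact: smooth.
Qed.

End fibre_homology.

(** * Parallel transport *)

Section quadratic_derivatives.
Variable R : realType.
Local Notation C := (cplx R).

(** A pointwise complex derivative with quadratic remainder. The remainder yields a local Lipschitz
    bound, which makes the notion stable under products and inverses. *)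
Definition qd (f : C -> C) (t df : C) := exists K : R, 0 <= K /\
  \forall t' \near t, nm (f t' - f t - df * (t' - t)) <= K * nm (t' - t) ^+ 2.

Lemma qd_is_derive f t df : qd f t df -> is_derive t 1 f df.
Proof. by move=> [K [_ H]]; apply: (@quadratic_is_derive R f t df K). Qed.

Lemma qd_cst (c t : C) : qd (fun=> c) t 0.
Proof.
exists 0; split=> //; near=> t'; by rewrite subrr mul0r subr0 nm0 mul0r.
Unshelve. all: by end_near. Qed.

Lemma qdD f g t df dg : qd f t df -> qd g t dg ->
  qd (fun x => f x + g x) t (df + dg).
Proof.
move=> [K [K0 HK]] [M [M0 HM]]; exists (K + M); split; first exact: addr_ge0.
apply: filterS2 HK HM => t' h1 h2.
have -> : f t' + g t' - (f t + g t) - (df + dg) * (t' - t) =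
  (f t' - f t - df * (t' - t)) + (g t' - g t - dg * (t' - t)) by ring.
by rewrite [leRHS]mulrDl; apply: le_trans (nmD _ _) _; exact: lerD.
Qed.

Lemma qdZ (c : C) f t df : qd f t df -> qd (fun x => c * f x) t (c * df).
Proof.
move=> [K [K0 HK]]; exists (nm c * K); split; first by rewrite mulr_ge0 ?nm_ge0.
apply: filterS HK => t' h; have -> : c * f t' - c * f t - c * df * (t' - t) =
  c * (f t' - f t - df * (t' - t)) by ring.
by rewrite -mulrA nmM ler_wpM2l ?nm_ge0.
Qed.

Lemma qdB f g t df dg : qd f t df -> qd g t dg ->
  qd (fun x => f x - g x) t (df - dg).
Proof.
move=> hf /(qdZ (-1)) hg; rewrite -mulN1r.
have -> : (fun x => f x - g x) = fun x => f x + -1 * g x.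
  by apply/funext => x; rewrite mulN1r.
exact: qdD.
Qed.

Lemma qd_sum (I : eqType) (s : seq I) (f : I -> C -> C) t (df : I -> C) :
  (forall i, i \in s -> qd (f i) t (df i)) ->
  qd (fun x => \sum_(i <- s) f i x) t (\sum_(i <- s) df i).
Proof.
elim: s => [|i s IH] H.
  rewrite big_nil; have -> : (fun x => \sum_(i <- [::]) f i x) = fun=> 0.
    by apply/funext => x; rewrite big_nil.
  exact: qd_cst.
rewrite big_cons; have -> : (fun x => \sum_(j <- i :: s) f j x) =
    fun x => f i x + \sum_(j <- s) f j x.
  by apply/funext => x; rewrite big_cons.
apply: qdD; first exact/H/mem_head.
by apply: IH => j js; apply: H; rewrite in_cons js orbT.
Qed.

Lemma qd_near (f g : C -> C) t df : (\forall x \near t, f x = g x) -> qd g t df -> qd f t df.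
Proof.
move=> E [K [K0 H]]; exists K; split=> //.
have Et := nbhs_singleton E.
by apply: filterS2 E H => x -> ; rewrite Et.
Qed.

Lemma near_all_seq (I : eqType) (T : topologicalType) (t : T) (s : seq I) (P : I -> T -> Prop) :
  (forall i, i \in s -> \forall x \near t, P i x) ->
  \forall x \near t, forall i, i \in s -> P i x.
Proof.
elim: s => [|i s IH] H; first by near=> x.
have Hi := H i (mem_head _ _).
have Hs : \forall x \near t, forall i, i \in s -> P i x.
  by apply: IH => j js; apply: H; rewrite in_cons js orbT.
by apply: filterS2 Hi Hs => x h1 h2 j; rewrite in_cons => /predU1P[->|/h2].
Unshelve. all: by end_near. Qed.

Lemma continuous_pair (T V W : topologicalType) (f : T -> V) (g : T -> W) (x : T) :
  {for x, continuous f} -> {for x, continuous g} ->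
  {for x, continuous (fun y => (f y, g y))}.
Proof.
move=> cf cg A [[P Q] /= [Pf Qg] PQA].
have h1 : \forall y \near x, P (f y) by exact: cf.
have h2 : \forall y \near x, Q (g y) by exact: cg.
suff : \forall y \near x, A (f y, g y) by [].
by near=> y; apply: PQA; split => /=; near: y.
Unshelve. all: by end_near.
Qed.

Lemma nm_near_near (t : C) (A : set C) :
  (\forall x \near t, A x) -> \forall x \near t, \forall y \near x, A y.
Proof.
move=> /nbhs_nm[r r0 rA]; apply/nbhs_nm; exists r => // x xt.
apply/nbhs_nm; exists (r - nm (x - t)); first by rewrite subr_gt0.
move=> y yx; apply: rA; have -> : y - t = (y - x) + (x - t) by ring.
by apply: le_lt_trans (nmD _ _) _; lra.
Qed.

End quadratic_derivatives.

(** * Differentiation of integrals over transported cycles *)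

Section transport.
Variable R : realType.
Local Notation C := (cplx R).
Variables (F : bipoly R) (p q : {poly C}).
Hypothesis FE : forall z, bieval F z = lev p q z.
Variables (t0 : C) (U : set C) (Phi : C * level F t0 -> C * C).
Hypothesis Ptriv : local_trivialization U Phi.
Hypothesis ns0 : forall z, lev p q z = t0 -> nonsing p q z.
Implicit Types (t : C) (a b : C * C -> C).

(** The simplex carried to the fibre over [t]. It depends only continuously on [t], so its end
    points cannot be differentiated. *)
Definition moved t (s : simplex R 1 (level F t0)) (u : R) : C * C := Phi (t, s (edge u)).

Lemma Ut0 : \forall t \near t0, U t.
Proof. by case: Ptriv => oU U0 _ _ _; exact: open_nbhs_nbhs. Qed.

Lemma Phi_continuous t (z : level F t0) : U t -> {for (t, z), continuous Phi}.
Proof.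
case: Ptriv => oU _ cP _ _ Ut.
have oO : open [set x : C * level F t0 | U x.1].
  by apply: (@open_comp _ _ fst U) => // x _; exact: cvg_fst.
move: cP; rewrite continuous_open_subspace// => cP.
by apply: cP; rewrite inE.
Qed.

Lemma moved_joint (s : simplex R 1 (level F t0)) t (u : R * R) : U t ->
  (fun x : C * (R * R) => moved x.1 s x.2.1) @ (t, u) --> moved t s u.1.
Proof.
move=> Ut.
suff : {for (t, u), continuous (Phi \o (fun x : C * (R * R) => (x.1, s (edge x.2.1))))}.
  by [].
apply: continuous_comp.
  apply: continuous_pair; first exact: cvg_fst.
  apply: (@continuous_comp _ _ _ (fun x : C * (R * R) => edge x.2.1) s); last exact: cts_fun.
  apply: (@continuous_comp _ _ _ (fun x : C * (R * R) => x.2.1) (@edge R)).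
    by apply: (@continuous_comp _ _ _ snd fst); [exact: cvg_snd|exact: cvg_fst].
  exact: edge_continuous.
exact: Phi_continuous.
Qed.

Lemma moved_continuous t s : U t -> continuous (moved t s).
Proof.
move=> Ut u.
apply: (@continuous_comp _ _ _ (fun v : R => (t, s (edge v))) Phi).
  apply: continuous_pair; first exact: cvg_cst.
  by apply: (@continuous_comp _ _ _ (@edge R) s); [exact: edge_continuous|exact: cts_fun].
exact: Phi_continuous.
Qed.

Lemma lev_Phi t z : U t -> lev p q (Phi (t, z)) = t.
Proof. by case: Ptriv => _ _ _ H _ Ut; rewrite -FE H. Qed.

Lemma Phi0 z : Phi (t0, z) = \val z.
Proof. by case: Ptriv => _ _ _ _ []. Qed.

Lemma lev_val (z : level F t0) : lev p q (\val z) = t0.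
Proof. by rewrite -FE; exact: (set_valP z). Qed.

Definition good t (s : simplex R 1 (level F t0)) :=
  U t /\ forall u, 0 <= u <= 1 -> nonsing p q (moved t s u).

Lemma cover_moved (D : Type) (L : D -> C * C -> Prop) (s : simplex R 1 (level F t0)) :
  (forall d z, L d z -> \forall w \near z, L d w) ->
  (forall z : level F t0, exists d, L d (\val z)) ->
  exists2 e : R, 0 < e & forall u, 0 <= u <= 1 -> exists d,
    forall t u', nm (t - t0) < e -> `|u' - u| < e -> L d (moved t s u').
Proof.
move=> oL ex.
have [u _|u _|e e0 eH] := @cover _ D L (fun t u => moved t s u.1) t0 (@square R) oL
  (@compact_square R).
- by apply: moved_joint; exact: nbhs_singleton Ut0.
- by rewrite /moved Phi0.
exists e => // u u01; have [|d dH] := eH (u, 0); first by split; rewrite //= lexx ler01.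
exists d => t u' tt uu; apply: (dH t (u', 0)) => //.
by apply/dist2_ball; rewrite /dist2 /= subrr normr0 gt_max e0 distrC uu.
Qed.

Lemma good_near s : \forall t \near t0, good t s.
Proof.
have [|z|e e0 eH] := @cover_moved unit (fun _ z => nonsing p q z) s.
- by move=> _ z; exact: nonsing_near.
- by exists tt; apply: ns0; exact: lev_val.
have H : \forall t \near t0, nm (t - t0) < e by apply/nbhs_nm; exists e.
apply: filterS2 Ut0 H => t Ut te; split=> // u /eH[_]; apply => //.
by rewrite subrr normr0.
Qed.

Lemma good_Om_axpy t s a b (k : C -> C) : good t s -> lint p q a -> lint p q b ->
  Om p q (fun z => a z + k (lev p q z) * b z) (moved t s) =
  Om p q a (moved t s) + k t * Om p q b (moved t s).
Proof.
move=> [Ut ns] la lb; apply: Om_axpy; first exact: moved_continuous.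
- by move=> u; exact: lev_Phi.
- by move=> u /ns/la.
- by move=> u /ns/lb.
Qed.

Lemma Phi_near (z : level F t0) (d : R) : 0 < d ->
  \forall t \near t0, n2 (Phi (t, z) - \val z) < d.
Proof.
move=> d0; have : \forall w \near Phi (t0, z), n2 (w - \val z) < d.
  by rewrite Phi0; apply/nbhs_n2; exists d.
have c : (fun t => Phi (t, z)) @ t0 --> Phi (t0, z).
  apply: (@continuous_comp _ _ _ (fun t => (t, z)) Phi).
    by apply: continuous_pair; [exact: cvg_id|exact: cst_continuous].
  by apply: Phi_continuous; exact: nbhs_singleton Ut0.
by move=> /c.
Qed.

Section derivative.
Variable k : nat.

Let a1 (z : C * C) := z.1 ^+ k * z.2 * q^`().[z.2].
Let a0 (z : C * C) := z.1 ^+ k.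

(* At a point of the fibre over t0: a holomorphic local section of F, with    *)
(* the derivative of its first coordinate, and a local primitive.             *)
Definition vertex_datum (z : level F t0)
    (x : ((C -> C * C) * (C -> C)) * ((C * C -> C) * (C * C -> C))) :=
  [/\ exists d L : R, [/\ 0 < d, 0 <= L, x.1.1 t0 = \val z,
        forall t, nm (t - t0) < d -> lev p q (x.1.1 t) = t &
        forall t t', nm (t - t0) < d -> nm (t' - t0) < d ->
          n2 (x.1.1 t' - x.1.1 t) <= L * nm (t' - t) /\
          nm ((x.1.1 t').1 - (x.1.1 t).1 - x.1.2 t * (t' - t)) <= L * nm (t' - t) ^+ 2] &
      gl_pair p q k x.2.1 x.2.2 (\val z)].

Lemma vertex_data : exists x : level F t0 -> _, forall z, vertex_datum z (x z).
Proof.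
suff H z : exists x, vertex_datum z x by have [x xH] := choice H; exists x.
have ns := ns0 (lev_val z).
have [s [s1 [d [L [d0 L0 sz h1 h2]]]]] := local_section ns.
have [P [psi H]] := gl_pair_exists k ns; rewrite lev_val in sz h1 h2.
by exists ((s, s1), (P, psi)); split=> //; exists d, L.
Qed.

Lemma section_near z x (d : R) : vertex_datum z x -> 0 < d ->
  \forall t \near t0, lev p q (x.1.1 t) = t /\ n2 (x.1.1 t - \val z) < d.
Proof.
move=> [[r [L [r0 L0 xz h1 h2]]] _] d0.
have L1 : 0 < L + 1 by rewrite ltr_wpDl.
apply/nbhs_nm; exists (Num.min r (d / (L + 1))); first by rewrite lt_min r0 divr_gt0.
move=> t; rewrite lt_min ltr_pdivlMr// => /andP[tr td]; split; first exact: h1.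
have t0r : nm (t0 - t0) < r by rewrite subrr nm0.
rewrite -xz; have [h _] := h2 t0 t t0r tr; apply: le_lt_trans h _.
by have := nm_ge0 (t - t0); lra.
Qed.

(** Along a section the level moves at unit speed and contributes [psi], the transversal derivative
    of [P]; the displacement of the first coordinate contributes [x^k y] times its speed. *)
Lemma section_qd z x (P psi : C * C -> C) : vertex_datum z x ->
  gl_pair p q k P psi (\val z) ->
  \forall t \near t0, qd (P \o x.1.1) t
    (psi (x.1.1 t) + (x.1.1 t).1 ^+ k * (x.1.1 t).2 * x.1.2 t).
Proof.
move=> vd [[e [K [e0 KH]]] _].
have H := section_near vd e0; case: vd => [[r [L [r0 L0 xz h1 h2]]] _].
have Hr : \forall t \near t0, nm (t - t0) < r by apply/nbhs_nm; exists r.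
have : \forall t \near t0, \forall t' \near t,
    (lev p q (x.1.1 t') = t' /\ n2 (x.1.1 t' - \val z) < e) /\ nm (t' - t0) < r.
  exact: nm_near_near (filterI H Hr).
apply: filterS => t HH; have [[lt st] tr] := nbhs_singleton HH.
set s := x.1.1 in lt st h1 h2 HH *.
pose A := (s t).1 ^+ k * (s t).2.
exists (`|K| * L ^+ 2 + nm A * L); split.
  by rewrite addr_ge0 ?mulr_ge0 ?exprn_ge0 ?nm_ge0.
apply: filterS HH => t' [[lt' st'] t'r].
have [g1 g2] := h2 _ _ tr t'r; have := KH _ _ st st'; rewrite lt lt' => g3.
have -> : (P \o s) t' - (P \o s) t - (psi (s t) + A * x.1.2 t) * (t' - t) =
  (P (s t') - P (s t) - A * ((s t').1 - (s t).1) - psi (s t) * (t' - t)) +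
  A * ((s t').1 - (s t).1 - x.1.2 t * (t' - t)) by rewrite /=; ring.
apply: le_trans (nmD _ _) _; rewrite [leRHS]mulrDl .
apply: lerD; last by rewrite -mulrA; exact: nmM_le (lexx _) g2.
apply: le_trans g3 _; apply: le_trans (ler_wpM2r _ (ler_norm K)) _.
  by rewrite exprn_ge0 ?n2_ge0.
rewrite -mulrA -exprMn ler_wpM2l// lerXn2r ?nnegrE ?n2_ge0//.
by rewrite mulr_ge0 ?nm_ge0.
Qed.

(** The transported point and the holomorphic section lie on the same fibre and close to each other,
    so the increment between them does not depend on the chosen primitive. *)
Lemma section_compare z x a P Q : vertex_datum z x ->
  lprim p q a P (\val z) -> lprim p q a Q (\val z) ->
  \forall t \near t0, P (Phi (t, z)) - P (x.1.1 t) = Q (Phi (t, z)) - Q (x.1.1 t).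
Proof.
move=> vd hP hQ; have [d d0 dH] := lprim_sub_cst hP hQ.
near=> t; apply: dH.
- by have [] : lev p q (x.1.1 t) = t /\ n2 (x.1.1 t - \val z) < d
    by near: t; exact: section_near.
- by near: t; exact: Phi_near.
- have Ut : U t by near: t; exact: Ut0.
  have [-> _] : lev p q (x.1.1 t) = t /\ n2 (x.1.1 t - \val z) < d
    by near: t; exact: section_near.
  by rewrite lev_Phi.
Unshelve. all: by end_near. Qed.

Lemma gl_pair_lprim1 P psi z : gl_pair p q k P psi z -> lprim p q a1 P z.
Proof. by move=> H; apply: (gl_pair_lprim _ H); case: H => _ []. Qed.

(** Each integral splits into a part [E], [E'] recording the discrepancy between the transported end
    points and the holomorphic sections through them, and a part [G], [G'] built from holomorphic
    sections only. Only [G] is differentiated; up to another end point term [b], its derivative is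
    [G']. *)
Lemma transport_simplex (x : level F t0 -> _) (s : simplex R 1 (level F t0)) :
  (forall z, vertex_datum z (x z)) ->
  let E t z := (x z).2.1 (Phi (t, z)) - (x z).2.1 ((x z).1.1 t) in
  let E' t z := (x z).2.2 (Phi (t, z)) - (x z).2.2 ((x z).1.1 t) in
  let b t z := ((x z).1.1 t).1 ^+ k * ((x z).1.1 t).2 * (x z).1.2 t in
  exists G G' : C -> C, \forall t \near t0,
    [/\ Om p q a1 (moved t s) = E t (s (edge 1)) - E t (s (edge 0)) + G t,
        Om p q a0 (moved t s) = E' t (s (edge 1)) - E' t (s (edge 0)) + G' t &
        qd G t (G' t + (b t (s (edge 1)) - b t (s (edge 0))))].
Proof.
move=> vd E E' b.
have [|z|e e0 eH] := @cover_moved ((C * C -> C) * (C * C -> C))%type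
  (fun d z => gl_pair p q k d.1 d.2 z) s.
- by move=> d z; exact: gl_pair_near.
- have [P [psi H]] := gl_pair_exists k (ns0 (lev_val z)); by exists (P, psi).
have [N [N0 Ne]] : exists N : nat, (0 < N)%N /\ N%:R^-1 < e.
  exists (Num.truncn e^-1).+1; split=> //.
  by rewrite -[ltRHS]invrK ltf_pV2 ?posrE ?invr_gt0// truncnS_gt.
have Nn0 : (0 : R) < N%:R by rewrite ltr0n.
pose v (j : nat) : R := j%:R / N%:R.
have v01 j : (j <= N)%N -> 0 <= v j <= 1.
  by move=> jN; rewrite divr_ge0//= ler_pdivrMr// mul1r ler_nat.
have v0 : v 0%N = 0 by rewrite /v mul0r.
have v1 : v N = 1 by rewrite /v divff// gt_eqF.
have vS j : v j.+1 = v j + N%:R^-1 by rewrite /v -natr1; ring.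
have Ni : 0 <= N%:R^-1 :> R by rewrite invr_ge0 ltW.
have Hd j : exists d : (C * C -> C) * (C * C -> C), (j < N)%N ->
    forall t u', nm (t - t0) < e -> `|u' - v j| < e -> gl_pair p q k d.1 d.2 (moved t s u').
  have [jN|jN] := boolP (j < N)%N; last by exists (fun=> 0, fun=> 0).
  by have [d dH] := eH _ (v01 _ (ltnW jN)); exists d.
have [d dH] := choice Hd.
have cell j u : v j <= u <= v j.+1 -> `|u - v j| < e.
  by rewrite vS => /andP[h1 h2]; rewrite ger0_norm ?subr_ge0//; lra.
have cellL j : `|v j - v j| < e by rewrite subrr normr0.
have cellR j : `|v j.+1 - v j| < e.
  by apply: cell; rewrite lexx andbT vS lerDl.
pose z j : level F t0 := s (edge (v j)).
have mz j : moved t0 s (v j) = \val (z j) by rewrite /moved Phi0.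
have t0e : nm (t0 - t0) < e by rewrite subrr nm0.
have dL j : (j < N)%N -> gl_pair p q k (d j).1 (d j).2 (\val (z j)).
  by move=> jN; rewrite -mz; apply: dH.
have dR j : (j < N)%N -> gl_pair p q k (d j).1 (d j).2 (\val (z j.+1)).
  by move=> jN; rewrite -mz; apply: dH.
(* On each cell, the increment of its fixed primitive between the sections through the two ends. By
   [section_compare] the discrepancies at interior subdivision points are the same from both sides,
   so they telescope. *)
exists (fun t => \sum_(0 <= j < N) ((d j).1 ((x (z j.+1)).1.1 t) - (d j).1 ((x (z j)).1.1 t))).
exists (fun t => \sum_(0 <= j < N) ((d j).2 ((x (z j.+1)).1.1 t) - (d j).2 ((x (z j)).1.1 t))).
have Hcmp : \forall t \near t0, forall j, j \in iota 0 N ->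
    ((d j).1 (Phi (t, z j.+1)) - (d j).1 ((x (z j.+1)).1.1 t) = E t (z j.+1) /\
     (d j).1 (Phi (t, z j)) - (d j).1 ((x (z j)).1.1 t) = E t (z j)) /\
    ((d j).2 (Phi (t, z j.+1)) - (d j).2 ((x (z j.+1)).1.1 t) = E' t (z j.+1) /\
     (d j).2 (Phi (t, z j)) - (d j).2 ((x (z j)).1.1 t) = E' t (z j)).
  apply: near_all_seq => j; rewrite mem_iota add0n => /= jN.
  have [_ g1] := vd (z j.+1); have [_ g2] := vd (z j).
  have [l1 l2] := (dR _ jN, dL _ jN).
  apply: filterI; apply: filterI.
  - exact: (section_compare (a := a1) (vd _) (gl_pair_lprim1 l1) (gl_pair_lprim1 g1)).
  - exact: (section_compare (a := a1) (vd _) (gl_pair_lprim1 l2) (gl_pair_lprim1 g2)).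
  - exact: (section_compare (a := a0) (vd _) l1.2 g1.2).
  - exact: (section_compare (a := a0) (vd _) l2.2 g2.2).
have Hqd : \forall t \near t0, forall j, j \in iota 0 N ->
    qd ((d j).1 \o (x (z j.+1)).1.1) t ((d j).2 ((x (z j.+1)).1.1 t) + b t (z j.+1)) /\
    qd ((d j).1 \o (x (z j)).1.1) t ((d j).2 ((x (z j)).1.1 t) + b t (z j)).
  apply: near_all_seq => j; rewrite mem_iota add0n => /= jN.
  by apply: filterI; apply: section_qd; do ?[exact: vd|exact: dL|exact: dR].
have He : \forall t \near t0, nm (t - t0) < e by apply/nbhs_nm; exists e.
apply: filterS (filterI (filterI (good_near s) He) (filterI Hcmp Hqd)).
move=> t [[[Ut ns] te] [cmp hqd]].
have cm := @moved_continuous t s Ut.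
have lm u : lev p q (moved t s u) = t by exact: lev_Phi.
have jin j : (0 <= j < N)%N -> j \in iota 0 N by rewrite mem_iota add0n.
have tele (f : level F t0 -> C) :
    f (s (edge 1)) - f (s (edge 0)) = \sum_(0 <= j < N) (f (z j.+1) - f (z j)).
  by rewrite (telescope_sumr (fun j => f (z j)))// /z v0 v1.
split.
- rewrite (Om_sum (P := fun j => (d j).1) cm lm _ N0).
  + rewrite (tele (E t)) -big_split; apply: eq_big_nat => j /jin/cmp[[<- <-] _].
    by rewrite /moved /= -/(v j) -/(v j.+1) -/(z j) -/(z j.+1); ring.
  + by move=> u /ns h; exact: (@lint_pow_dx _ p q k _ h).
  + by move=> j jN u /cell uj; apply: gl_pair_lprim1; exact: dH.
- rewrite (Om_sum (P := fun j => (d j).2) cm lm _ N0).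
  + rewrite (tele (E' t)) -big_split; apply: eq_big_nat => j /jin/cmp[_ [<- <-]].
    by rewrite /moved /= -/(v j) -/(v j.+1) -/(z j) -/(z j.+1); ring.
  + by move=> u /ns h; exact: (@lint_pow _ p q k _ h).
  + by move=> j jN u /cell uj; have [_] := dH j jN t u te uj.
- rewrite (tele (b t)) -big_split /=; apply: qd_sum => j.
  rewrite mem_index_iota => /jin/hqd[h1 h2].
  have -> : (d j).2 ((x (z j.+1)).1.1 t) - (d j).2 ((x (z j)).1.1 t) +
     (b t (z j.+1) - b t (z j)) =
     ((d j).2 ((x (z j.+1)).1.1 t) + b t (z j.+1)) -
     ((d j).2 ((x (z j)).1.1 t) + b t (z j)) by ring.
  exact: qdB h1 h2.
Qed.

(** The Gelfand-Leray formula [I_k' = J_k]. On a cycle the end point terms [E], [E'] and [b] of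
    [transport_simplex] all cancel by [ch_vertices]. *)
Lemma transport_derivative (c : chain R 1 (level F t0)) : boundary c = 0 ->
  \forall t \near t0,
    qd (fun t => ch (fun s => Om p q a1 (moved t s)) c) t (ch (fun s => Om p q a0 (moved t s)) c).
Proof.
move=> bc; have [x vd] := vertex_data.
pose E t z := (x z).2.1 (Phi (t, z)) - (x z).2.1 ((x z).1.1 t).
pose E' t z := (x z).2.2 (Phi (t, z)) - (x z).2.2 ((x z).1.1 t).
pose b t z := ((x z).1.1 t).1 ^+ k * ((x z).1.1 t).2 * (x z).1.2 t.
have [G GH] := choice (fun s => transport_simplex s vd).
have [G' {}GH] := choice GH.
have : \forall t \near t0, forall s, s \in dom c ->
   [/\ Om p q a1 (moved t s) = E t (s (edge 1)) - E t (s (edge 0)) + G s t,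
       Om p q a0 (moved t s) = E' t (s (edge 1)) - E' t (s (edge 0)) + G' s t &
       qd (G s) t (G' s t + (b t (s (edge 1)) - b t (s (edge 0))))].
  by apply: near_all_seq => s _; exact: GH.
move=> /nm_near_near; apply: filterS => t Ht.
have split (e : level F t0 -> C) (phi psi : simplex R 1 (level F t0) -> C) :
    (forall s, s \in dom c -> phi s = e (s (edge 1)) - e (s (edge 0)) + psi s) ->
    ch phi c = ch psi c.
  move=> H; rewrite -[RHS]add0r -(ch_vertices e bc) /ch -big_split /=.
  by apply: eq_big_seq => s /H ->; rewrite mulrDr.
apply: (@qd_near _ _ (fun t => ch (fun s => G s t) c)).
  by apply: filterS Ht => t' H; apply: (split (E t')) => s /H[].
have H0 := nbhs_singleton Ht.
rewrite (split (E' t) _ (fun s => G' s t)); last by move=> s /H0[].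
rewrite (_ : ch _ c = ch (fun s => G' s t + (b t (s (edge 1)) - b t (s (edge 0)))) c).
  by apply: qd_sum => s /H0[_ _ h]; exact: qdZ.
by apply/esym/(split (b t)) => s _; rewrite addrC.
Qed.

End derivative.

Lemma good_chain_near (c : chain R 1 (level F t0)) :
  \forall t \near t0, U t /\ forall s, s \in dom c -> good t s.
Proof.
have H : \forall t \near t0, forall s, s \in dom c -> good t s.
  by apply: (near_all_seq (P := fun s t => good t s)) => s _; exact: good_near.
by apply: filterS2 Ut0 H.
Qed.

Lemma ch_moved_axpy t (c : chain R 1 (level F t0)) a b (k : C -> C) :
  (forall s, s \in dom c -> good t s) -> lint p q a -> lint p q b ->
  ch (fun s => Om p q (fun z => a z + k (lev p q z) * b z) (moved t s)) c =
  ch (fun s => Om p q a (moved t s)) c + k t * ch (fun s => Om p q b (moved t s)) c.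
Proof.
move=> gt la lb; rewrite /ch mulr_sumr -big_split /=.
by apply: eq_big_seq => s /gt g; rewrite good_Om_axpy//; ring.
Qed.

Lemma ch_moved_exact t (c : chain R 1 (level F t0)) (S : bipoly R) :
  boundary c = 0 -> (forall s, s \in dom c -> good t s) ->
  ch (fun s => Om p q (form_tangent p q (exact_form S)) (moved t s)) c = 0.
Proof.
move=> bc gt; rewrite -(ch_vertices (fun z => bieval S (Phi (t, z))) bc).
apply: eq_big_seq => s /gt[Ut ns]; congr (_ * _).
apply: (Om_prim (t := t)); first exact: moved_continuous.
- by move=> u; exact: lev_Phi.
- by move=> u /ns; exact: lprim_exact.
Qed.

Lemma hom_transported t (h0 : H1 R (level F t0)) (h : H1 R (level F t)) a :
  (forall z, lev p q z = t -> nonsing p q z) -> lint p q a ->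
  transported Phi h0 h ->
  hom p q a h = ch (fun s => Om p q a (moved t s)) (\val (repr h0)).
Proof.
move=> ns la [f fE ->]; rewrite /H1_map homE// /= ch_pushforward.
apply: eq_bigr => s _; congr (_ * Om _ _ _ _).
by apply/funext => u; rewrite /path_of /= fE.
Qed.

End transport.

Lemma leq_size_deriv (K : nzRingType) (g : {poly K}) : (size g^`() <= (size g).-1)%N.
Proof. exact: size_poly. Qed.

(** * Reduction of the periods and the Picard-Fuchs system *)

Section periods.
Variable R : realType.
Local Notation C := (cplx R).
Variables (n : nat) (f : {poly C}).
Hypothesis size_f : size f = n.+2.
Implicit Types (g h c : {poly C}) (t : C) (a b : C * C -> C).
Implicit Types (La : (C * C -> C) -> C).

Let q : {poly C} := 'X^2.
Let lint := @lint R f q.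

(* What the integrals over a cycle of the fibre over t satisfy as functions   *)
(* of the form.                                                               *)
Definition period t La :=
  (forall a b (k : C -> C), lint a -> lint b ->
     La (fun z => a z + k (lev f q z) * b z) = La a + k t * La b) /\
  (forall S : bipoly R, La (form_tangent f q (exact_form S)) = 0).

Lemma dq y : q^`().[y] = 2 * y.
Proof. by rewrite /q derivXn hornerMn hornerXn expr1 mulr_natl. Qed.

Lemma bieval_monomial c j (z : C * C) : bieval (c%:P * 'X^j) z = c.[z.1] * z.2 ^+ j.
Proof. by rewrite /bieval !hornerE. Qed.

Lemma tangent_monomial c j (z : C * C) :
  form_tangent f q (exact_form (c%:P * 'X^j)) z =
  c^`().[z.1] * z.2 ^+ j * q^`().[z.2] - j%:R * c.[z.1] * z.2 ^+ j.-1 * f^`().[z.1].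
Proof.
rewrite /form_tangent /=.
have -> : dx (c%:P * 'X^j : bipoly R) = (c^`())%:P * 'X^j :> bipoly R.
  apply/polyP => i; rewrite /dx coef_map_id0 ?deriv0// !coefCM !coefXn.
  by case: (_ == _); rewrite ?mulr1// !mulr0 deriv0.
have -> : dy (c%:P * 'X^j : bipoly R) = (c *+ j)%:P * 'X^(j.-1) :> bipoly R.
  by rewrite /dy derivM derivC mul0r add0r derivXn mulrnAr polyCMn mulrnAl.
by rewrite !bieval_monomial hornerMn mulr_natl.
Qed.

Lemma lint_exact S : lint (form_tangent f q (exact_form S)).
Proof. by move=> z ns; exists (bieval S); exact: lprim_exact. Qed.

Lemma lint_add a b : lint a -> lint b -> lint (fun z => a z + b z).
Proof.
move=> la lb; apply: lint_ext (lint_axpy (fun=> 1) la lb) => z.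
by rewrite mul1r.
Qed.

Lemma lint0 : lint (fun=> 0).
Proof.
apply: lint_ext (lint_exact 0) => z; rewrite /form_tangent /= /dx map_poly0 /dy deriv0.
by rewrite !bieval0 !mul0r subr0.
Qed.

Lemma lint_scale (k : C) a : lint a -> lint (fun z => k * a z).
Proof.
move=> la; apply: lint_ext (lint_axpy (fun=> k) lint0 la) => z.
by rewrite add0r.
Qed.

Lemma lint_sum (I : Type) (s : seq I) (k : I -> C) (a : I -> C * C -> C) :
  (forall i, lint (a i)) -> lint (fun z => \sum_(i <- s) k i * a i z).
Proof.
move=> la; elim: s => [|i s IH].
  by apply: lint_ext lint0 => z; rewrite big_nil.
apply: lint_ext (lint_add (lint_scale (k i) (la i)) IH) => z.
by rewrite big_cons.
Qed.

(** [aJ g] and [aI g] are the forms [g(x) dx / F_y] and [g(x) y dx], evaluated on the tangent vector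
    [(q', - f')]. *)
Definition aJ g (z : C * C) := g.[z.1].
Definition aI g (z : C * C) := g.[z.1] * z.2 * q^`().[z.2].

Lemma aJ_sum g : (fun z => \sum_(i <- iota 0 (size g)) g`_i * aJ 'X^i z) = aJ g.
Proof.
apply/funext => z; rewrite /aJ [RHS]horner_coef -(big_mkord xpredT (fun i => g`_i * z.1 ^+ i)).
by rewrite /index_iota subn0; apply: eq_bigr => i _; rewrite hornerXn.
Qed.

Lemma aI_sum g : (fun z => \sum_(i <- iota 0 (size g)) g`_i * aI 'X^i z) = aI g.
Proof.
apply/funext => z; rewrite /aI -[g.[z.1]]/(aJ g z) -aJ_sum !mulr_suml.
by apply: eq_bigr => i _; rewrite /aJ !mulrA.
Qed.

Lemma lint_aJ g : lint (aJ g).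
Proof.
rewrite -aJ_sum; apply: lint_sum => i.
by apply: lint_ext (@lint_pow _ f q i) => z; rewrite /aJ hornerXn.
Qed.

Lemma lint_aI g : lint (aI g).
Proof.
rewrite -aI_sum; apply: lint_sum => i.
by apply: lint_ext (@lint_pow_dx _ f q i) => z; rewrite /aI hornerXn.
Qed.

Section fixed_period.
Variables (t : C) (La : (C * C -> C) -> C).
Hypothesis per : period t La.

Lemma La_add a b : lint a -> lint b -> La (fun z => a z + b z) = La a + La b.
Proof.
move=> la lb; rewrite -[La b]mul1r -(per.1 a b (fun=> 1) la lb); congr La.
by apply/funext => z; rewrite mul1r.
Qed.

Lemma La0 : La (fun=> 0) = 0.
Proof.
have := per.2 0; have -> // : form_tangent f q (exact_form 0) = fun=> 0.
apply/funext => z.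
by rewrite /form_tangent /= /dx map_poly0 /dy deriv0 !bieval0 !mul0r subr0.
Qed.

Lemma La_scale (k : C) a : lint a -> La (fun z => k * a z) = k * La a.
Proof.
move=> la; have := per.1 _ _ (fun=> k) lint0 la; rewrite La0 add0r => <-.
by congr La; apply/funext => z; rewrite add0r.
Qed.

Lemma La_sum (I : Type) (s : seq I) (k : I -> C) (a : I -> C * C -> C) :
  (forall i, lint (a i)) ->
  La (fun z => \sum_(i <- s) k i * a i z) = \sum_(i <- s) k i * La (a i).
Proof.
move=> la; elim: s => [|i s IH].
  rewrite big_nil; transitivity (La (fun=> 0)); last exact: La0.
  by congr La; apply/funext => z; rewrite big_nil.
rewrite big_cons -IH -La_scale// -La_add; last exact: lint_sum.
  by congr La; apply/funext => z; rewrite big_cons.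
exact: lint_scale.
Qed.

Lemma La_aJ g : La (aJ g) = \sum_(i <- iota 0 (size g)) g`_i * La (aJ 'X^i).
Proof. by rewrite -aJ_sum; apply: La_sum => i; exact: lint_aJ. Qed.

Lemma La_aI g : La (aI g) = \sum_(i <- iota 0 (size g)) g`_i * La (aI 'X^i).
Proof. by rewrite -aI_sum; apply: La_sum => i; exact: lint_aI. Qed.

Lemma aID g h : La (aI (g + h)) = La (aI g) + La (aI h).
Proof.
rewrite -La_add; try exact: lint_aI.
by congr La; apply/funext => z; rewrite /aI hornerD; ring.
Qed.

Lemma aIZ (k : C) g : La (aI (k *: g)) = k * La (aI g).
Proof.
rewrite -La_scale; last exact: lint_aI.
by congr La; apply/funext => z; rewrite /aI hornerZ !mulrA.
Qed.

Lemma aJD g h : La (aJ (g + h)) = La (aJ g) + La (aJ h).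
Proof.
rewrite -La_add; try exact: lint_aJ.
by congr La; apply/funext => z; rewrite /aJ hornerD.
Qed.

(* d (g(x) y) *)
Lemma periodJ g : La (aJ (f^`() * g)) = La (aI g^`()).
Proof.
have := per.2 (g%:P * 'X^1).
have -> : form_tangent f q (exact_form (g%:P * 'X^1)) =
    fun z => aI g^`() z + (-1) * aJ (f^`() * g) z.
  apply/funext => z; rewrite tangent_monomial /aI /aJ hornerM expr1 expr0; ring.
rewrite (per.1 _ _ (fun=> -1) (lint_aI _) (lint_aJ _)) mulN1r => /eqP.
by rewrite subr_eq0 => /eqP.
Qed.

(* y^2 = t - f(x) *)
Lemma periodI g : La (aI g) = 2 * t * La (aJ g) - 2 * La (aJ (f * g)).
Proof.
have -> : aI g = fun z => (-2) * aJ (f * g) z + 2 * lev f q z * aJ g z.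
  apply/funext => z; rewrite /aI /aJ /lev dq /q hornerXn hornerM expr2; ring.
rewrite (per.1 _ _ (fun s => 2 * s) (lint_scale _ (lint_aJ _)) (lint_aJ _)).
by rewrite La_scale; [ring|exact: lint_aJ].
Qed.

(* d (g(x) y^3) *)
Lemma period_reduction g :
  La (aI (f * g^`() + (3 / 2) *: (f^`() * g))) = t * La (aI g^`()).
Proof.
have := per.2 (g%:P * 'X^3).
have -> : form_tangent f q (exact_form (g%:P * 'X^3)) =
    fun z => (-1) * aI (f * g^`() + (3 / 2) *: (f^`() * g)) z + lev f q z * aI g^`() z.
  apply/funext => z; rewrite tangent_monomial /aI /lev dq /q hornerXn !hornerE /=.
  by field.
rewrite (per.1 _ _ id (lint_scale _ (lint_aI _)) (lint_aI _)).
rewrite La_scale; last exact: lint_aI.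
by rewrite mulN1r addrC => /eqP; rewrite subr_eq0 => /eqP.
Qed.

End fixed_period.

(** The coefficients are chosen before [t] and [La], so one polynomial vector serves for all fibres
    and all cycles. *)
Definition red a (D : nat) := lint a /\ exists v : 'I_n -> {poly C},
  (forall k, (size (v k) <= D)%N) /\
  forall t La, period t La -> La a = \sum_k (v k).[t] * La (aI 'X^k).

Lemma red_ext a b D : a =1 b -> red a D -> red b D.
Proof. by move=> /funext ->. Qed.

Lemma red_le a D D' : (D <= D')%N -> red a D -> red a D'.
Proof.
move=> DD [la [v [sv vE]]]; split=> //; exists v; split=> // k.
exact: leq_trans DD.
Qed.

Lemma red_axpy a b k D D' : red a D -> red b D' ->
  red (fun z => a z + k.[lev f q z] * b z) (maxn D (D' + (size k).-1)).
Proof.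
move=> [la [v [sv vE]]] [lb [w [sw wE]]]; split; first exact: (lint_axpy (horner k)).
exists (fun i => v i + k * w i); split=> [i|t La per].
  apply: leq_trans (size_polyD _ _) _; rewrite geq_max !leq_max sv /=.
  apply/orP; right; apply: leq_trans (size_polyMleq _ _) _.
  by move: (sw i); move: (size (w i)) (size k) => x y; lia.
rewrite (per.1 _ _ (horner k) la lb) (vE _ _ per) (wE _ _ per) mulr_sumr -big_split.
by apply: eq_bigr => i _; rewrite /= hornerD hornerM; ring.
Qed.

Lemma red0 D : red (fun=> 0) D.
Proof.
split; first exact: lint0.
exists (fun=> 0); split=> [k|t La per]; first by rewrite size_poly0.
by rewrite (La0 per) big1// => i _; rewrite horner0 mul0r.
Qed.

Lemma red_exact S D : red (form_tangent f q (exact_form S)) D.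
Proof.
split; first exact: lint_exact.
exists (fun=> 0); split=> [k|t La per]; first by rewrite size_poly0.
by rewrite per.2 big1// => i _; rewrite horner0 mul0r.
Qed.

Lemma red_comb a b (k : C) D : red a D -> red b D -> red (fun z => a z + k * b z) D.
Proof.
move=> ra rb; have := red_axpy k%:P ra rb.
have -> : maxn D (D + (size k%:P).-1) = D by have := size_polyC_leq1 k; lia.
by apply: red_ext => z; rewrite hornerC.
Qed.

Lemma red_sum (I : Type) (s : seq I) (a : I -> C * C -> C) D :
  (forall i, red (a i) D) -> red (fun z => \sum_(i <- s) a i z) D.
Proof.
move=> H; elim: s => [|i s IH]; first by apply: red_ext (red0 D) => z; rewrite big_nil.
by apply: red_ext (red_comb 1 (H i) IH) => z; rewrite big_cons mul1r.
Qed.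

Lemma lead_df : f^`()`_n = lead_coef f * n.+1%:R.
Proof. by rewrite coef_deriv lead_coefE size_f /= mulr_natr. Qed.

Lemma size_df : (size f^`() <= n.+1)%N.
Proof. by rewrite (leq_trans (leq_size_deriv _))// size_f. Qed.

Lemma lf0 : lead_coef f != 0.
Proof. by rewrite lead_coef_eq0 -size_poly_gt0 size_f. Qed.

(** [period_reduction] for [x^m], [m = s - n], trades the polynomial [h] of degree [s] for [t] times
    the derivative of [x^m]. The coefficient of [x^s] in [h] is the leading coefficient of [f] times
    [m + 3 (n + 1) / 2], which is nonzero, so a multiple of [h] removes the top term of [g] at the
    cost of one degree in [t]. *)
Lemma red_I s : forall g, (size g <= s)%N -> red (aI g) s.+1.
Proof.
elim: s => [|s IH] g sg.
  have -> : aI g = fun=> 0; last exact: red0.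
  move: sg; rewrite leqn0 size_poly_eq0 => /eqP ->.
  by apply/funext => z; rewrite /aI horner0 !mul0r.
have [sn|ns] := ltnP s n.
  split; first exact: lint_aI.
  exists (fun k => (g`_k)%:P); split=> [k|t La per].
    exact: leq_trans (size_polyC_leq1 _) _.
  rewrite (La_aI per).
  have -> : \sum_(k < n) (g`_k)%:P.[t] * La (aI 'X^k) = \sum_(0 <= k < n) g`_k * La (aI 'X^k).
    by rewrite big_mkord; apply: eq_bigr => k _; rewrite hornerC.
  rewrite (big_cat_nat _ (n := size g)) //=; last exact: leq_trans sg sn.
  rewrite [X in _ = _ + X]big1_seq ?addr0; first by rewrite /index_iota subn0.
  move=> i /= ; rewrite mem_index_iota => /andP[gi _].
  by rewrite nth_default// mul0r.
pose m := (s - n)%N; have sm : s = (m + n)%N by rewrite subnK.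
pose h := f * ('X^m)^`() + (3 / 2) *: (f^`() * 'X^m).
have dXm : (size ('X^m : {poly C})^`() <= m)%N.
  by rewrite (leq_trans (leq_size_deriv _))// size_polyXn.
have sh : (size h <= s.+1)%N.
  rewrite (leq_trans (size_polyD _ _))// geq_max; apply/andP; split.
    rewrite (leq_trans (size_polyMleq _ _))// size_f; lia.
  rewrite (leq_trans (size_scale_leq _ _))// (leq_trans (size_polyMleq _ _))//.
  by rewrite size_polyXn; have := size_df; lia.
have hs : h`_s = lead_coef f * (m%:R + 3 / 2 * n.+1%:R).
  rewrite coefD coefZ coefMXn sm ltnNge leq_addr /= addKn lead_df.
  have -> : (f * ('X^m)^`())`_(m + n) = lead_coef f * m%:R.
    rewrite derivXn; case: (m) => [|m']; first by rewrite mulr0n mulr0 coef0 mulr0.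
    rewrite /= mulrnAr coefMn coefMXn addSnnS ltnNge leq_addr /= addKn.
    by rewrite lead_coefE size_f /= mulr_natr.
  by ring.
have hs0 : h`_s != 0.
  rewrite hs; apply: mulf_neq0; first exact: lf0.
  have -> : m%:R + 3 / 2 * n.+1%:R = (m.*2 + 3 * n.+1)%N%:R / 2 :> C.
    by rewrite natrD natrM -mul2n natrM; field.
  by rewrite mulf_neq0 ?invr_eq0 ?pnatr_eq0//; lia.
pose k := g`_s / h`_s; pose g0 := g - k *: h.
have sg0 : (size g0 <= s)%N.
  apply/leq_sizeP => j; rewrite leq_eqVlt => /predU1P[<-|sj].
    by rewrite coefB coefZ /k divfK// subrr.
  by rewrite coefB coefZ !nth_default ?mulr0 ?subr0//; exact: leq_trans sj.
have r0 := IH _ sg0; have r1 : red (aI ('X^m)^`()) s.+1.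
  by apply: IH; rewrite (leq_trans dXm)// sm leq_addr.
have := red_axpy (k *: 'X) r0 r1.
move=> /(@red_le _ _ s.+2)[].
  have : (size (k *: 'X : {poly C}) <= 2)%N.
    by rewrite (leq_trans (size_scale_leq _ _))// size_polyX.
  by lia.
move=> _ [v [sv vE]]; split; first exact: lint_aI.
exists v; split=> // t La per; rewrite -(vE _ _ per).
rewrite (per.1 _ _ (horner (k *: 'X)) r0.1 r1.1) hornerZ hornerX -mulrA.
rewrite -(period_reduction per) -(aIZ per) -(aID per); congr (La (aI _)).
by rewrite /g0 /h subrK.
Qed.

Definition aK c (j : nat) (z : C * C) := c.[z.1] * z.2 ^+ j * q^`().[z.2].

(** Since [y^2 = t - f(x)], the exponent of [y] drops by 2 while the degree in [x] rises by [n + 1]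
    or that in [t] by 1. For [j = 0] the form [c(x) dx] is exact; [j = 1] is [red_I]. *)
Lemma red_K j : forall c s, (size c <= s)%N -> red (aK c j) (s + n.+2 * j).+1.
Proof.
have [k] := ubnP j; elim: k j => // k IH [|[|j]] jk c s sc.
- have [g gE] : exists g, g^`() = c.
    exists (\poly_(i < (size c).+1) (if i is i'.+1 then c`_i' / i'.+1%:R else 0)).
    apply/polyP => i; rewrite coef_deriv coef_poly ltnS.
    case: ltnP => ic; last by rewrite mul0rn nth_default.
    by rewrite /= -[LHS]mulr_natr divfK// pnatr_eq0.
  apply: red_ext (red_exact (g%:P * 'X^0) _) => z.
  by rewrite tangent_monomial gE /aK !mul0r subr0.
- have -> : aK c 1 = aI c by apply/funext => z; rewrite /aK expr1.
  apply: red_le (red_I sc); lia.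
- have r1 := IH j (ltnW jk) _ _ sc.
  have sfc : (size (f * c)%R <= s + n.+1)%N.
    by rewrite (leq_trans (size_polyMleq _ _))// size_f; lia.
  have r2 := IH j (ltnW jk) _ _ sfc.
  have r3 := red_comb (-1) (red0 _) r2.
  have := red_axpy 'X r3 r1; rewrite size_polyX => /(@red_le _ _ (s + n.+2 * j.+2).+1)[].
    by rewrite !mulnS; lia.
  move=> la H; have E : (fun z => 0 + -1 * aK (f * c) j z + 'X.[lev f q z] * aK c j z)
      = aK c j.+2.
    apply/funext => z; rewrite /aK /lev hornerX hornerM /q hornerXn !exprS; ring.
  by rewrite -E.
Qed.

Lemma bieval_sum (F : bipoly R) (z : C * C) :
  bieval F z = \sum_(j <- iota 0 (size F)) (F`_j).[z.1] * z.2 ^+ j.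
Proof.
rewrite /bieval (horner_coef F) horner_sum -(big_mkord xpredT (fun j => (F`_j * z.2%:P ^+ j).[z.1])).
rewrite /index_iota subn0; apply: eq_bigr => j _.
by rewrite hornerM -polyC_exp hornerC.
Qed.

(** Integrating the coefficient of [dy] in [y] gives a polynomial [S]; modulo its differential the
    form becomes [P1 dx], which is treated one power of [y] at a time. *)
Lemma red_form (w : form1 R) (m : nat) :
  (forall j, (size ((form_dx w)`_j)%R <= m)%N) -> (size (form_dx w) <= m)%N ->
  (forall j, (size ((form_dy w)`_j)%R <= m)%N) -> (size (form_dy w) <= m)%N ->
  red (form_tangent f q w) (n.+3 * m.+2).
Proof.
case: w => P Q /= sPx sPy sQx sQy.
pose S : bipoly R := \poly_(i < (size Q).+1) (if i is i'.+1 then i'.+1%:R^-1 *: Q`_i' else 0).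
have dS : dy S = Q.
  apply/polyP => i; rewrite coef_deriv coef_poly ltnS.
  case: ltnP => ic; last by rewrite mul0rn nth_default.
  by rewrite /= -[LHS]scaler_nat scalerA divff ?scale1r// pnatr_eq0.
pose P1 := P - dx S.
have sS j : (size (S`_j)%R <= m)%N.
  rewrite coef_poly; case: ifP => _; last by rewrite size_poly0.
  case: j => [|j]; first by rewrite size_poly0.
  exact: leq_trans (size_scale_leq _ _) _.
have sP1 j : (size (P1`_j)%R <= m)%N.
  rewrite coefB /dx coef_map_id0 ?deriv0//.
  rewrite (leq_trans (size_polyD _ _))// size_polyN geq_max sPx.
  by rewrite (leq_trans (leq_size_deriv _))// (leq_trans (leq_pred _)).
(* The antiderivative in [y] raises the degree in [y] by one. *)
have sP : (size P1 <= m.+1)%N.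
  have sdS : (size (dx S) <= (size Q).+1)%N.
    exact: leq_trans (size_poly _ _) (size_poly _ _).
  by rewrite (leq_trans (size_polyD _ _))// size_polyN geq_max (leq_trans sPy)//= (leq_trans sdS).
have rP : red (fun z => \sum_(j <- iota 0 (size P1)) aK P1`_j j z) (n.+3 * m.+2).
  have -> : (fun z => \sum_(j <- iota 0 (size P1)) aK P1`_j j z) =
     (fun z => \sum_(j <- iota 0 (size P1)) if (j < m.+1)%N then aK P1`_j j z else 0).
    apply/funext => z; apply: eq_big_seq => j; rewrite mem_iota add0n => /= jP.
    by rewrite (leq_trans jP sP).
  apply: red_sum => j; case: ltnP => [jm|_]; last exact: red0.
  apply: red_le (red_K j (sP1 j)).
  have : (n.+2 * j <= n.+2 * m)%N by rewrite leq_mul2l.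
  by rewrite !mulSn !mulnS; lia.
apply: red_ext (red_comb 1 rP (red_exact S _)) => z.
rewrite mul1r /form_tangent /= dS.
have -> : \sum_(j <- iota 0 (size P1)) aK P1`_j j z = bieval P1 z * q^`().[z.2].
  by rewrite bieval_sum mulr_suml.
have -> : bieval P1 z = bieval P z - bieval (dx S) z by rewrite /bieval !hornerE.
by ring.
Qed.

End periods.

(** * Degrees of determinants and adjugates *)

Section polynomial_matrices.
Variable K : fieldType.

Lemma size_det (m s : nat) (M : 'M[{poly K}]_m) :
  (forall i j, (size (M i j) <= s.+1)%N) -> (size (\det M) <= (m * s).+1)%N.
Proof.
move=> sM; apply: leq_trans (size_sum _ _ _) _; apply/bigmax_leqP => sg _.
rewrite size_Msign; apply: leq_trans (size_poly_prod_leq _ _) _.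
rewrite cardT size_enum_ord leq_subLR.
have : (\sum_(i < m) size (M i (sg i)) <= \sum_(i < m) s.+1)%N by exact: leq_sum.
by rewrite sum_nat_const card_ord mulnS addnS ltnS.
Qed.

Lemma size_adj (m s : nat) (M : 'M[{poly K}]_m) i j :
  (forall i j, (size (M i j) <= s.+1)%N) -> (size (\adj M i j) <= (m * s).+1)%N.
Proof.
move=> sM; rewrite mxE /cofactor size_Msign.
have := @size_det m.-1 s (row' j (col' i M)).
move=> /(_ _)/leq_trans; apply=> [k l|]; first by rewrite !mxE.
by rewrite ltnS leq_mul2r leq_pred orbT.
Qed.

End polynomial_matrices.

(** * The Picard-Fuchs system *)

Section picard_fuchs.
Variable R : realType.
Local Notation C := (cplx R).
Variables (n : nat) (f : {poly C}).
Hypothesis size_f : size f = n.+2.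
Let q : {poly C} := 'X^2.

Lemma df_neq0 : f^`() != 0.
Proof.
apply/eqP => E; have := lead_df size_f; rewrite E coef0 => /esym/eqP.
by rewrite mulf_eq0 (negPf (lf0 size_f)) pnatr_eq0.
Qed.

Lemma size_df_eq : size f^`() = n.+1.
Proof.
apply/eqP; rewrite eqn_leq size_df//= ltnNge; apply/negP => /leq_sizeP/(_ _ (leqnn _)).
by rewrite (lead_df size_f) => /eqP; rewrite mulf_eq0 (negPf (lf0 size_f)) pnatr_eq0.
Qed.

(** Division of [f x^k] by [f'] with quotient [Q_k], together with [periodI] and [periodJ], gives
    [(t - A) J = B I]; multiplying by the adjugate of [t - A] gives the system, with [D] the
    characteristic polynomial of [A]. The matrix [A] represents multiplication by [f] modulo [f'],
    so the roots of [D] are critical values. *)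
Lemma picard_fuchs : exists (D : {poly C}) (M : 'M[{poly C}]_n), [/\
  (size D <= n.+1)%N, forall i j, (size (M i j) <= n.+1)%N,
  forall t, (forall z, lev f q z = t -> nonsing f q z) -> D.[t] != 0 &
  forall t La, period f t La -> forall k : 'I_n,
    D.[t] * La (aJ 'X^k) = \sum_l (M k l).[t] * La (aI 'X^l)].
Proof.
pose Q (k : nat) := (f * 'X^k) %/ f^`(); pose r (k : nat) := (f * 'X^k) %% f^`().
have fE k : f * 'X^k = Q k * f^`() + r k by exact: divp_eq.
have sr k : (size (r k) <= n)%N.
  by rewrite -ltnS -size_df_eq ltn_modp df_neq0.
have sQ k : (k < n)%N -> (size (Q k)^`() <= n)%N.
  move=> kn; apply: leq_trans (leq_size_deriv _) _.
  rewrite size_divp ?df_neq0// size_df_eq /=.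
  have : (size (f * 'X^k)%R <= n.+2 + k)%N.
    by rewrite (leq_trans (size_polyMleq _ _))// size_polyXn size_f; lia.
  by move=> h; apply: (@leq_trans (n.+2 + k - n).-1); [rewrite -!subn1 leq_sub2r// leq_sub2r|lia].
(* Row [k] of [A] lists the coefficients of [f x^k] modulo [f']; [B] collects the term [I_k / 2] of
   [periodI] and the derivative of [Q_k]. *)
pose A : 'M[C]_n := \matrix_(k, l) (r k)`_l.
pose B : 'M[C]_n := \matrix_(k, l) ((k == l)%:R / 2 + (Q k)^`()`_l).
exists (char_poly A), (\adj (char_poly_mx A) *m map_mx polyC B).
have sA i j : (size (char_poly_mx A i j) <= 2)%N.
  rewrite !mxE (leq_trans (size_polyD _ _))// geq_max size_polyN.
  rewrite (leq_trans (size_polyC_leq1 _))// andbT.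
  by case: (i == j); rewrite ?mulr1n ?mulr0n ?size_polyX ?size_poly0.
split.
- by rewrite size_char_poly.
- move=> i j; rewrite mxE (leq_trans (size_sum _ _ _))//.
  apply/bigmax_leqP => k _; rewrite (leq_trans (size_polyMleq _ _))//.
  have := size_adj i k sA; rewrite muln1.
  have : (size (map_mx polyC B k j) <= 1)%N by rewrite mxE size_polyC_leq1.
  by move=> h1 h2; apply: (@leq_trans (n.+1 + 1).-1); [rewrite -!subn1 leq_sub2r// leq_add|lia].
- move=> t nst; apply/negP => /eqP Dt.
  have : root (char_poly A) t by apply/eqP.
  rewrite -eigenvalue_root_char => /eigenvalueP[v vA v0].
  pose g := \sum_(k < n) v 0 k *: 'X^k : {poly C}.
  have gE : g = \poly_(k < n) (if insub k is Some i then v 0 i else 0).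
    by rewrite poly_def; apply: eq_bigr => k _; rewrite valK.
  have sg : (size g <= n)%N by rewrite gE size_poly.
  have gk (k : 'I_n) : g`_k = v 0 k by rewrite gE coef_poly ltn_ord valK.
  have vr : \sum_(k < n) v 0 k *: r k = t *: g.
    apply/polyP => l; rewrite coef_sum coefZ.
    have [ln|nl] := ltnP l n; last first.
      rewrite nth_default ?mulr0 ?(leq_trans sg)// big1// => k _.
      by rewrite coefZ nth_default ?mulr0 ?(leq_trans (sr k)).
    have := congr1 (fun x : 'rV_n => x 0 (Ordinal ln)) vA.
    rewrite !mxE -(gk (Ordinal ln)) /= => <-.
    by apply: eq_bigr => k _; rewrite coefZ mxE.
  have dv : f^`() %| (f - t%:P) * g.
    have -> : (f - t%:P) * g = (\sum_(k < n) v 0 k *: Q k) * f^`().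
      rewrite mulrBl mul_polyC -vr /g mulr_sumr mulr_suml -sumrB.
      by apply: eq_bigr => k _; rewrite -scalerAr fE scalerDr addrK scalerAl.
    exact: dvdp_mulIr.
  (* A common root [c] would make [(c, 0)] a singular point of the fibre. Thus [f'] divides the
     eigenvector polynomial [g], whose degree is too small. *)
  have cop : coprimep f^`() (f - t%:P).
    rewrite coprimep_def; apply/negPn/negP => sz.
    have [c] : exists c, root (gcdp f^`() (f - t%:P)) c by apply/closed_rootP.
    rewrite root_gcd => /andP[/eqP fc1 /eqP]; rewrite !hornerE => /eqP.
    rewrite subr_eq0 => /eqP fc2.
    have := nst (c, 0); rewrite /lev /= fc2 /q hornerXn expr0n /= addr0 => /(_ erefl).
    by case=> /=; rewrite ?fc1 ?eqxx// derivXn hornerMn hornerXn expr1 mul0rn eqxx.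
  rewrite Gauss_dvdpr// in dv.
  have g0 : g = 0.
    apply/eqP/negPn/negP => gn0; have := dvdp_leq gn0 dv.
    by rewrite size_df_eq leqNgt ltnS sg.
  case/eqP: v0; apply/rowP => k; by rewrite -gk g0 coef0 mxE.
- move=> t La per k.
  pose I : 'cV[C]_n := \col_l La (aI 'X^l); pose J : 'cV[C]_n := \col_l La (aJ 'X^l).
  have E : (t%:M - A) *m J = B *m I.
    apply/colP => i; rewrite mulmxBl mul_scalar_mx !mxE.
    have sumJ (g : {poly C}) : (size g <= n)%N -> La (aJ g) = \sum_(l < n) g`_l * La (aJ 'X^l).
      move=> sg; rewrite (La_aJ per) -(big_mkord xpredT (fun l => g`_l * La (aJ 'X^l))).
      rewrite (big_cat_nat _ (n := size g))//= [X in _ + X]big1_seq ?addr0.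
        by rewrite /index_iota subn0.
      by move=> l /=; rewrite mem_index_iota => /andP[gl _]; rewrite nth_default// mul0r.
    have sumI (g : {poly C}) : (size g <= n)%N -> La (aI g) = \sum_(l < n) g`_l * La (aI 'X^l).
      move=> sg; rewrite (La_aI per) -(big_mkord xpredT (fun l => g`_l * La (aI 'X^l))).
      rewrite (big_cat_nat _ (n := size g))//= [X in _ + X]big1_seq ?addr0.
        by rewrite /index_iota subn0.
      by move=> l /=; rewrite mem_index_iota => /andP[gl _]; rewrite nth_default// mul0r.
    have e1 := periodI per 'X^i; rewrite fE (aJD per) mulrC (mulrC (Q i)) in e1.
    rewrite (periodJ per) (sumJ _ (sr i)) (sumI _ (sQ _ (ltn_ord i))) in e1.
    have -> : \sum_j A i j * J j 0 = \sum_(l < n) (r i)`_l * La (aJ 'X^l).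
      by apply: eq_bigr => l _; rewrite !mxE.
    have -> : \sum_j B i j * I j 0 =
       La (aI 'X^i) / 2 + \sum_(l < n) (Q i)^`()`_l * La (aI 'X^l).
      rewrite (eq_bigr (fun l : 'I_n => (i == l)%:R * (La (aI 'X^l) / 2) +
        (Q i)^`()`_l * La (aI 'X^l))); last by move=> l _; rewrite !mxE; ring.
      rewrite big_split /=; congr (_ + _).
      rewrite (bigD1 i)//= eqxx mul1r big1 ?addr0// => l li.
      by rewrite eq_sym (negPf li) mul0r.
    by rewrite e1; field.
  have adjE : map_mx (horner_eval t) (char_poly_mx A) = t%:M - A.
    apply/matrixP => i j; rewrite !mxE /horner_eval hornerD hornerN hornerC.
    by case: (i == j); rewrite ?mulr1n ?mulr0n ?hornerX ?horner0.
  have := congr1 (fun X => map_mx (horner_eval t) X) (mul_adj_mx (char_poly_mx A)).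
  rewrite map_mxM adjE map_scalar_mx => dE.
  have := congr1 (fun X => X *m J) dE; rewrite mul_scalar_mx -mulmxA E.
  move=> /(congr1 (fun X : 'cV_n => X k 0)); rewrite [in RHS]mxE [J k 0]mxE => <-.
  have BE : B = map_mx (horner_eval t) (map_mx polyC B).
    by apply/matrixP => i j; rewrite !mxE /horner_eval hornerC.
  rewrite {1}BE.
  rewrite mulmxA -map_mxM [LHS]mxE; apply: eq_bigr => l _.
  by rewrite [map_mx _ _ k l]mxE [I l 0]mxE.
Qed.

End picard_fuchs.

(** * A relation between the iterated derivatives *)

Section derivation_chain.
Variables (K : fieldType) (n s d0 : nat) (D : {poly K}) (M : 'M[{poly K}]_n).
Variable v : nat -> 'rV[{poly K}]_n.
Hypothesis sD : (size D <= s.+1)%N.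
Hypothesis sM : forall i j, (size (M i j) <= s.+1)%N.
Hypothesis sv0 : forall j, (size (v 0%N ord0 j) <= d0)%N.

(** If [D I' = M I], then [D] times the derivative of [u . I] is [der u . I]. *)
Definition der (u : 'rV[{poly K}]_n) : 'rV[{poly K}]_n :=
  D *: map_mx (@deriv K) u + u *m M.

Hypothesis vS : forall k, v k.+1 = der (v k) - (D^`() *+ k) *: v k.

Lemma derD u w : der (u + w) = der u + der w.
Proof.
rewrite /der mulmxDl; apply/rowP => j; rewrite !mxE derivD; ring.
Qed.

Lemma derZ c u : der (c *: u) = c *: der u + (D * c^`()) *: u.
Proof.
rewrite /der -scalemxAl scalerDr; apply/rowP => j; rewrite !mxE derivM; ring.
Qed.

Lemma der_sum (I : Type) (r : seq I) (F : I -> 'rV_n) :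
  der (\sum_(i <- r) F i) = \sum_(i <- r) der (F i).
Proof.
elim: r => [|i r IH]; last by rewrite !big_cons derD IH.
rewrite !big_nil /der mul0mx addr0; apply/rowP => j.
by rewrite !mxE deriv0 mulr0.
Qed.

Lemma size_v k j : (size (v k ord0 j) <= d0 + k * s)%N.
Proof.
elim: k j => [|k IH] j; first by rewrite addn0.
have sDk (a b : {poly K}) : (size a <= s.+1)%N -> (size b <= d0 + k * s)%N ->
    (size (a * b)%R <= d0 + k.+1 * s)%N.
  move=> sa sb; apply: leq_trans (size_polyMleq _ _) _; rewrite mulSn.
  apply: (@leq_trans (s.+1 + (d0 + k * s)).-1); last by lia.
  by rewrite -!subn1 leq_sub2r// leq_add.
have sd (a : {poly K}) m : (size a <= m)%N -> (size a^`() <= m)%N.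
  move=> sa; apply: leq_trans (size_poly _ _) _.
  exact: leq_trans (leq_pred _) sa.
rewrite vS /der !mxE; apply: leq_trans (size_polyD _ _) _; rewrite size_polyN geq_max.
apply/andP; split.
  apply: leq_trans (size_polyD _ _) _; rewrite geq_max; apply/andP; split.
    by apply: sDk => //; exact: sd.
  apply: leq_trans (size_sum _ _ _) _; apply/bigmax_leqP => i _.
  by rewrite mulrC; exact: sDk.
by rewrite mulrnAl -mulrnAr; apply: sDk; [exact: sd|
  apply: leq_trans (IH j); rewrite -scaler_nat; exact: size_scale_leq].
Qed.

Lemma scale_polyI (c : {poly K}) (m : nat) (u w : 'rV[{poly K}]_m) :
  c != 0 -> c *: u = c *: w -> u = w.
Proof.
move=> c0 /rowP E; apply/rowP => j; apply: (mulfI c0).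
by have := E j; rewrite !mxE.
Qed.

Section torsion.
Variables (r : nat) (phi : 'I_r -> 'I_n).
Let V : 'M[{poly K}]_(r, n) := \matrix_(i < r) v i.
Let G : 'M[{poly K}]_r := colsub phi V.
Hypothesis G0 : \det G != 0.

(** Membership in the span of [v 0, ..., v r.-1] over the field of fractions, with denominators
    cleared. *)
Definition tors (u : 'rV[{poly K}]_n) := exists c y, c != 0 /\ c *: u = y *m V.

Lemma torsD u w : tors u -> tors w -> tors (u + w).
Proof.
move=> [c [y [c0 cu]]] [c' [y' [c'0 cw]]]; exists (c * c'), (c' *: y + c *: y').
split; first by rewrite mulf_neq0.
by rewrite mulmxDl -!scalemxAl -cu -cw scalerDr !scalerA (mulrC c').
Qed.

Lemma torsZ a u : tors u -> tors (a *: u).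
Proof.
move=> [c [y [c0 cu]]]; exists c, (a *: y); split=> //.
by rewrite -scalemxAl -cu !scalerA mulrC.
Qed.

Lemma tors0 : tors 0.
Proof. by exists 1, 0; rewrite oner_neq0 scaler0 mul0mx. Qed.

Lemma tors_sum (I : Type) (l : seq I) (F : I -> 'rV_n) :
  (forall i, tors (F i)) -> tors (\sum_(i <- l) F i).
Proof.
move=> H; elim: l => [|i l IH]; first by rewrite big_nil; exact: tors0.
by rewrite big_cons; exact: torsD.
Qed.

Lemma torsVZ a u : a != 0 -> tors (a *: u) -> tors u.
Proof.
move=> a0 [c [y [c0 cu]]]; exists (c * a), y; split; first by rewrite mulf_neq0.
by rewrite -cu scalerA.
Qed.

Lemma tors_v (i : 'I_r) : tors (v i).
Proof.
exists 1, (delta_mx 0 i); rewrite oner_neq0 scale1r; split=> //.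
by rewrite -rowE rowK.
Qed.

Hypothesis tors_r : tors (v r).

(** The span is stable because [der (v i)] is [v i.+1] up to a multiple of [v i], and [v r] belongs
    to the span. Denominators pass through [der] by the Leibniz rule. *)
Lemma tors_der u : tors u -> tors (der u).
Proof.
move=> tu; have [c [y [c0 cu]]] := tu.
apply: (torsVZ c0); have -> : c *: der u = der (c *: u) + (- (D * c^`())) *: u.
  by rewrite derZ scaleNr addrK.
apply: torsD; last exact: torsZ.
rewrite cu; have -> : y *m V = \sum_i y 0 i *: v i.
  by rewrite mulmx_sum_row; apply: eq_bigr => i _; rewrite rowK.
rewrite der_sum; apply: tors_sum => i; rewrite derZ; apply: torsD; apply: torsZ.
  have -> : der (v i) = v i.+1 + (D^`() *+ i) *: v i by rewrite vS subrK.
  apply: torsD; last by apply: torsZ; exact: tors_v.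
  have [ir|ri] := ltnP i.+1 r; first exact: (tors_v (Ordinal ir)).
  by have -> : i.+1 = r by apply/eqP; rewrite eqn_leq ri ltn_ord.
exact: tors_v.
Qed.

Lemma tors_all k : tors (v k).
Proof.
have [kr|rk] := ltnP k r; first exact: (tors_v (Ordinal kr)).
rewrite -(subnK rk); elim: (k - r)%N => // m IH; rewrite addSn vS.
apply: torsD; first exact: tors_der.
by rewrite -scaleNr; exact: torsZ.
Qed.

(** Cramer's rule on the columns [phi] determines the coordinates; the point is that the single
    denominator [\det G] works for every vector of the span. *)
Lemma tors_cramer u : tors u -> \det G *: u = (colsub phi u *m \adj G) *m V.
Proof.
move=> [c [y [c0 cu]]].
have E : c *: colsub phi u = y *m G.
  apply/rowP => j; have := congr1 (fun X : 'rV_n => X 0 (phi j)) cu.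
  rewrite !mxE => ->; apply: eq_bigr => i _; congr (_ * _); by rewrite !mxE.
apply: (scale_polyI c0); rewrite scalerA mulrC -scalerA cu !scalemxAl E.
by rewrite -[y *m G *m _]mulmxA mul_mx_adj mul_mx_scalar.
Qed.

End torsion.

Definition minor (r : nat) (phi : 'I_r -> 'I_n) : 'M[{poly K}]_r :=
  \matrix_(i < r, j < r) v i 0 (phi j).

(** The rows of the minors are always the first ones of the sequence, so [r] marks a place where
    independence breaks. The empty minor is 1, and a minor of size [n + 1] repeats a column, so a
    break occurs at some [r] not exceeding [n]. *)
Lemma max_minor : exists r (phi : 'I_r -> 'I_n), [/\ (r <= n)%N, \det (minor phi) != 0 &
  forall psi : 'I_r.+1 -> 'I_n, \det (minor psi) = 0].
Proof.
pose P r := exists phi : 'I_r -> 'I_n, \det (minor phi) != 0.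
have nP : ~ P n.+1.
  move=> [phi /eqP]; apply.
  have /injectivePn[i [j ij pij]] : ~~ injectiveb phi.
    apply/negP => /injectiveP/leq_card.
    by rewrite !card_ord ltnn.
  rewrite -det_tr; apply: (determinant_alternate ij) => k.
  by rewrite !mxE pij.
have f0 : 'I_0 -> 'I_n by case.
have P0 : P 0%N by exists f0; rewrite det_mx00 oner_neq0.
suff [r [rn [phi phi0] nPr]] : exists r, [/\ (r <= n)%N, P r & ~ P r.+1].
  exists r, phi; split=> // psi; apply/eqP/negPn/negP => h.
  by apply: nPr; exists psi.
apply: contrapT => H; apply: nP.
have step r : (r <= n)%N -> P r -> P r.+1.
  by move=> rn Pr; apply: contrapT => nPr; apply: H; exists r.
have: forall r, (r <= n.+1)%N -> P r.
  by elim=> [//|r IH] rn; apply: step => //; apply: IH; exact: ltnW.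
exact.
Qed.

(** Add an arbitrary column [j] to the [r] chosen ones: the minor of size [r + 1] vanishes. Its
    cofactors along that column do not depend on [j], so they are the coefficients of a relation, in
    which that of [v r] is the nonzero minor. *)
Lemma tors_next (r : nat) (phi : 'I_r -> 'I_n) : \det (minor phi) != 0 ->
  (forall psi : 'I_r.+1 -> 'I_n, \det (minor psi) = 0) -> tors r (v r).
Proof.
move=> g0 H.
pose N : 'M[{poly K}]_(r.+1, r) := \matrix_(i, k) v i 0 (phi k).
pose c (i : 'I_r.+1) : {poly K} := (-1) ^+ (i + r) * \det (row' i N).
have rel : \sum_(i < r.+1) c i *: v i = 0.
  apply/rowP => j; rewrite summxE [RHS]mxE.
  pose psi (k : 'I_r.+1) := if unlift ord_max k is Some k' then phi k' else j.
  transitivity (\det (minor psi)); last exact: H psi.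
  rewrite (expand_det_col _ ord_max); apply: eq_bigr => i _.
  rewrite mulrC !mxE /psi unlift_none; congr (_ * _).
  rewrite /cofactor /c /=; congr (_ * \det _).
  by apply/matrixP => a b; rewrite !mxE liftK.
have cr : c ord_max = \det (minor phi).
  rewrite /c /= -signr_odd oddD addbb expr0 mul1r; congr (\det _).
  by apply/matrixP => a b; rewrite !mxE lift_max.
exists (\det (minor phi)), (\row_(i < r) - c (widen_ord (leqnSn r) i)); split=> //.
move: rel; rewrite big_ord_recr /= cr addrC => /eqP; rewrite addr_eq0 => /eqP ->.
rewrite mulmx_sum_row -sumrN; apply: eq_bigr => i _.
by rewrite rowK !mxE scaleNr.
Qed.

(** By Cramer's rule [g v_k = w_k V] with [w_k] polynomial, so modulo the lattice spanned by the
    rows of [V], [v_k] is determined by the residue of [w_k] modulo [g]. These residues fill at most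
    [r deg g] dimensions over [K]. Among [v_r, v_{r+1}, ...] a nontrivial combination with constant
    coefficients thus lies in the lattice, and it can be solved for its last term without
    introducing denominators. *)
Lemma chain_stops (e : nat) : (d0 + n * s <= e.+1)%N ->
  exists N (c : nat -> {poly K}), (N <= n + n * (n * e))%N /\
    v N = \sum_(j < N) c j *: v j.
Proof.
move=> de; have [r [phi [rn g0 H]]] := max_minor.
have tr := tors_next g0 H.
have GE : minor phi = colsub phi (\matrix_(i < r) v i).
  by apply/matrixP => i j; rewrite !mxE.
rewrite GE in g0; set V := \matrix_(i < r) v i in g0 GE.
set g := \det (colsub phi V) in g0.
have sg : (size g <= (r * e).+1)%N.
  rewrite /g -GE; apply: size_det => i j; rewrite mxE.
  apply: leq_trans (size_v i (phi j)) _; apply: leq_trans de.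
  by rewrite leq_add2l leq_mul2r (leq_trans (ltnW (ltn_ord i)) rn) orbT.
pose w k := colsub phi (v k) *m \adj (colsub phi V).
have wE k : g *: v k = w k *m V by apply: tors_cramer => //; exact: tors_all.
pose dg := (size g).-1; pose m := (r * dg)%N.
(* Row [k] lists the coefficients of the residues of the entries of [w_{r+k}] modulo [g]. With one
   row more than columns, there is a nonzero left kernel vector. *)
pose W : 'M[K]_(m.+1, m) := \matrix_(k < m.+1)
  mxvec (\matrix_(i < r, l < dg) ((w (r + k)%N 0 i) %% g)`_l).
have : kermx W != 0.
  by rewrite -mxrank_eq0 mxrank_ker -lt0n subn_gt0 ltnS rank_leq_col.
move=> /rowV0Pn[la /sub_kermxP laW la0].
have {la0} : exists k : 'I_m.+1, la 0 k != 0.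
  by move: la0 => /rV0Pn.
move=> [k0 k00].
(* The last index with a nonzero coefficient: this coefficient is an invertible constant, so
   [v_{r+k}] can be isolated. *)
case: (@arg_maxnP _ k0 (fun k => la 0 k != 0) val k00) => k kn0 kmax.
pose y : 'rV[{poly K}]_r := \row_i \sum_(j < m.+1) (la 0 j)%:P * (w (r + j)%N 0 i %/ g).
have wy : \sum_(j < m.+1) (la 0 j)%:P *: w (r + j)%N = g *: y.
  apply/rowP => i; rewrite summxE [in RHS]mxE [y 0 i]mxE mulr_sumr.
  apply/eqP; rewrite -subr_eq0 -sumrB.
  rewrite (eq_bigr (fun j : 'I_m.+1 => la 0 j *: (w (r + j)%N 0 i %% g))); last first.
    move=> j _; rewrite [in LHS]mxE [X in _ * X](divp_eq _ g) -mul_polyC; ring.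
  apply/eqP/polyP => l; rewrite coef0 coef_sum.
  have [ldg|dgl] := ltnP l dg; last first.
    rewrite big1// => j _; rewrite coefZ nth_default ?mulr0//.
    by apply: leq_trans dgl; rewrite /dg -ltnS prednK ?size_poly_gt0// ltn_modp.
  have := congr1 (fun X : 'rV_m => X 0 (mxvec_index i (Ordinal ldg))) laW.
  rewrite !mxE => laE; rewrite -[RHS]laE; apply: eq_bigr => j _.
  by rewrite coefZ ?[W _ _]mxE mxvecE [in RHS]mxE.
have vy : \sum_(j < m.+1) (la 0 j)%:P *: v (r + j)%N = y *m V.
  apply: (scale_polyI g0); rewrite -/g scaler_sumr scalemxAl -wy mulmx_suml.
  apply: eq_bigr => j _.
  by rewrite -scalemxAl -wE scalerA mulrC -scalerA.
pose ll (j : nat) := if insub j is Some j' then la 0 (j' : 'I_m.+1) else 0.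
pose yy (j : nat) := if insub j is Some j' then y 0 (j' : 'I_r) else 0.
have lk : (ll k)^-1 * ll k = 1 by rewrite /ll valK mulVf.
exists (r + k)%N, (fun j => (ll k)^-1%:P * (if (j < r)%N then yy j else - (ll (j - r)%N)%:P)).
split.
  apply: leq_add => //; apply: leq_trans (_ : m <= _)%N; first by rewrite -ltnS.
  apply: leq_mul => //; rewrite /dg; apply: leq_trans (_ : r * e <= _)%N.
    by move: sg; case: (size g).
  by rewrite leq_mul2r rn orbT.
have E : \sum_(0 <= j < m.+1) (ll j)%:P *: v (r + j)%N = y *m V.
  by rewrite -vy big_mkord; apply: eq_bigr => j _; rewrite /ll valK.
have km : (k < m.+1)%N by [].
rewrite (big_cat_nat _ (n := k.+1))//= [X in _ + X]big1_seq ?addr0 in E; last first.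
  move=> j /=; rewrite mem_index_iota => /andP[kj jm].
  have -> : ll j = 0; last by rewrite scale0r.
  rewrite /ll insubT /=; apply/eqP/negPn/negP => /kmax jk.
  by have : (j <= k)%N := jk; rewrite leqNgt kj.
rewrite big_nat_recr//= in E.
have {}E : (ll k)%:P *: v (r + k)%N = y *m V - \sum_(0 <= j < k) (ll j)%:P *: v (r + j)%N.
  by apply/esym/eqP; rewrite subr_eq -E addrC.
have -> : v (r + k)%N = (ll k)^-1%:P *: ((ll k)%:P *: v (r + k)%N).
  by rewrite scalerA -polyCM lk scale1r.
rewrite E big_split_ord /= scalerDr; congr (_ + _).
  rewrite mulmx_sum_row scaler_sumr; apply: eq_bigr => j _.
  by rewrite rowK ltn_ord scalerA /yy valK.
rewrite big_mkord -sumrN scaler_sumr; apply: eq_bigr => j _.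
by rewrite ltnNge leq_addr /= addKn -scaleNr scalerA.
Qed.

End derivation_chain.

(** * Continuation of the zeros *)

Section ode.
Variable R : realType.
Local Notation C := (cplx R).
Implicit Types (f g : C -> C) (t : C).

Lemma qd_lip f t df : qd f t df -> exists2 L : R, 0 <= L &
  \forall t' \near t, nm (f t' - f t) <= L * nm (t' - t).
Proof.
move=> [K [K0 H]]; exists (K + nm df); first by rewrite addr_ge0 ?nm_ge0.
have H1 : \forall t' \near t, nm (t' - t) < 1 by apply/nbhs_nm; exists 1.
apply: filterS2 H H1 => t' h h1.
rewrite -[f t' - f t](subrK (df * (t' - t))); apply: le_trans (nmD _ _) _.
rewrite mulrDl nmM lerD2r; apply: le_trans h _; rewrite ler_wpM2l// expr2.
by rewrite ler_piMr ?nm_ge0 ?ltW.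
Qed.

Lemma qd_near_lt f t df (e : R) : 0 < e -> qd f t df ->
  \forall t' \near t, nm (f t' - f t) < e.
Proof.
move=> e0 /qd_lip[L L0 H].
have L1 : 0 < L + 1 by rewrite ltr_wpDl.
have H1 : \forall t' \near t, nm (t' - t) < e / (L + 1).
  by apply/nbhs_nm; exists (e / (L + 1)) => //; rewrite divr_gt0.
apply: filterS2 H H1 => t' h; rewrite ltr_pdivlMr// => h1.
by have := nm_ge0 (t' - t); lra.
Qed.

Lemma qd_neq0 f t df : qd f t df -> f t != 0 -> \forall t' \near t, f t' != 0.
Proof.
move=> h; rewrite -nm_gt0 => f0; apply: filterS (qd_near_lt f0 h) => t'.
by apply: contraTneq => ->; rewrite sub0r nmN ltxx.
Qed.

Lemma qd_poly (u : {poly C}) t : qd (horner u) t u^`().[t].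
Proof.
have [M [M0 _ _ H]] := cd_poly u (@disc_bounded _ t 1).
exists M; split=> //; apply/nbhs_nm; exists 1 => // t' t1.
by apply: H => //; rewrite /disc /= subrr nm0.
Qed.

Lemma qdM f g t df dg : qd f t df -> qd g t dg ->
  qd (fun x => f x * g x) t (df * g t + f t * dg).
Proof.
move=> hf hg; have [K [K0 HK]] := hf; have [M [M0 HM]] := hg.
have [L L0 HL] := qd_lip hg.
exists (K * (nm (g t) + 1) + nm (f t) * M + nm df * L); split.
  by rewrite !addr_ge0 ?mulr_ge0 ?addr_ge0 ?nm_ge0.
apply: filterS2 (filterI HK HM) (filterI HL (qd_near_lt (ltr01) hg)) => t' [h1 h2] [h3 h4].
have h5 : nm (g t') <= nm (g t) + 1.
  by rewrite -[g t'](subrK (g t)) addrC (le_trans (nmD _ _))// lerD2l ltW.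
have -> : f t' * g t' - f t * g t - (df * g t + f t * dg) * (t' - t) =
  (f t' - f t - df * (t' - t)) * g t' + f t * (g t' - g t - dg * (t' - t)) +
  df * (t' - t) * (g t' - g t) by ring.
apply: le_trans (nmD3 (nmM_le h1 h5) (nmM_le (lexx _) h2)
  (nmM_le (lexx (nm (df * (t' - t)))) h3)) _.
by rewrite nmM le_eqVlt; apply/orP; left; apply/eqP; ring.
Qed.

Lemma qdV f t df : f t != 0 -> qd f t df ->
  qd (fun x => (f x)^-1) t (- df / f t ^+ 2).
Proof.
move=> f0 hf; have [K [K0 HK]] := hf; have [L L0 HL] := qd_lip hf.
have n0 : 0 < nm (f t) by rewrite nm_gt0.
set m := nm (f t) in n0; have m0 := ltW n0.
exists ((m * K + nm df * L) * (2 / m ^+ 3)); split.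
  by rewrite mulr_ge0 ?addr_ge0 ?mulr_ge0 ?nm_ge0 ?invr_ge0 ?exprn_ge0.
have m2 : 0 < m / 2 by rewrite divr_gt0.
apply: filterS2 (filterI HK HL) (filterI (qd_neq0 hf f0) (qd_near_lt m2 hf)).
move=> t' [h1 h2] [h3 h4].
have h5 : m / 2 <= nm (f t').
  have : m <= nm (f t') + nm (f t' - f t).
    rewrite /m nm_sym -[X in nm X <= _](subrK (f t')) addrC.
    exact: nmD.
  lra.
have -> : (f t')^-1 - (f t)^-1 - - df / f t ^+ 2 * (t' - t) =
  (- f t * (f t' - f t - df * (t' - t)) + df * (t' - t) * (f t' - f t)) *
  (f t ^+ 2 * f t')^-1 by field; rewrite f0 h3.
rewrite nmM [leRHS]mulrAC; apply: ler_pM; rewrite ?nm_ge0//.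
  apply: le_trans (nmD _ _) _; rewrite [leRHS]mulrDl; apply: lerD.
    by rewrite nmM nmN -/m -mulrA ler_wpM2l.
  apply: le_trans (nmM_le (lexx (nm (df * (t' - t)))) h2) _.
  by rewrite nmM le_eqVlt; apply/orP; left; apply/eqP; ring.
have m'0 : 0 < nm (f t') by rewrite nm_gt0.
rewrite nmV nmM nmX -/m -[leRHS]invrK lef_pV2 ?posrE ?invr_gt0 ?divr_gt0 ?mulr_gt0 ?exprn_gt0//.
rewrite invf_div; have -> : m ^+ 3 / 2 = m ^+ 2 * (m / 2) by ring.
by rewrite ler_wpM2l// exprn_ge0// ltW.
Qed.

(* Iterating the mean value inequality halves any bound on a small disc.      *)
Lemma ode_zero (N : nat) (A : 'I_N -> 'I_N -> C -> C) (dA : 'I_N -> 'I_N -> C)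
    (Y : 'I_N -> C -> C) t0 :
  (forall i j, qd (A i j) t0 (dA i j)) ->
  (\forall t \near t0, forall i, qd (Y i) t (\sum_j A i j t * Y j t)) ->
  (forall i, Y i t0 = 0) -> \forall t \near t0, forall i, Y i t = 0.
Proof.
move=> hA hY Y0.
pose K := \sum_i \sum_j (nm (A i j t0) + 1).
have K0 : 0 <= K by rewrite sumr_ge0// => i _; rewrite sumr_ge0// => j _; rewrite addr_ge0 ?nm_ge0.
have KA : \forall t \near t0, forall i, \sum_j nm (A i j t) <= K.
  have : \forall t \near t0, forall i, i \in enum 'I_N -> forall j, j \in enum 'I_N ->
      nm (A i j t) <= nm (A i j t0) + 1.
    apply: near_all_seq => i _; apply: near_all_seq => j _.
    apply: filterS (qd_near_lt ltr01 (hA i j)) => t h.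
    by rewrite -[A i j t](subrK (A i j t0)) addrC (le_trans (nmD _ _))// lerD2l ltW.
  apply: filterS => t h i; rewrite /K [leRHS](bigD1 i)//= -[leLHS]addr0 lerD//.
    by apply: ler_sum => j _; apply: h; rewrite mem_enum.
  by rewrite sumr_ge0// => k _; rewrite sumr_ge0// => j _; rewrite addr_ge0 ?nm_ge0.
have YB : \forall t \near t0, forall i, nm (Y i t) <= 1.
  have : \forall t \near t0, forall i, i \in enum 'I_N -> nm (Y i t) <= 1.
    apply: near_all_seq => i _.
    apply: filterS (qd_near_lt ltr01 (nbhs_singleton hY i)) => t.
    by rewrite Y0 subr0 => /ltW.
  by apply: filterS => t h i; apply: h; rewrite mem_enum.
have [r r0 rH] : exists2 r : R, 0 < r & forall t, nm (t - t0) < r ->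
    [/\ forall i, qd (Y i) t (\sum_j A i j t * Y j t),
        forall i, \sum_j nm (A i j t) <= K & forall i, nm (Y i t) <= 1].
  have : \forall t \near t0, [/\ forall i, qd (Y i) t (\sum_j A i j t * Y j t),
        forall i, \sum_j nm (A i j t) <= K & forall i, nm (Y i t) <= 1].
    by apply: filterS2 hY (filterI KA YB) => t h1 [h2 h3].
  by move=> /nbhs_nm.
have K1 : 0 < 2 * (K + 1) by rewrite mulr_gt0 ?ltr_wpDl.
(* With this radius, [K] times the distance to [t0] is at most 1/2, so each use of the mean value
   inequality halves the bound. *)
apply/nbhs_nm; exists (Num.min r (2 * (K + 1))^-1); first by rewrite lt_min r0 invr_gt0.
have bound m : forall t, nm (t - t0) < Num.min r (2 * (K + 1))^-1 ->
    forall i, nm (Y i t) <= 2^-1 ^+ m.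
  elim: m => [|m IH] t tr i.
    by move: tr; rewrite lt_min expr0 => /andP[/rH[_ _]].
  have sr u : 0 <= u <= 1 -> nm (seg t0 t u - t0) < Num.min r (2 * (K + 1))^-1.
    move=> /andP[u0 u1]; rewrite seg_itv ger0_norm//; apply: le_lt_trans tr.
    by rewrite ler_piMl ?nm_ge0.
  have := @mean_value_seg _ (Y i) (fun t => \sum_j A i j t * Y j t)
    [set t | nm (t - t0) < Num.min r (2 * (K + 1))^-1] t0 t (K * 2^-1 ^+ m) sr.
  have h1 x : nm (x - t0) < Num.min r (2 * (K + 1))^-1 ->
      forall e : R, 0 < e -> exists2 d, 0 < d & forall y, nm (y - t0) < Num.min r (2 * (K + 1))^-1 ->
      nm (y - x) < d -> nm (Y i y - Y i x - (\sum_j A i j x * Y j x) * (y - x)) <= e * nm (y - x).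
    rewrite lt_min => /andP[/rH[/(_ i)[M [M0 /nbhs_nm[d d0 dH]]] _ _] _] e e0.
    have M1 : 0 < M + 1 by rewrite ltr_wpDl.
    exists (Num.min d (e / (M + 1))); first by rewrite lt_min d0 divr_gt0.
    move=> y _; rewrite lt_min ltr_pdivlMr// => /andP[/dH h h2].
    apply: le_trans h _; rewrite expr2 mulrA ler_wpM2r ?nm_ge0//.
    by have := nm_ge0 (y - x); lra.
  have h2 u : 0 <= u <= 1 ->
      nm (\sum_j A i j (seg t0 t u) * Y j (seg t0 t u)) <= K * 2^-1 ^+ m.
    move=> /sr su; have {}IH := IH _ su; move: su; rewrite lt_min => /andP[/rH[_ hK _] _].
    apply: le_trans (nm_sum _ _ _) _; apply: le_trans (ler_wpM2r _ (hK i)); last first.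
      by rewrite exprn_ge0.
    by rewrite mulr_suml; apply: ler_sum => j _; rewrite nmM ler_wpM2l ?nm_ge0.
  move=> /(_ h1 h2); rewrite Y0 subr0 => h; apply: le_trans h _.
  rewrite exprSr -mulrA mulrCA ler_wpM2l ?exprn_ge0//.
  have : nm (t - t0) < (2 * (K + 1))^-1 by move: tr; rewrite lt_min => /andP[].
  rewrite -[_^-1]mul1r ltr_pdivlMr// => h3.
  by have := nm_ge0 (t - t0); lra.
move=> t tr i; apply/eqP; rewrite -nm_eq0 eq_le nm_ge0 andbT.
apply/ler_addgt0Pl => e e0; rewrite addr0.
have [m me] : exists m, 2^-1 ^+ m < e :> R.
  have := @cvg_geometric R 1 2^-1; rewrite ger0_norm// => /(_ _)/cvgrPdist_lt.
  have h : 2^-1 < 1 :> R by lra.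
  move=> /(_ h e e0) [m _ /(_ m (leqnn m))] /=.
  rewrite mul1r sub0r normrN ger0_norm ?exprn_ge0// => ?.
  by exists m.
exact: le_trans (bound m t tr i) (ltW me).
Qed.

End ode.

(** * Iterated derivatives of combinations of periods *)

Section gauss_manin.
Variable R : realType.
Local Notation C := (cplx R).
Variables (n : nat) (D : {poly C}) (M : 'M[{poly C}]_n).
Implicit Types (u : 'rV[{poly C}]_n) (t : C).

Definition comb u (x : 'I_n -> C) t : C := \sum_k (u ord0 k).[t] * x k.

Lemma combD u u' x t : comb (u + u') x t = comb u x t + comb u' x t.
Proof.
by rewrite /comb -big_split; apply: eq_bigr => k _; rewrite mxE hornerD mulrDl.
Qed.

Lemma combZ (c : {poly C}) u x t : comb (c *: u) x t = c.[t] * comb u x t.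
Proof.
by rewrite /comb mulr_sumr; apply: eq_bigr => k _; rewrite mxE hornerM mulrA.
Qed.

Lemma comb_sum (N : nat) (F : 'I_N -> 'rV[{poly C}]_n) x t :
  comb (\sum_j F j) x t = \sum_j comb (F j) x t.
Proof.
rewrite /comb exchange_big; apply: eq_bigr => k _.
by rewrite summxE horner_sum mulr_suml.
Qed.

Definition solution (x : 'I_n -> C -> C) t := D.[t] != 0 /\
  forall k, qd (x k) t ((\sum_l (M k l).[t] * x l t) / D.[t]).

Lemma qd_comb u x t : solution x t ->
  qd (fun s => comb u (x^~ s) s) t (comb (der D M u) (x^~ t) t / D.[t]).
Proof.
move=> [D0 H].
have : qd (fun s => comb u (x^~ s) s) t
    (\sum_k ((u ord0 k)^`().[t] * x k t + (u ord0 k).[t] * ((\sum_l (M k l).[t] * x l t) / D.[t]))).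
  by apply: qd_sum => k _; apply: qdM; first exact: qd_poly.
congr (qd _ _ _); rewrite /comb /der big_split /=.
have -> : \sum_k (u ord0 k).[t] * ((\sum_l (M k l).[t] * x l t) / D.[t]) =
    (\sum_k (\sum_l u ord0 l * M l k).[t] * x k t) / D.[t].
  rewrite mulr_suml; under eq_bigr do rewrite mulr_suml mulr_sumr.
  rewrite exchange_big; apply: eq_bigr => k _ /=.
  rewrite horner_sum !mulr_suml; apply: eq_bigr => l _.
  by rewrite hornerM; ring.
have -> : \sum_k (u ord0 k)^`().[t] * x k t =
    (\sum_k (D * (u ord0 k)^`()).[t] * x k t) / D.[t].
  rewrite mulr_suml; apply: eq_bigr => k _; rewrite hornerM; field; exact: D0.
rewrite -mulrDl -big_split; congr (_ / _); apply: eq_bigr => k _.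
by rewrite !mxE hornerD mulrDl.
Qed.

Variable v : nat -> 'rV[{poly C}]_n.
Hypothesis vS : forall k, v k.+1 = der D M (v k) - (D^`() *+ k) *: v k.
Variables (x : 'I_n -> C -> C) (t0 : C).
Hypothesis sol : \forall t \near t0, solution x t.

Lemma comb_der k t : comb (der D M (v k)) (x^~ t) t =
  comb (v k.+1) (x^~ t) t + (D^`().[t] *+ k) * comb (v k) (x^~ t) t.
Proof.
have -> : der D M (v k) = v k.+1 + (D^`() *+ k) *: v k by rewrite vS subrK.
by rewrite combD combZ hornerMn.
Qed.

(** The term of [vS] subtracting [k D'] times [v k] is what differentiating the denominator [D ^+ k]
    produces, so the formula reproduces itself. *)
Lemma derive1n_comb (g : C -> C) : (\forall t \near t0, g t = comb (v 0%N) (x^~ t) t) ->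
  forall k, \forall t \near t0, derive1n k g t = comb (v k) (x^~ t) t / (D ^+ k).[t].
Proof.
move=> gE; elim=> [|k IH].
  by apply: filterS gE => t E; rewrite derive1n0 E expr0 hornerC divr1.
apply: filterS2 (nm_near_near IH) sol => t E st; have [D0 _] := st.
have Dk0 : (D ^+ k).[t] != 0 by rewrite horner_exp expf_neq0.
have := qdM (qd_comb (v k) st) (qdV Dk0 (qd_poly _ t)).
move=> /(qd_near E)/qd_is_derive[_ dE].
rewrite derive1nS derive1E dE comb_der deriv_exp.
move: (comb (v k) _ _) (comb (v k.+1) _ _) => c c'.
case: k {IH E Dk0 dE} => [|k]; rewrite !hornerE /= ?horner_exp.
  by field.
rewrite hornerMn hornerM horner_exp !exprS; field; by rewrite D0 expf_neq0.
Qed.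

End gauss_manin.

Section continuation.
Variable R : realType.
Local Notation C := (cplx R).
Variables (n : nat) (D : {poly C}) (M : 'M[{poly C}]_n).
Variables (v : nat -> 'rV[{poly C}]_n) (N : nat) (c : nat -> {poly C}).
Hypothesis vS : forall k, v k.+1 = der D M (v k) - (D^`() *+ k) *: v k.
Hypothesis vN : v N = \sum_(j < N) c j *: v j.

(** By [vN] the [N] combinations form a closed linear system with denominator [D], nonzero at [t0];
    uniqueness is [ode_zero]. *)
Lemma comb_near_zero (x : 'I_n -> C -> C) t0 : (\forall t \near t0, solution D M x t) ->
  (forall j, (j < N)%N -> comb (v j) (x^~ t0) t0 = 0) ->
  \forall t \near t0, forall j, (j < N)%N -> comb (v j) (x^~ t) t = 0.
Proof.
(* A companion matrix, whose last row holds the coefficients of [vN], plus the diagonal terms [i D']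
   that undo the correction in [vS]. *)
move=> sol x0; pose P (i j : 'I_N) : {poly C} :=
  (if (i.+1 < N)%N then (i.+1 == j)%:R else c j) + (D^`() *+ i) *+ (i == j).
have [D0 _] := nbhs_singleton sol.
have := @ode_zero R N (fun i j t => (P i j).[t] / D.[t]) _
  (fun i t => comb (v i) (x^~ t) t) t0 (fun i j => qdM (qd_poly _ _) (qdV D0 (qd_poly _ _))).
move=> H; have : \forall t \near t0, forall i : 'I_N, comb (v i) (x^~ t) t = 0.
  apply: H => [|i]; last exact: x0.
  apply: filterS sol => t st i; have := qd_comb (v i) st; congr (qd _ _ _).
  rewrite (comb_der vS); under [RHS]eq_bigr do rewrite mulrAC.
  rewrite -mulr_suml; congr (_ / _).
  under [RHS]eq_bigr do rewrite hornerD mulrDl.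
  rewrite big_split /=; congr (_ + _); last first.
    rewrite (bigD1 i)//= eqxx mulr1n hornerMn big1 ?addr0// => j ji.
    by rewrite eq_sym (negPf ji) mulr0n horner0 mul0r.
  have [iN|Ni] := ltnP i.+1 N.
    rewrite (bigD1 (Ordinal iN))//= eqxx hornerC mul1r big1 ?addr0// => j ji.
    have /negPf -> : i.+1 != j by rewrite eq_sym.
    by rewrite hornerC mul0r.
  have -> : i.+1 = N by apply/eqP; rewrite eqn_leq Ni ltn_ord.
  by rewrite vN comb_sum; apply: eq_bigr => j _; rewrite combZ.
by apply: filterS => t Ht j jN; exact: (Ht (Ordinal jN)).
Qed.

Variables (E : topologicalType) (p : E -> C) (X : E -> 'I_n -> C).
Hypothesis connE : connected [set: E].
Hypothesis cp : continuous p.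
Hypothesis local_solution : forall e0, exists2 x : 'I_n -> C -> C,
  \forall t \near p e0, solution D M x t &
  \forall e \near e0, X e = x^~ (p e).

(** The set where all the combinations vanish is open by [comb_near_zero] and closed by continuity.
    If it were nonempty it would be the whole connected space, contradicting the nonzero value at
    [e]. *)
Lemma chain_neq0 e : comb (v 0%N) (X e) (p e) != 0 ->
  forall e0, exists2 j, (j < N)%N & comb (v j) (X e0) (p e0) != 0.
Proof.
move=> e1 e0; apply: contrapT => H.
pose S := [set e | forall j, (j < N)%N -> comb (v j) (X e) (p e) = 0].
have S0 : S e0.
  by move=> j jN; apply/eqP/negPn/negP => h; apply: H; exists j.
have oS : open S.
  rewrite openE => e' Se'; have [x sol xE] := local_solution e'.
  have xe := nbhs_singleton xE.
  have h : \forall t \near p e', forall j, (j < N)%N -> comb (v j) (x^~ t) t = 0.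
    by apply: comb_near_zero => // j jN; have := Se' j jN; rewrite xe.
  have {}h : \forall y \near e', forall j, (j < N)%N -> comb (v j) (x^~ (p y)) (p y) = 0.
    exact: cp h.
  by apply: filterS2 h xE => y h1 h2 j jN; rewrite h2; exact: h1.
have cS : closed S.
  rewrite -openC openE => e' nSe'; have [x sol xE] := local_solution e'.
  have xe := nbhs_singleton xE.
  have [j jN j0] : exists2 j, (j < N)%N & comb (v j) (X e') (p e') != 0.
    apply: contrapT => h; apply: nSe' => j jN; apply/eqP/negPn/negP => h'.
    by apply: h; exists j.
  rewrite xe in j0.
  have h : \forall y \near e', comb (v j) (x^~ (p y)) (p y) != 0.
    exact: cp (qd_neq0 (qd_comb (v j) (nbhs_singleton sol)) j0).
  by apply: filterS2 h xE => y h1 h2 /(_ j jN)/eqP; rewrite h2 (negPf h1).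
have ST : S = setT.
  by apply: connE; [exists e0|exists S => //; rewrite setTI|exists S => //; rewrite setTI].
have Se : S e by rewrite ST.
move: e1 => /eqP; apply.
(* When [N] is 0 the vanishing conditions are empty, but the relation itself says that [v 0] is
   zero. *)
have [N0|N1] := posnP N; last exact: Se.
have -> : v 0%N = 0 by have := vN; rewrite N0 big_ord0.
by rewrite /comb big1// => k _; rewrite mxE horner0 mul0r.
Qed.

(** Some combination of index [j < N] is nonzero over [t0]; divided by [D ^+ j], it is the [j]-th
    derivative of the branch at [t0]. *)
Lemma vanishing_order_bound (g : E -> C) (branch : C -> E) t0 :
  (forall e, g e = comb (v 0%N) (X e) (p e)) -> (exists e, g e != 0) ->
  (\forall t \near t0, p (branch t) = t /\ {for t, continuous branch}) ->
  (vanishing_order t0 (g \o branch) <= N%:R%:E)%E.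
Proof.
move=> gE [e]; rewrite gE => /chain_neq0 /(_ (branch t0))[j jN j0] br.
have [pt0 cb] := nbhs_singleton br.
have [x] := local_solution (branch t0); rewrite pt0 => sol xE.
have gx : \forall t \near t0, (g \o branch) t = comb (v 0%N) (x^~ t) t.
  have h : \forall t \near t0, X (branch t) = x^~ (p (branch t)) by exact: cb _ xE.
  by apply: filterS2 h br => t h1 [h2 _]; rewrite /= gE h1 h2.
have := nbhs_singleton (derive1n_comb vS sol gx j).
have {}j0 : comb (v j) (x^~ t0) t0 != 0.
  by move: j0; rewrite (nbhs_singleton xE) pt0.
have [D0 _] := nbhs_singleton sol.
move=> dE; apply: (@le_trans _ _ (j%:R%:E)); last by rewrite lee_fin ler_nat ltnW.
apply: ereal_inf_lbound; exists j => //=.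
by rewrite dE mulf_neq0// invr_eq0 horner_exp expf_neq0.
Qed.

End continuation.

(** * Periods of a horizontal section *)

Section periods_along.
Variable R : realType.
Local Notation C := (cplx R).
Variables (n : nat) (f : {poly C}) (F : bipoly R).
Hypothesis FE : forall z, bieval F z = lev f 'X^2 z.
Variables (D : {poly C}) (M : 'M[{poly C}]_n).
Hypothesis D0 : forall t, (forall z, lev f 'X^2 z = t -> nonsing f 'X^2 z) -> D.[t] != 0.
Hypothesis DM : forall t La, period f t La -> forall k : 'I_n,
  D.[t] * La (aJ 'X^k) = \sum_l (M k l).[t] * La (aI 'X^l).
Variables (E : topologicalType) (p : E -> C) (delta : forall e, H1 R (level F (p e))).
Hypothesis ns : forall e z, lev f 'X^2 z = p e -> nonsing f 'X^2 z.
Hypothesis hs : horizontal_section delta.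

Definition basic_periods e : 'I_n -> C := fun k => hom f 'X^2 (aI 'X^k) (delta e).

(** All nearby classes are carried by one cycle representing [delta e0], moved by the
    trivialization. This yields functions of [t] itself, although the section is defined over
    [E]. *)
Lemma period_near e0 : exists La : C -> (C * C -> C) -> C,
  [/\ \forall t \near p e0, period f t (La t),
      forall k, \forall t \near p e0, qd (fun t => La t (aI 'X^k)) t (La t (aJ 'X^k)) &
      \forall e \near e0, forall a, lint f 'X^2 a -> hom f 'X^2 a (delta e) = La (p e) a].
Proof.
have [U [Phi triv tr]] := hs e0.
pose c := \val (repr (delta e0)).
have bc : boundary c = 0 by exact/eqP/(valP (repr (delta e0))).
have ns0 := @ns e0.
exists (fun t a => ch (fun s => Om f 'X^2 a (moved Phi t s)) c); split.
- apply: filterS (good_chain_near FE triv ns0 c) => t [Ut gt]; split=> [a b k la lb|S].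
    exact: (ch_moved_axpy FE triv k gt la lb).
  exact: (ch_moved_exact FE triv S bc gt).
- move=> k; have := transport_derivative FE triv ns0 k bc.
  have -> : (fun z : C * C => z.1 ^+ k * z.2 * ('X^2 : {poly C})^`().[z.2]) = aI 'X^k.
    by apply/funext => z; rewrite /aI hornerXn.
  have -> : (fun z : C * C => z.1 ^+ k) = aJ 'X^k.
    by apply/funext => z; rewrite /aJ hornerXn.
  by [].
- apply: filterS tr => e [_ te] a la.
  exact: (hom_transported FE (@ns e) la te).
Qed.

Lemma basic_periods_solution e0 : exists2 x : 'I_n -> C -> C,
  \forall t \near p e0, solution D M x t &
  \forall e \near e0, basic_periods e = x^~ (p e).
Proof.
have [La [per dLa homLa]] := period_near e0.
exists (fun k t => La t (aI 'X^k)); last first.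
  apply: filterS homLa => e H; apply/funext => k; apply: H; exact: lint_aI.
have Dn : \forall t \near p e0, D.[t] != 0 by exact: qd_neq0 (qd_poly D _) (D0 (@ns e0)).
have dn : \forall t \near p e0, forall k : 'I_n, k \in enum 'I_n ->
    qd (fun t => La t (aI 'X^k)) t (La t (aJ 'X^k)).
  by apply: (near_all_seq (P := fun (k : 'I_n) t =>
    qd (fun t => La t (aI 'X^k)) t (La t (aJ 'X^k)))) => k _; exact: dLa.
apply: filterS2 (filterI per dn) Dn => t [pt dt] Dt; split=> // k.
rewrite -(DM pt k) mulrAC divff// mul1r; apply: dt; exact: mem_enum.
Qed.

Lemma integral_comb (w : form1 R) (v : 'I_n -> {poly C}) e (g : C) :
  lint f 'X^2 (form_tangent f 'X^2 w) ->
  (forall t La, period f t La ->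
     La (form_tangent f 'X^2 w) = \sum_k (v k).[t] * La (aI 'X^k)) ->
  is_integral w (delta e) g ->
  g = comb (\row_k v k) (basic_periods e) (p e).
Proof.
move=> lw vE /(is_integral_hom FE (@ns e) lw) ->.
have [La [per _ homLa]] := period_near e.
rewrite (nbhs_singleton homLa _ lw) (vE _ _ (nbhs_singleton per)).
apply: eq_bigr => k _; rewrite mxE /basic_periods (nbhs_singleton homLa)//.
exact: lint_aI.
Qed.

End periods_along.

(** * From weighted degrees to sizes *)

Section degrees.
Variable R : realType.
Local Notation C := (cplx R).
Local Open Scope ereal_scope.

Lemma wdeg_coef n (F : bipoly R) i j : F`_j`_i != 0%R ->
  (i%:R * weight_x R + j%:R * weight_y R n)%:E <= wdeg n F.
Proof.
move=> Fij.
have jF : (j < size F)%N.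
  by rewrite ltnNge; apply: contra Fij => /leq_sizeP -> //; rewrite coef0.
have iF : (i < size (F`_j)%R)%N.
  by rewrite ltnNge; apply: contra Fij => /leq_sizeP ->.
rewrite /wdeg; apply: le_trans (le_bigmax _ _ (Ordinal jF)) => /=.
exact: (le_bigmax_cond _ (fun i : 'I_(size (F`_j)%R) =>
  (i%:R * weight_x R + j%:R * weight_y R n)%:E) (j := Ordinal iF)).
Qed.

Lemma wdeg_ge0 n (F : bipoly R) : wdeg n F = -oo \/ 0 <= wdeg n F.
Proof.
have max0 (x y : \bar R) : (x = -oo \/ 0 <= x) -> (y = -oo \/ 0 <= y) ->
    (maxe x y = -oo \/ 0 <= maxe x y).
  move=> [->|x0]; first by rewrite maxNye.
  by move=> _; right; rewrite le_max x0.
rewrite /wdeg; elim/big_ind: _ => [|x y|j _]; [by left|exact: max0|].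
elim/big_ind: _ => [|x y|i _]; [by left|exact: max0|right].
by rewrite lee_fin addr_ge0// ?mulr_ge0// /weight_x /weight_y ?divr_ge0.
Qed.

Lemma wdeg_sizes n (F : bipoly R) (a d : R) : (1 <= n)%N -> (1 <= a)%R ->
  wdeg n F + a%:E <= d%:E ->
  (size F <= Num.truncn d)%N /\ forall j, (size (F`_j)%R <= Num.truncn d)%N.
Proof.
move=> n1 a1 Fd.
have wy : (1 <= weight_y R n)%R.
  by rewrite /weight_y ler_pdivlMr// mul1r (ler_nat _ 2).
have H i j : F`_j`_i != 0%R -> (i + j < Num.truncn d)%N.
  move=> Fij; have h : ((i + j).+1%:R <= d)%R.
    have : (i%:R * weight_x R + j%:R * weight_y R n)%:E + a%:E <= d%:E.
      by apply: le_trans Fd; rewrite leeD2r// wdeg_coef.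
    rewrite -EFinD lee_fin; apply: le_trans; rewrite -natr1 lerD//.
    by rewrite natrD /weight_x mulr1 lerD2l ler_peMr.
  by rewrite truncn_ge_nat //; apply: le_trans h.
have size_le (G : {poly C}) j : ((G != 0)%R -> (((size G).-1 + j) < Num.truncn d)%N) ->
    (size G <= Num.truncn d)%N.
  have [->|G0] := eqVneq G 0%R; first by rewrite size_poly0.
  by move=> /(_ isT); have := size_poly_gt0 G; rewrite G0; lia.
split=> [|j]; last first.
  apply: (@size_le _ j) => G0; apply: H; by rewrite -lead_coefE lead_coef_eq0.
have [->|F0] := eqVneq F 0%R; first by rewrite size_poly0.
have l0 : (F`_(size F).-1)%R != 0%R by rewrite -lead_coefE lead_coef_eq0.
have := @H (size (F`_(size F).-1)%R).-1 (size F).-1.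
rewrite -[in X in X -> _]lead_coefE lead_coef_eq0 l0 => /(_ isT).
by have := size_poly_gt0 F; rewrite F0; lia.
Qed.

End degrees.

(** * Specialization to hyperelliptic Hamiltonians *)

Section hyperelliptic_curves.
Variable R : realType.
Local Notation C := (cplx R).

Lemma form_wdeg_ge0 n (w : form1 R) (d : R) : (1 <= n)%N -> form_wdeg n w = d%:E -> 0 <= d.
Proof.
move=> n1 wd; rewrite -lee_fin -wd /form_wdeg.
have wy : 0 <= weight_y R n by rewrite /weight_y divr_ge0.
have [H|H] := wdeg_ge0 n (form_dx w); last first.
  by rewrite le_max adde_ge0// lee_fin /weight_x ler01.
have [H'|H'] := wdeg_ge0 n (form_dy w); last first.
  by rewrite le_max orbC adde_ge0// lee_fin.
by move: wd; rewrite /form_wdeg H H'.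
Qed.

Lemma form_wdeg_sizes n (w : form1 R) (d : R) : (1 <= n)%N -> form_wdeg n w = d%:E ->
  let m := Num.truncn d in
  [/\ (size (form_dx w) <= m)%N, forall j, (size ((form_dx w)`_j)%R <= m)%N,
      (size (form_dy w) <= m)%N & forall j, (size ((form_dy w)`_j)%R <= m)%N].
Proof.
move=> n1 wd /=.
have [|hx hx'] := @wdeg_sizes R n (form_dx w) (weight_x R) d n1 (lexx _).
  by rewrite -wd /form_wdeg le_max lexx.
have wy : 1 <= weight_y R n by rewrite /weight_y ler_pdivlMr// mul1r (ler_nat _ 2).
have [|hy hy'] := @wdeg_sizes R n (form_dy w) (weight_y R n) d n1 wy.
  by rewrite -wd /form_wdeg le_max lexx orbT.
by [].
Qed.

Lemma hyperellipticE n (Hbar : {poly C}) (z : C * C) :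
  bieval (hyperelliptic n Hbar) z = lev (Hbar - 'X^(n.+1)) 'X^2 z.
Proof. rewrite /bieval /hyperelliptic /lev !hornerE; ring. Qed.

Lemma hyperelliptic_nonsing n (Hbar : {poly C}) t :
  regular_value (hyperelliptic n Hbar) t ->
  forall z, lev (Hbar - 'X^(n.+1)) 'X^2 z = t -> nonsing (Hbar - 'X^(n.+1)) 'X^2 z.
Proof.
move=> reg z zt; apply: contrapT => nns; apply: reg; exists z; last first.
  by rewrite hyperellipticE.
have [h1 h2] : ('X^2 : {poly C})^`().[z.2] = 0 /\ (Hbar - 'X^(n.+1))^`().[z.1] = 0.
  by split; apply/eqP/negPn/negP => h; apply: nns; [left|right].
have HE : hyperelliptic n Hbar = 'X * 'X + (Hbar - 'X^(n.+1))%:P.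
  by rewrite /hyperelliptic expr2 polyCB; ring.
rewrite HE; split.
  rewrite dxMXaddC bievalMXaddC h2 addr0 /dx.
  have -> : map_poly (@deriv C) 'X = 0.
    apply/polyP => i; rewrite coef_map_id0 ?deriv0// coefX coef0.
    by case: (_ == _); rewrite ?deriv0// -polyC1 derivC.
  by rewrite bieval0 mul0r.
rewrite /dy derivD derivC addr0 derivM derivX mul1r mulr1.
by rewrite -[RHS]h1 /bieval derivXn !hornerE; ring.
Qed.

Lemma size_hyperelliptic n (Hbar : {poly C}) : (size Hbar <= n)%N ->
  size (Hbar - 'X^(n.+1)) = n.+2.
Proof.
move=> sH; rewrite addrC size_polyDl size_polyN size_polyXn// ltnS.
exact: leq_trans sH _.
Qed.

End hyperelliptic_curves.

Theorem theorem3 (R : realType) (n : nat) (n_ge1 : (1 <= n)%N) :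
  exists A B : R,
    forall (Hbar : {poly cplx R}) (H : bipoly R),
      (size Hbar <= n)%N -> H = hyperelliptic n Hbar -> morse_type H ->
    forall (w : form1 R) (d : R), form_wdeg n w = d%:E ->
    forall (E : topologicalType) (p : E -> cplx R)
        (delta : forall e, H1 R (level H (p e))),
      connected [set: E] -> continuous p ->
      (forall e, regular_value H (p e)) ->
      horizontal_section delta ->
    forall abelian_integral : E -> cplx R,
      (forall e, is_integral w (delta e) (abelian_integral e)) ->
      (exists e, abelian_integral e != 0) ->
    forall t0 : cplx R, regular_value H t0 ->
    forall branch : cplx R -> E,
      (\forall t \near t0, p (branch t) = t /\ {for t, continuous branch}) ->
      (vanishing_order t0 (abelian_integral \o branch) <= (A + d * B)%:E)%E.
Proof.
pose b : R := (n * (n * n.+3))%:R.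
(* These expand the bound [n + n^2 (d0 + n^2)] of [chain_stops], where [d0 = (n + 3) (m + 2)] comes
   from [red_form] and [m] is the integer part of [d]. *)
exists ((n + n * (n * (n * n)))%:R + 2 * b), b.
move=> Hbar H sH -> _ w d wd E p delta connE cp reg hs g gint gn0 t0 _ branch br.
have sf := size_hyperelliptic sH.
have [sx sx' sy sy'] := form_wdeg_sizes n_ge1 wd.
have [lw [v0 [sv0 vE]]] := red_form sf sx' sx sy' sy.
have [D [M [sD sM D0 DM]]] := picard_fuchs sf.
have ns e := hyperelliptic_nonsing (reg e).
pose v := fix v k := if k is k'.+1 then der D M (v k') - (D^`() *+ k') *: v k'
  else \row_k v0 k.
have vS k : v k.+1 = der D M (v k) - (D^`() *+ k) *: v k by [].
have sv j : (size (v 0%N ord0 j) <= n.+3 * (Num.truncn d).+2)%N by rewrite mxE.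
(* Here [s] is [n], the degree bound in [picard_fuchs], and [e] is simply [d0 + n * n]. *)
have [N [c [NB vN]]] := chain_stops sD sM sv vS (leqnSn _).
have gE e : g e = comb (v 0%N) (basic_periods (Hbar - 'X^(n.+1)) delta e) (p e).
  exact: (integral_comb (@hyperellipticE R n Hbar) ns hs lw vE (gint e)).
have sol := basic_periods_solution (@hyperellipticE R n Hbar) D0 DM ns hs.
apply: le_trans (vanishing_order_bound vS vN connE cp sol gE gn0 br) _.
have d0 := form_wdeg_ge0 n_ge1 wd.
rewrite lee_fin.
apply: (@le_trans _ _ ((n + n * (n * (n * n)))%:R + 2 * b + (Num.truncn d)%:R * b)); last first.
  by rewrite lerD2l ler_wpM2r ?truncn_le.
rewrite /b -!natrM -!natrD ler_nat; apply: leq_trans NB _.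
by rewrite eq_leq//; ring.
Qed.
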